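(* Let $H$ be Kashina #8 or Kashina #9. Then $H$ acts inner-faithfully on the algebras $A=\frac{\mathbb{C}\langle u,v\rangle}{(r)}[t;\sigma]$ with $A_1=\pi(u,v)\oplus T(t)$, where $\pi$ is an irreducible two-dimensional representation given in the list below, $T$ is a one-dimensional representation with $x.t=\pm\mathrm{i}t$, $y.t=t$, $\sigma=\begin{bmatrix}\alpha&0\\0&-\alpha\end{bmatrix}$ (i.e. $\sigma(u)=\alpha u$, $\sigma(v)=-\alpha v$) with $\alpha\in\mathbb{C}^\times$, and $r=uv\pm vu$ or $r=u^2\pm v^2$. The invariant rings $A^H$ are: 1. #8, $\pi_1$, $uv-vu$: $\mathbb{C}[u^2v^2,\ u^4+v^4,\ uv(u^4-v^4),\ uv(u^2+v^2)t^2,\ (u^2-v^2)t^2,\ t^4]$. 2. #8, $\pi_1$, $uv+vu$: $\mathbb{C}[uv,\ u^4+v^4,\ (u^2-v^2)t^2,\ t^4]$. 3. #8, $\pi_1$, $u^2-v^2$: $\mathbb{C}[u^4,\ uv-vu,\ u^2(uv+vu)t^2,\ t^4]$. 4. #8, $\pi_1$, $u^2+v^2$: $\mathbb{C}[u^4,\ uv-vu,\ u^2t^2,\ t^4]$. 5. #8, $\pi_2$, $uv-vu$: $\mathbb{C}[u^2v^2,\ u^2+v^2,\ uvt^2,\ t^4]$. 6. #8, $\pi_2$, $uv+vu$: $\mathbb{C}[u^2v^2,\ u^2+v^2,\ uv(u^2-v^2)t^2,\ t^4]$. 7. #8, $\pi_2$, $u^2-v^2$: $\mathbb{C}[u^2,\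 (uv)^2+(vu)^2,\ (uv+vu)t^2,\ t^4]$. 8. #8, $\pi_2$, $u^2+v^2$: $\mathbb{C}[u^4,\ (uv)^2+(vu)^2,\ u^2((uv)^2-(vu)^2),\ u^2(uv-vu)t^2,\ (uv+vu)t^2,\ t^4]$. 9. #9, $\pi_1$, $uv-vu$: $\mathbb{C}[uv,\ u^4+v^4,\ (u^2-v^2)t^2,\ t^4]$. 10. #9, $\pi_1$, $uv+vu$: $\mathbb{C}[u^2v^2,\ u^4+v^4,\ uv(u^4-v^4),\ (u^2-v^2)t^2,\ uv(u^2+v^2)t^2,\ t^4]$. 11. #9, $\pi_1$, $u^2-v^2$: $\mathbb{C}[u^4,\ uv+vu,\ u^2(uv-vu)t^2,\ t^4]$. 12. #9, $\pi_1$, $u^2+v^2$: $\mathbb{C}[u^4,\ uv+vu,\ u^2t^2,\ t^4]$. 13. #9, $\pi_2$, $uv-vu$: $\mathbb{C}[u^2v^2,\ u^2+v^2,\ uv(u^2-v^2)t^2,\ t^4]$. 14. #9, $\pi_2$, $uv+vu$: $\mathbb{C}[u^2v^2,\ u^2+v^2,\ uvt^2,\ t^4]$. 15. #9, $\pi_2$, $u^2-v^2$: $\mathbb{C}[u^2,\ (uv)^2+(vu)^2,\ (uv-vu)t^2,\ t^4]$. 16. #9, $\pi_2$, $u^2+v^2$: $\mathbb{C}[u^4,\ (uv)^2+(vu)^2,\ u^2((uv)^2-(vu)^2),\ u^2(uv+vu)t^2,\ (uv-vu)t^2,\ t^4]$. Hence #8 and #9 are not reflection Hopf algebras for any of thes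e actions.
   Context: The base field is $\mathbb{C}$ and $\mathrm{i}=\sqrt{-1}$. Kashina #8 and #9 are the 16-dimensional semisimple Hopf algebras generated as algebras by commuting grouplike elements $x,y$ with $x^4=y^2=1$ and an element $z$ with $\epsilon(z)=1$, $$\Delta(z)=\tfrac12(1\otimes1+y\otimes1+1\otimes x^2-y\otimes x^2)(z\otimes z),$$ and relations $zx=xyz$, $zy=yz$, together with $z^2=1$ (#8), $z^2=y$ (#9). Irreducible two-dimensional representations $\pi_1,\pi_2$ with basis $u,v$: $y$ acts as $-1$; on $\pi_1$, $x.u=\mathrm{i}u$, $x.v=-\mathrm{i}v$; on $\pi_2$, $x.u=u$, $x.v=-v$; for #8, $z.u=v$, $z.v=u$; for #9, $z.u=v$, $z.v=-u$. One-dimensional representations with $x.t=\pm\mathrm{i}t$ satisfy $y.t=t$, $z.t=\pm t$. $B[t;\sigma]$ is the Ore extension with $tb=\sigma(b)t$; $u,v,t$ have degree 1. ''$H$ acts on $A$'' means $A$ is a left $H$-module algebra with homogeneous grading-preserving action. Inner-faithful: no nonzero Hopf ideal annihilates $A$. $A^H=\{f: h.f=\epsilon(h)f\ \forall h\in H\}$; $\mathbb{C}[f_1,\dots]$ denotes the subalgebra of $A$ generated by the listed elements. A connected graded algebra is AS regular if it has finite global dimension, finite Gelfand–Kirillov dimension, and is AS Gorenstein (finite injective dimension $d$ and $\mathrm{Ext}^j_A(\mathbb{C},A)=\delta_{j,d}\,\mathbb{C}(l)$ for some $l$). $H$ is a reflection Hopf algebra for an AS regular algebra $A$ on which it acts inner-faithfully,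 preserving the grading, if $A^H$ is AS regular. *)

(* Defs.v *)
From HB Require Import structures.
From mathcomp Require Import all_boot all_order all_algebra all_field.
From mathcomp Require Import all_classical all_reals.
From mathcomp Require Import ereal topology normedtype sequences exp.
From mathcomp.real_closed Require Import complex.
(* The notations of monalg clash with those of mathcomp-analysis, so only its
   canonical structures are imported. *)
From mathcomp.multinomials Require monalg.
Import (canonicals, coercions, hints) monalg.

Set Implicit Arguments.
Unset Strict Implicit.
Unset Printing Implicit Defensive.

Import Order.TTheory GRing.Theory Num.Theory.
Local Open Scope classical_set_scope.
Local Open Scope ring_scope.

Section Tensor.
Variable K : fieldType.

(* V (x) W is modelled by the matrices of coordinates with respect to the
   products of the vectors of [vbasis {:V}] and [vbasis {:W}]. *)
Definition tens (V W : vectType K) (v : V) (w : W) : 'M[K]_(\dim {:V}, \dim {:W}) :=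
  \matrix_(i, j) (coord (vbasis {:V}) i v * coord (vbasis {:W}) j w).

(* The linear map V (x) W -> U induced by a bilinear map f : V -> W -> U;
   [tlift f (comul h)] is the Sweedler sum of the f h_(1) h_(2). *)
Definition tlift (V W : vectType K) (U : lmodType K) (f : V -> W -> U)
    (M : 'M[K]_(\dim {:V}, \dim {:W})) : U :=
  \sum_(i < \dim {:V}) \sum_(j < \dim {:W})
     M i j *: f (vbasis {:V})`_i (vbasis {:W})`_j.

(* The multiplication of the algebra B (x) B. *)
Definition tmul (B : falgType K) (M N : 'M[K]_(\dim {:B}, \dim {:B})) :
    'M[K]_(\dim {:B}, \dim {:B}) :=
  tlift (fun a b => tlift (fun c d => tens (a * c) (b * d)) N) M.

End Tensor.

Section Hopf.
Variable K : fieldType.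

Record hopfAlg := HopfAlg {
  hopf_alg :> falgType K;
  comul : {linear hopf_alg -> 'M[K]_(\dim {:hopf_alg}, \dim {:hopf_alg})};
  counit : {scalar hopf_alg};
  antipode : {linear hopf_alg -> hopf_alg};
  comul_unit : comul 1 = tens 1 1;
  comul_mul : forall a b, comul (a * b) = tmul (comul a) (comul b);
  counit_unit : counit 1 = 1;
  counit_mul : forall a b, counit (a * b) = counit a * counit b;
  comul_assoc : forall h,
    tlift (fun a b => tens (comul a) b) (comul h) =
    tlift (fun a b => tlift (fun b1 b2 => tens (tens a b1) b2) (comul b))
      (comul h);
  counit_comul_l : forall h, tlift (fun a b => counit a *: b) (comul h) = h;
  counit_comul_r : forall h, tlift (fun a b => counit b *: a) (comul h) = h;
  antipode_l : forall h,
    tlift (fun a b => antipode a * b) (comul h) = counit h *: 1;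
  antipode_r : forall h,
    tlift (fun a b => a * antipode b) (comul h) = counit h *: 1
}.

Definition grouplike (H : hopfAlg) (g : H) : Prop :=
  comul H g = tens g g /\ counit H g = 1.

Definition semisimple (B : falgType K) : Prop :=
  forall I : {vspace B}, ({:B} * I <= I)%VS ->
  exists J : {vspace B},
    [/\ ({:B} * J <= J)%VS, (I + J)%VS = {:B}%VS & (I :&: J)%VS = 0%VS].

Definition hopf_ideal (H : hopfAlg) (I : {vspace H}) : Prop :=
  [/\ ({:H} * I <= I)%VS, (I * {:H} <= I)%VS,
      (* comul I is contained in I (x) H + H (x) I *)
      forall h, h \in I -> comul H h \in
        <<[seq tens a b | a <- vbasis I, b <- vbasis {:H}] ++
          [seq tens a b | a <- vbasis {:H}, b <- vbasis I]>>%VS,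
      forall h, h \in I -> counit H h = 0
    & forall h, h \in I -> antipode H h \in I].

End Hopf.

Definition graded_by (I : choiceType) (V : zmodType) (comp : I -> set V) : Prop :=
  [/\ forall i, comp i 0,
      forall i a b, comp i a -> comp i b -> comp i (a - b),
      forall a, exists (s : seq I) (f : I -> V),
        [/\ uniq s, forall i, comp i (f i) & a = \sum_(i <- s) f i]
    & forall (s : seq I) (f : I -> V), uniq s ->
        (forall i, i \in s -> comp i (f i)) ->
        \sum_(i <- s) f i = 0 -> forall i, i \in s -> f i = 0].

Record cgAlg (K : fieldType) := CGAlg {
  cg_alg :> algType K;
  cg_comp : nat -> set cg_alg;
  cg_graded : graded_by cg_comp;
  cg_scale : forall i c a, cg_comp i a -> cg_comp i (c *: a);
  cg_mul : forall i j a b,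
    cg_comp i a -> cg_comp j b -> cg_comp (i + j)%N (a * b);
  cg_conn : forall a, cg_comp 0%N a <-> exists c : K, a = c%:A
}.

Inductive subalg_gen (K : fieldType) (A : algType K) (s : seq A) : A -> Prop :=
| subalg_gen_gen a of a \in s : subalg_gen s a
| subalg_gen_scal (c : K) : subalg_gen s c%:A
| subalg_gen_add a b of subalg_gen s a & subalg_gen s b : subalg_gen s (a + b)
| subalg_gen_mul a b of subalg_gen s a & subalg_gen s b : subalg_gen s (a * b).

Section Homological.
Variable A : nzRingType.

Definition exact_at (L M N : lmodType A) (f : L -> M) (g : M -> N) : Prop :=
  forall m, g m = 0 <-> exists l, f l = m.

Definition surj_map (T U : Type) (f : T -> U) : Prop :=
  forall y, exists x, f x = y.

Definition projective (P : lmodType A) : Prop :=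
  forall (M N : lmodType A) (g : {linear M -> N}) (f : {linear P -> N}),
    surj_map g -> exists h : {linear P -> M}, forall p, g (h p) = f p.

Definition injective_module (E : lmodType A) : Prop :=
  forall (M N : lmodType A) (g : {linear M -> N}) (f : {linear M -> E}),
    injective g -> exists h : {linear N -> E}, forall m, h (g m) = f m.

Definition pdim_le (M : lmodType A) (n : nat) : Prop :=
  exists (P : nat -> lmodType A) (d : forall i, {linear P i.+1 -> P i})
         (e : {linear P 0%N -> M}),
    [/\ forall i, projective (P i),
        surj_map e,
        exact_at (d 0%N) e,
        forall i, exact_at (d i.+1) (d i)
      & forall i, (n < i)%N -> forall p : P i, p = 0].

Definition idim_le (M : lmodType A) (n : nat) : Prop :=
  exists (E : nat -> lmodType A) (d : forall i, {linear E i -> E i.+1})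
         (e : {linear M -> E 0%N}),
    [/\ forall i, injective_module (E i),
        injective e,
        exact_at e (d 0%N),
        forall i, exact_at (d i) (d i.+1)
      & forall i, (n < i)%N -> forall x : E i, x = 0].

Definition finite_gldim : Prop := exists n, forall M : lmodType A, pdim_le M n.

Definition injdim_eq (M : lmodType A) (d : nat) : Prop :=
  idim_le M d /\ forall e, (e < d)%N -> ~ idim_le M e.

End Homological.

Section GKdim.
Variables (R : realType) (K : fieldType).

Definition lin_indep (V : lmodType K) (s : seq V) (I : {set 'I_(size s)}) : Prop :=
  forall c : 'I_(size s) -> K,
    \sum_(i in I) c i *: s`_i = 0 -> forall i, i \in I -> c i = 0.

Definition span_dim (V : lmodType K) (s : seq V) : nat :=
  \max_(I : {set 'I_(size s)} | `[< lin_indep I >]) #|I|.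

Variable A : algType K.

Fixpoint words (s : seq A) (n : nat) : seq A :=
  if n is m.+1 then [seq a * w | a <- s, w <- words s m] else [:: 1].

(* The dimension of K + V + .. + V^n, where V is the span of s. *)
Definition growth (s : seq A) (n : nat) : nat :=
  span_dim (flatten [seq words s k | k <- iota 0 n.+1]).

Definition GKdim : \bar R :=
  ereal_sup [set limn_esup (fun n => (ln (growth s n)%:R / ln n%:R)%:E)
            | s in [set: seq A]].

End GKdim.

Section ASRegular.
Variable K : fieldType.

Record grModule (A : cgAlg K) := GrModule {
  gr_module :> lmodType A;
  gr_comp : int -> set gr_module;
  gr_graded : graded_by gr_comp;
  gr_act : forall i j (a : A) m,
    cg_comp i a -> gr_comp j m -> gr_comp (i%:Z + j) (a *: m)
}.

(* M is the trivial module K = A / A_(>0), concentrated in degree 0. *)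
Definition trivial_module (A : cgAlg K) (M : grModule A) : Prop :=
  exists e : M, [/\ e <> 0, gr_comp 0 e
    & forall m : M, exists c : K, m = (c%:A : A) *: e].

Record grResolution (A : cgAlg K) (M : grModule A) := GrResolution {
  res_mod : nat -> grModule A;
  res_diff : forall i, {linear res_mod i.+1 -> res_mod i};
  res_aug : {linear res_mod 0%N -> M};
  res_proj : forall i, projective (res_mod i);
  res_diff_gr : forall i n x, gr_comp n x -> gr_comp n (res_diff i x);
  res_aug_gr : forall n x, gr_comp n x -> gr_comp n (res_aug x);
  res_aug_surj : surj_map res_aug;
  res_exact0 : exact_at (res_diff 0%N) res_aug;
  res_exact : forall i, exact_at (res_diff i.+1) (res_diff i)
}.

Section Ext.
Variables (A : cgAlg K) (M : grModule A) (P : grResolution M).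

Definition cg_compz (n : int) (a : A) : Prop :=
  if n is Posz k then cg_comp k a else a = 0.

Definition hom_deg (Q : grModule A) (n : int) (f : {linear Q -> A^o}) : Prop :=
  forall k x, gr_comp k x -> cg_compz (k + n) (f x).

Definition cocycle (j : nat) (n : int) (f : {linear res_mod P j -> A^o}) : Prop :=
  hom_deg n f /\ forall x, f (res_diff P j x) = 0.

Definition coboundary (j : nat) (n : int) :
    {linear res_mod P j -> A^o} -> Prop :=
  match j with
  | 0%N => fun f => forall x, f x = 0
  | i.+1 => fun f => exists g : {linear res_mod P i -> A^o},
      hom_deg n g /\ forall x, f x = g (res_diff P i x)
  end.

(* Ext^j_A(M, A) is graded by the degree of homogeneous homomorphisms.  The two
   predicates say that its degree-n part, computed with the resolution P, has
   dimension 0, respectively 1. *)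
Definition Ext_part_zero (j : nat) (n : int) : Prop :=
  forall f : {linear res_mod P j -> A^o}, cocycle n f -> coboundary n f.

Definition Ext_part_line (j : nat) (n : int) : Prop :=
  exists f0 : {linear res_mod P j -> A^o},
    [/\ cocycle n f0, ~ coboundary n f0
      & forall f : {linear res_mod P j -> A^o}, cocycle n f ->
        exists (c : K) (b : {linear res_mod P j -> A^o}),
          coboundary n b /\ forall x, f x = (c *: (f0 x : A) : A) + b x].

(* Ext^j_A(M, A) is K(l) for j = d and 0 for j <> d, where K(l)_n = K_(l + n).
   A graded right A-module of total dimension 1 is a shift of K, so it is enough
   to give the dimensions of the graded parts. *)
Definition Ext_delta (d : nat) (l : int) : Prop :=
  forall (j : nat) (n : int),
    if (j == d) && (n == - l) then Ext_part_line j n else Ext_part_zero j n.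

End Ext.

Definition AS_Gorenstein (A : cgAlg K) : Prop :=
  exists d : nat, injdim_eq (A^o : lmodType A) d /\
  exists (l : int) (M : grModule A) (P : grResolution M),
    trivial_module M /\ Ext_delta P d l.

End ASRegular.

(* Modules are left modules. *)
Definition AS_regular (R : realType) (A : cgAlg R[i]) : Prop :=
  [/\ finite_gldim A, (GKdim R A < +oo)%E & AS_Gorenstein A].

Section Action.
Variable K : fieldType.

Record hopfAction (H : hopfAlg K) (A : cgAlg K) := HopfAction {
  act :> H -> A -> A;
  act_linear_l : forall a, linear (fun h => act h a);
  act_linear_r : forall h, linear (act h);
  act_one : forall a, act 1 a = a;
  act_comp : forall g h a, act (g * h) a = act g (act h a);
  act_unit : forall h, act h 1 = counit H h *: 1;
  act_mul : forall h a b,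
    act h (a * b) = tlift (fun h1 h2 => act h1 a * act h2 b) (comul H h);
  act_graded : forall h n a, cg_comp n a -> cg_comp n (act h a)
}.

Variables (H : hopfAlg K) (A : cgAlg K) (rho : hopfAction H A).

Definition inner_faithful : Prop :=
  forall I : {vspace H}, hopf_ideal I ->
    (forall h a, h \in I -> rho h a = 0) -> I = 0%VS.

Definition act_invariant (a : A) : Prop := forall h, rho h a = counit H h *: a.

Definition invariant_pred : pred A := fun a => `[< act_invariant a >].

Lemma counit_tlift (h : H) :
  tlift (fun h1 h2 => counit H h1 * counit H h2 : K^o) (comul H h) = counit H h.
Proof.
rewrite -[in RHS](counit_comul_l h) /tlift raddf_sum; apply: eq_bigr => i _.
rewrite raddf_sum; apply: eq_bigr => j _.
by rewrite [RHS]linearZ; congr (_ * _); rewrite linearZ.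
Qed.

Lemma act_add h a b : rho h (a + b) = rho h a + rho h b.
Proof. by have := act_linear_r rho h 1 a b; rewrite !scale1r. Qed.

Lemma act_zero h : rho h 0 = 0.
Proof. by apply: (addrI (rho h 0)); rewrite -act_add !addr0. Qed.

Lemma act_scale h c a : rho h (c *: a) = c *: rho h a.
Proof. by have := act_linear_r rho h c a 0; rewrite act_zero !addr0. Qed.

Lemma act_sum h (I : Type) (s : seq I) (f : I -> A) :
  rho h (\sum_(i <- s) f i) = \sum_(i <- s) rho h (f i).
Proof. by apply: (big_morph (rho h)); [apply: act_add | apply: act_zero]. Qed.

Lemma invariant_subsemialg : GRing.subsemialg_closed invariant_pred.
Proof.
split.
- by apply/asboolP => h; rewrite act_unit.
- split; first by apply/asboolP => h; rewrite scaler0 act_zero.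
  move=> a b /asboolP Ha /asboolP Hb; apply/asboolP => h.
  by rewrite act_add Ha Hb scalerDr.
- move=> c a /asboolP Ha; apply/asboolP => h.
  by rewrite act_scale Ha !scalerA mulrC.
- move=> a b /asboolP Ha /asboolP Hb; apply/asboolP => h.
  rewrite act_mul -counit_tlift /tlift scaler_suml; apply: eq_bigr => i _.
  rewrite scaler_suml; apply: eq_bigr => j _.
  by rewrite Ha Hb -scalerAl -scalerAr !scalerA.
Qed.

HB.instance Definition _ :=
  GRing.isSubalgClosed.Build K A invariant_pred invariant_subsemialg.

Record invariants := Invariants {
  inv_val :> A;
  inv_valP : invariant_pred inv_val
}.

HB.instance Definition _ := [isSub for inv_val].
HB.instance Definition _ := [Choice of invariants by <:].
HB.instance Definition _ := [SubChoice_isSubAlgebra of invariants by <:].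

Definition inv_comp (n : nat) : set invariants := [set a | cg_comp n (val a)].

Lemma inv_graded : graded_by inv_comp.
Proof.
have [c0 cB cD cU] := cg_graded A.
split=> [i|i a b|a|s f us fs sf0 i si].
- exact: (c0 i).
- exact: cB.
- have [s [f [us fc af]]] := cD (val a).
  have finv i : i \in s -> invariant_pred (f i).
    move=> si; apply/asboolP => h; apply/subr0_eq.
    apply: (cU s (fun i => rho h (f i) - counit H h *: f i)) => // [j _|].
      by apply: (cB); [apply: act_graded | apply: cg_scale].
    rewrite sumrB -act_sum -scaler_sumr -af.
    by have /asboolP -> := inv_valP a; rewrite subrr.
  exists s, (fun i => insubd 0 (f i)); split=> // [i|].
    by rewrite /inv_comp /= val_insubd; case: ifP => // _; apply: c0.
  apply: val_inj; rewrite af raddf_sum /=; apply: eq_big_seq => i si.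
  by rewrite val_insubd finv.
- apply: val_inj; apply: (cU s (fun i => val (f i))) => //.
  by rewrite -raddf_sum sf0 raddf0.
Qed.

Lemma inv_scale i c (a : invariants) : inv_comp i a -> inv_comp i (c *: a).
Proof. exact: cg_scale. Qed.

Lemma inv_mul i j (a b : invariants) :
  inv_comp i a -> inv_comp j b -> inv_comp (i + j)%N (a * b).
Proof. exact: cg_mul. Qed.

Lemma inv_conn (a : invariants) : inv_comp 0%N a <-> exists c : K, a = c%:A.
Proof.
rewrite /inv_comp /= cg_conn; split=> -[c ac]; exists c; last by rewrite ac.
exact: val_inj.
Qed.

Definition inv_cgAlg : cgAlg K := CGAlg inv_graded inv_scale inv_mul inv_conn.

End Action.

Definition reflection_Hopf (R : realType) (H : hopfAlg R[i]) (A : cgAlg R[i])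
    (rho : hopfAction H A) : Prop :=
  [/\ AS_regular A, inner_faithful rho & AS_regular (inv_cgAlg rho)].

Variant kashina := Kashina8 | Kashina9.

Record is_kashina (R : realType) (k : kashina) (H : hopfAlg R[i]) (x y z : H) :
    Prop := IsKashina {
  kashina_dim : \dim {:H} = 16;
  kashina_semisimple : semisimple H;
  kashina_gen : agenv <<[:: x; y; z]>>%VS = {:H}%VS;
  kashina_grouplike_x : grouplike x;
  kashina_grouplike_y : grouplike y;
  kashina_xy : x * y = y * x;
  kashina_x4 : x ^+ 4 = 1;
  kashina_y2 : y ^+ 2 = 1;
  kashina_counit_z : counit H z = 1;
  kashina_comul_z : comul H z =
    tmul (2^-1 *: (tens 1 1 + tens y 1 + tens 1 (x ^+ 2) - tens y (x ^+ 2)))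
         (tens z z);
  kashina_zx : z * x = x * y * z;
  kashina_zy : z * y = y * z;
  kashina_z2 : z ^+ 2 = if k is Kashina8 then 1 else y
}.

Variant quadric := Comm | Skew | SqDiff | SqSum.

Definition quadric_rel (B : pzRingType) (q : quadric) (u v : B) : B :=
  match q with
  | Comm => u * v - v * u
  | Skew => u * v + v * u
  | SqDiff => u ^+ 2 - v ^+ 2
  | SqSum => u ^+ 2 + v ^+ 2
  end.

Definition in_ideal (B : pzRingType) (r b : B) : Prop :=
  exists s : seq (B * B), b = \sum_(c <- s) c.1 * r * c.2.

(* The algebra of the free monoid on two letters. *)
Notation free_alg2 K := (monalg.malg (monalg.fmonom 'I_2) K).

Definition free_var (K : fieldType) (i : 'I_2) : free_alg2 K :=
  monalg.mkmalgU (monalg.fmu i) 1.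

Definition quadric_algebra (K : fieldType) (q : quadric) (B : algType K)
    (u v : B) : Prop :=
  exists phi : {lrmorphism free_alg2 K -> B},
    [/\ phi (free_var K ord0) = u, phi (free_var K ord_max) = v, surj_map phi
      & forall p, phi p = 0 <->
          in_ideal (quadric_rel q (free_var K ord0) (free_var K ord_max)) p].

(* A = B[t; sigma]: A is a free left B-module on the powers of t, B being
   included by iota. *)
Definition Ore_extension (K : fieldType) (B A : algType K)
    (sigma : {lrmorphism B -> B}) (iota : {lrmorphism B -> A}) (t : A) : Prop :=
  (forall b, t * iota b = iota (sigma b) * t) /\
  (forall a, exists! p : {poly B}, a = \sum_(i < size p) iota p`_i * t ^+ i).

Definition quadric_Ore (K : fieldType) (q : quadric) (alpha : K) (A : cgAlg K)
    (u v t : A) : Prop :=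
  [/\ cg_comp 1%N u, cg_comp 1%N v, cg_comp 1%N t
    & exists (B : algType K) (bu bv : B) (sigma : {lrmorphism B -> B})
             (iota : {lrmorphism B -> A}),
        [/\ quadric_algebra q bu bv,
            bijective sigma,
            sigma bu = alpha *: bu /\ sigma bv = - alpha *: bv,
            Ore_extension sigma iota t
          & iota bu = u /\ iota bv = v]].

Variant rep2 := Pi1 | Pi2.

(* A_1 = pi (+) T; the booleans are the signs of x.t = +-i t and z.t = +-t. *)
Definition acts_as (R : realType) (k : kashina) (p : rep2) (sx sz : bool)
    (H : hopfAlg R[i]) (x y z : H) (A : cgAlg R[i]) (u v t : A)
    (rho : hopfAction H A) : Prop :=
  let c : R[i] := if p is Pi1 then 'i%C else 1 in
  [/\ [/\ rho x u = c *: u, rho y u = - u & rho z u = v],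
      [/\ rho x v = - c *: v, rho y v = - v
        & rho z v = if k is Kashina8 then u else - u]
    & [/\ rho x t = ((-1) ^+ sx * 'i%C) *: t, rho y t = t
        & rho z t = (-1) ^+ sz *: t]].

Definition inv_gens (k : kashina) (p : rep2) (q : quadric) (A : pzRingType)
    (u v t : A) : seq A :=
  match k, p, q with
  | Kashina8, Pi1, Comm =>
      [:: u^+2 * v^+2; u^+4 + v^+4; u * v * (u^+4 - v^+4);
          u * v * (u^+2 + v^+2) * t^+2; (u^+2 - v^+2) * t^+2; t^+4]
  | Kashina8, Pi1, Skew =>
      [:: u * v; u^+4 + v^+4; (u^+2 - v^+2) * t^+2; t^+4]
  | Kashina8, Pi1, SqDiff =>
      [:: u^+4; u * v - v * u; u^+2 * (u * v + v * u) * t^+2; t^+4]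
  | Kashina8, Pi1, SqSum =>
      [:: u^+4; u * v - v * u; u^+2 * t^+2; t^+4]
  | Kashina8, Pi2, Comm =>
      [:: u^+2 * v^+2; u^+2 + v^+2; u * v * t^+2; t^+4]
  | Kashina8, Pi2, Skew =>
      [:: u^+2 * v^+2; u^+2 + v^+2; u * v * (u^+2 - v^+2) * t^+2; t^+4]
  | Kashina8, Pi2, SqDiff =>
      [:: u^+2; (u * v)^+2 + (v * u)^+2; (u * v + v * u) * t^+2; t^+4]
  | Kashina8, Pi2, SqSum =>
      [:: u^+4; (u * v)^+2 + (v * u)^+2; u^+2 * ((u * v)^+2 - (v * u)^+2);
          u^+2 * (u * v - v * u) * t^+2; (u * v + v * u) * t^+2; t^+4]
  | Kashina9, Pi1, Comm =>
      [:: u * v; u^+4 + v^+4; (u^+2 - v^+2) * t^+2; t^+4]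
  | Kashina9, Pi1, Skew =>
      [:: u^+2 * v^+2; u^+4 + v^+4; u * v * (u^+4 - v^+4);
          (u^+2 - v^+2) * t^+2; u * v * (u^+2 + v^+2) * t^+2; t^+4]
  | Kashina9, Pi1, SqDiff =>
      [:: u^+4; u * v + v * u; u^+2 * (u * v - v * u) * t^+2; t^+4]
  | Kashina9, Pi1, SqSum =>
      [:: u^+4; u * v + v * u; u^+2 * t^+2; t^+4]
  | Kashina9, Pi2, Comm =>
      [:: u^+2 * v^+2; u^+2 + v^+2; u * v * (u^+2 - v^+2) * t^+2; t^+4]
  | Kashina9, Pi2, Skew =>
      [:: u^+2 * v^+2; u^+2 + v^+2; u * v * t^+2; t^+4]
  | Kashina9, Pi2, SqDiff =>
      [:: u^+2; (u * v)^+2 + (v * u)^+2; (u * v - v * u) * t^+2; t^+4]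
  | Kashina9, Pi2, SqSum =>
      [:: u^+4; (u * v)^+2 + (v * u)^+2; u^+2 * ((u * v)^+2 - (v * u)^+2);
          u^+2 * (u * v + v * u) * t^+2; (u * v - v * u) * t^+2; t^+4]
  end.

(* Main.v *)
Require Import Defs.
From HB Require Import structures.
From mathcomp Require Import all_boot all_order all_algebra all_field.
From mathcomp Require Import all_classical all_reals.
From mathcomp.real_closed Require Import complex.
From mathcomp.multinomials Require monalg.
Import (canonicals, coercions, hints) monalg.
From mathcomp Require Import ring.

(* In all cases A is generated by t and two elements a, b with b a = tau a b,
   tau = +-1: they are u, v for the relations uv = +-vu, and u + v, u - v, resp.
   u + i v, u - i v, for u^2 = v^2, resp. u^2 = -v^2.  Write E = a^2, F = b^2,
   P = a b, T = t^2 and D = T^2.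

   The automorphisms by which x and y act are given by the universal property of
   A; the twisted multiplicativity of z becomes multiplicativity of a map from A
   to M_2(A).  A is even a faithful H-module, because every character of <x, y>
   occurs with independent vectors w and z w among the u t^k and the u^3 v t^k.

   Averaging monomials over the x^i y^j z^l shows that the invariants are spanned
   by sums P^m (E^j +- F^j) T^l, where the parities of m, j and l decide whether
   such an invariant exists, and its sign.  So A^H is the sum of the R0 D^l and the
   R1 T D^l, where R1 = R0 f or R1 = R0 f + R0 g.

   The left ideal I of the invariants in A t is generated by D, f T and g T.  If
   R1 = R0 f, there is an exact sequence 0 -> I -> R^2 -> I -> 0, where R = A^H.
   Otherwise let K = R D + R f T and L = {r | r g T in K}; there are exact sequences
   0 -> I -> R^2 -> K -> 0, 0 -> L -> K + R -> I -> 0 and 0 -> R -> I^2 -> L -> 0.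
   In both cases I is projective as soon as its projective dimension is finite.
   Then the identity of I lifts through R^3 -> I, and comparing the lifts of D and
   f T gives T = p T + q f + q' g with p in A t, which is absurd modulo u and v.
   Hence A^H has infinite global dimension. *)

(** The ring of invariants is in general noncommutative, since [T] commutes with [E], [F], [P] only
    up to the scalar alpha^4, so regularity is refuted through one explicit left ideal rather than
    by a criterion for commutative rings. What makes I = R D + R f T + R g T computable is that (w
    T)(f T) is a multiple of w f [D]: right multiplication by f T followed by division by [D] is a
    linear map from I to R. In a syzygy (p, q) of (D, f T) one has q f in A t, so q lies in I
    because f is regular modulo t, and p is determined by q. This is why I reappears as its own
    syzygy and the resolution never ends. With a second generator g one must know that L is the sum
    of I and of the image of that map. This follows from a specialization that kills t and f, but
    not g. All statements modulo t are tested in 2 x 2 matrices over K[X][Y], where the image of f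
    has a nonzero scalar square, hence is regular on both sides. *)

Set Implicit Arguments.
Unset Strict Implicit.
Unset Printing Implicit Defensive.

Import GRing.Theory Num.Theory.
Local Open Scope classical_set_scope.
Local Open Scope ring_scope.

(** * Identities in noncommutative algebras *)

(* Decision by reflection of identities in a noncommutative algebra: both sides
   are expanded into linear combinations of words in their atoms. *)
Section NcRing.
Variables (K : comNzRingType) (A : algType K).

Inductive ncexp :=
| NcVar of nat
| NcZero
| NcOne
| NcAdd of ncexp & ncexp
| NcOpp of ncexp
| NcMul of ncexp & ncexp
| NcScale of K & ncexp
| NcExp of ncexp & nat.

Fixpoint nc_eval (xs : seq A) (e : ncexp) : A :=
  match e with
  | NcVar n => nth 0 xs n
  | NcZero => 0
  | NcOne => 1
  | NcAdd e f => nc_eval xs e + nc_eval xs f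
  | NcOpp e => - nc_eval xs e
  | NcMul e f => nc_eval xs e * nc_eval xs f
  | NcScale k e => k *: nc_eval xs e
  | NcExp e n => nc_eval xs e ^+ n
  end.

(** Private copies of the list operations: [cbv] can then unfold exactly these and leave the
    coefficients in [K] in a form that [ring] accepts. *)
Fixpoint nc_app T (l1 l2 : seq T) : seq T :=
  if l1 is a :: l then a :: nc_app l l2 else l2.

Fixpoint nc_scale (k : K) (l : seq (K * seq nat)) : seq (K * seq nat) :=
  if l is (c, w) :: l' then (k * c, w) :: nc_scale k l' else [::].

Fixpoint nc_mul1 (k : K) (w : seq nat) (l : seq (K * seq nat)) : seq (K * seq nat) :=
  if l is (c, w') :: l' then (k * c, nc_app w w') :: nc_mul1 k w l' else [::].

Fixpoint nc_mul (l1 l2 : seq (K * seq nat)) : seq (K * seq nat) :=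
  if l1 is (c, w) :: l then nc_app (nc_mul1 c w l2) (nc_mul l l2) else [::].

Fixpoint nc_exp (l : seq (K * seq nat)) (n : nat) : seq (K * seq nat) :=
  if n is m.+1 then nc_mul l (nc_exp l m) else [:: (1, [::])].

Fixpoint nc_norm (e : ncexp) : seq (K * seq nat) :=
  match e with
  | NcVar n => [:: (1, [:: n])]
  | NcZero => [::]
  | NcOne => [:: (1, [::])]
  | NcAdd e f => nc_app (nc_norm e) (nc_norm f)
  | NcOpp e => nc_scale (-1) (nc_norm e)
  | NcMul e f => nc_mul (nc_norm e) (nc_norm f)
  | NcScale k e => nc_scale k (nc_norm e)
  | NcExp e n => nc_exp (nc_norm e) n
  end.

Definition nc_word (xs : seq A) (w : seq nat) : A := \prod_(i <- w) nth 0 xs i.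

Definition nc_sum (xs : seq A) (l : seq (K * seq nat)) : A :=
  \sum_(m <- l) m.1 *: nc_word xs m.2.

Lemma nc_appE T (l1 l2 : seq T) : nc_app l1 l2 = l1 ++ l2.
Proof. by elim: l1 => //= a l ->. Qed.

Lemma nc_mulE xs l1 l2 : nc_sum xs (nc_mul l1 l2) = nc_sum xs l1 * nc_sum xs l2.
Proof.
rewrite /nc_sum; elim: l1 => [|[c w] l1 IH] /=; first by rewrite !big_nil mul0r.
rewrite nc_appE big_cat IH big_cons mulrDl; congr (_ + _).
elim: l2 {IH} => [|[d w'] l2 IH] /=; first by rewrite !big_nil mulr0.
rewrite !big_cons IH mulrDr nc_appE; congr (_ + _).
by rewrite -scalerAl -scalerAr scalerA /nc_word big_cat.
Qed.

Lemma nc_scaleE xs k l : nc_sum xs (nc_scale k l) = k *: nc_sum xs l.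
Proof.
rewrite /nc_sum; elim: l => [|[c w] l IH] /=; first by rewrite !big_nil scaler0.
by rewrite !big_cons IH scalerDr scalerA.
Qed.

Lemma nc_normE xs e : nc_sum xs (nc_norm e) = nc_eval xs e.
Proof.
have sum1 : nc_sum xs [:: (1, [::])] = 1.
  by rewrite /nc_sum big_seq1 /nc_word big_nil scale1r.
elim: e => /= [n|||e IHe f IHf|e IHe|e IHe f IHf|k e IHe|e IHe n].
- by rewrite /nc_sum big_seq1 /nc_word big_seq1 scale1r.
- by rewrite /nc_sum big_nil.
- exact: sum1.
- by rewrite -IHe -IHf /nc_sum nc_appE big_cat.
- by rewrite nc_scaleE IHe scaleN1r.
- by rewrite nc_mulE IHe IHf.
- by rewrite nc_scaleE IHe.
- by elim: n => [|n IHn] /=; rewrite ?sum1 ?expr0 // nc_mulE IHn IHe exprS.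
Qed.

Fixpoint nc_eqn (m n : nat) : bool :=
  match m, n with
  | 0%N, 0%N => true
  | m'.+1, n'.+1 => nc_eqn m' n'
  | _, _ => false
  end.

Fixpoint nc_eqw (v w : seq nat) : bool :=
  match v, w with
  | [::], [::] => true
  | m :: v', n :: w' => if nc_eqn m n then nc_eqw v' w' else false
  | _, _ => false
  end.

Lemma nc_eqwE v w : nc_eqw v w = (v == w).
Proof.
have E m n : nc_eqn m n = (m == n) by elim: m n => [|m IH] [|n] //=; rewrite IH.
elim: v w => [|m v IH] [|n w] //=; rewrite E eqseq_cons IH.
by case: eqP.
Qed.

Fixpoint nc_coef (l : seq (K * seq nat)) (w : seq nat) : K :=
  if l is (c, v) :: l' then
    if nc_eqw v w then c + nc_coef l' w else nc_coef l' w
  else 0.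

Fixpoint nc_rest (l : seq (K * seq nat)) (w : seq nat) : seq (K * seq nat) :=
  if l is (c, v) :: l' then
    if nc_eqw v w then nc_rest l' w else (c, v) :: nc_rest l' w
  else [::].

(** One equation in [K] per distinct word. [n] is fuel; the number of terms suffices because
    [nc_rest] never lengthens a list. *)
Fixpoint nc_zero (n : nat) (l : seq (K * seq nat)) : Prop :=
  if n is m.+1 then
    if l is (c, w) :: l' then
      c + nc_coef l' w = 0 /\ nc_zero m (nc_rest l' w)
    else True
  else l = [::].

Lemma nc_zeroP xs n l : nc_zero n l -> nc_sum xs l = 0.
Proof.
have split_word w l' :
    nc_sum xs l' = nc_coef l' w *: nc_word xs w + nc_sum xs (nc_rest l' w).
  rewrite /nc_sum; elim: l' => [|[c v] l' IH] /=.
    by rewrite !big_nil scale0r addr0.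
  rewrite nc_eqwE; case: eqP => [->|_]; rewrite !big_cons IH /=.
    by rewrite scalerDl addrA.
  by rewrite addrCA.
elim: n l => [|n IH] [|[c w] l] //= h; try by rewrite /nc_sum big_nil.
rewrite /nc_sum big_cons -/(nc_sum xs l) (split_word w) /= addrA -scalerDl.
by have [-> /IH ->] := h; rewrite scale0r addr0.
Qed.

Fixpoint nc_size (l : seq (K * seq nat)) : nat :=
  if l is _ :: l' then (nc_size l').+1 else 0%N.

Lemma nc_correct xs e f :
  (let l := nc_norm (NcAdd e (NcOpp f)) in nc_zero (nc_size l) l) ->
  nc_eval xs e = nc_eval xs f.
Proof.
move=> /= h; apply/subr0_eq.
by rewrite -[LHS](nc_normE xs (NcAdd e (NcOpp f))); apply: nc_zeroP h.
Qed.

End NcRing.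

Ltac nc_index x xs :=
  lazymatch xs with
  | x :: _ => constr:(0%N)
  | _ :: ?t => let n := nc_index x t in constr:(S n)
  end.

Ltac nc_add x xs :=
  let rec go l := lazymatch l with
    | nil => constr:(true)
    | x :: _ => constr:(false)
    | _ :: ?t => go t
    end in
  let b := go xs in
  lazymatch b with true => constr:(x :: xs) | false => xs end.

Ltac nc_atoms t xs :=
  lazymatch t with
  | (?a + ?b)%R => let ys := nc_atoms a xs in nc_atoms b ys
  | (- ?a)%R => nc_atoms a xs
  | (?a * ?b)%R => let ys := nc_atoms a xs in nc_atoms b ys
  | (_ *: ?a)%R => nc_atoms a xs
  | (?a ^+ ?n)%R => nc_atoms a xs
  | 0%R => xs
  | 1%R => xs
  | _ => nc_add t xs
  end.

Ltac nc_reify K t xs :=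
  lazymatch t with
  | (?a + ?b)%R => let x := nc_reify K a xs in let y := nc_reify K b xs in
      constr:(@NcAdd K x y)
  | (- ?a)%R => let x := nc_reify K a xs in constr:(@NcOpp K x)
  | (?a * ?b)%R => let x := nc_reify K a xs in let y := nc_reify K b xs in
      constr:(@NcMul K x y)
  | (?k *: ?a)%R => let x := nc_reify K a xs in constr:(@NcScale K k x)
  | (?a ^+ ?n)%R => let x := nc_reify K a xs in constr:(@NcExp K x n)
  | 0%R => constr:(@NcZero K)
  | 1%R => constr:(@NcOne K)
  | _ => let n := nc_index t xs in constr:(@NcVar K n)
  end.

(** Stops at the equations between coefficients, so that [field], or [ring] with a hypothesis such
    as im * im = -1, can finish them. *)
Ltac nc_prep K A :=
  lazymatch goal with
  | |- @eq ?T ?l ?r =>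
    let xs0 := constr:(@nil T) in
    let xs1 := nc_atoms l xs0 in
    let xs := nc_atoms r xs1 in
    let e := nc_reify K l xs in
    let f := nc_reify K r xs in
    refine (@nc_correct K A xs e f _);
    cbv [nc_norm nc_app nc_scale nc_mul1 nc_mul nc_exp nc_eqn nc_eqw nc_coef
         nc_rest nc_zero nc_size]
  end.

Ltac nc_ring K A := nc_prep K A; repeat split; try ring.

(** * Projective dimension *)

Section Submodule.
Variables (A : nzRingType) (M : lmodType A).

Record subm := Subm {
  subm_pred :> pred M;
  subm_closed : GRing.submod_closed subm_pred
}.

HB.instance Definition _ (S : subm) :=
  GRing.isSubmodClosed.Build A M (subm_pred S) (subm_closed S).

Record subm_of (S : subm) := SubmOf { subm_val :> M; subm_valP : subm_val \in subm_pred S }.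

HB.instance Definition _ (S : subm) := [isSub for @subm_val S].
HB.instance Definition _ (S : subm) := [Choice of subm_of S by <:].
HB.instance Definition _ (S : subm) := [SubChoice_isSubLmodule of subm_of S by <:].

End Submodule.

Section Homology.
Variable A : nzRingType.
Implicit Types K L M N P Q : lmodType A.

Lemma linear_ex M N (f : M -> N) : linear f ->
  exists g : {linear M -> N}, forall m, g m = f m.
Proof.
move=> fl.
pose F := GRing.isLinear.Build A M N *:%R f fl.
by exists (HB.pack_for {linear M -> N} f F).
Qed.

Definition ses K M N (i : {linear K -> M}) (g : {linear M -> N}) : Prop :=
  [/\ injective i, surj_map g & exact_at i g].

Lemma ker_ses M N (g : {linear M -> N}) : surj_map g ->
  exists (K : lmodType A) (i : {linear K -> M}), ses i g.
Proof.
move=> gs; pose p : pred M := fun m => g m == 0.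
have pc : GRing.submod_closed p.
  split; first by rewrite /p unfold_in raddf0.
  move=> c m1 m2; rewrite /p !unfold_in linearP => /eqP -> /eqP ->.
  by rewrite scaler0 addr0.
exists (subm_of (Subm pc)), (val : {linear _ -> M}); split => //.
move=> m; split=> [gm0|[l <-]].
  have mp : m \in subm_pred (Subm pc) by rewrite unfold_in /= /p gm0.
  by exists (SubmOf mp).
by have := subm_valP l; rewrite unfold_in => /eqP.
Qed.

Lemma ses_lift K L M N (i : {linear K -> M}) (g : {linear M -> N})
  (h : {linear L -> M}) : ses i g -> (forall x, g (h x) = 0) ->
  exists h' : {linear L -> K}, forall x, i (h' x) = h x.
Proof.
move=> [ii gs ex] gh.
have /choice [h' hh'] : forall x, exists k, i k = h x by move=> x; apply/ex.
have [|h'' hE] := @linear_ex _ _ h'.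
  by move=> c x y; apply: ii; rewrite linearP !hh' linearP.
by exists h'' => x; rewrite hE hh'.
Qed.

Lemma ses_split K M P (i : {linear K -> M}) (g : {linear M -> P}) :
  ses i g -> projective P ->
  exists (s : {linear P -> M}) (r : {linear M -> K}),
    [/\ forall p, g (s p) = p, forall m, i (r m) + s (g m) = m,
        forall k, r (i k) = k & forall p, r (s p) = 0].
Proof.
move=> ex pP; have [ii gs eg] := ex.
have [s sP] := pP M P g idfun gs.
have [d dE] : exists d : {linear M -> M}, forall m, d m = m - s (g m).
  by apply: linear_ex => c x y; rewrite !linearP scalerDr addrACA.
have [|r rE] := @ses_lift _ _ _ _ i g d ex.
  by move=> x; rewrite dE linearB /= sP subrr.
exists s, r; split=> //.
- by move=> m; rewrite rE dE subrK.
- move=> k; apply: ii; rewrite rE dE (_ : g (i k) = 0) ?raddf0 ?addr0 ?raddf0 ?addr0 //.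
  by apply/eg; exists k.
- by move=> p; apply: ii; rewrite rE dE sP subrr raddf0.
Qed.

Lemma projective_retract P M (s : {linear M -> P}) (r : {linear P -> M}) :
  (forall m, r (s m) = m) -> projective P -> projective M.
Proof.
move=> rs pP X N g f gs.
have [h hP] := pP X N g (f \o r : {linear P -> N}) gs.
by exists (h \o s : {linear M -> X}) => m; rewrite /= hP /= rs.
Qed.

Lemma projective_pair P Q : projective P -> projective Q ->
  projective (P * Q)%type.
Proof.
move=> pP pQ X N g f gs.
have [f1 f1E] : exists f1 : {linear P -> N}, forall p, f1 p = f (p, 0).
  apply: linear_ex => c x y; rewrite -linearP; congr (f _).
  by congr pair; rewrite /= scaler0 addr0.
have [f2 f2E] : exists f2 : {linear Q -> N}, forall p, f2 p = f (0, p).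
  apply: linear_ex => c x y; rewrite -linearP; congr (f _).
  by congr pair; rewrite /= scaler0 addr0.
have [h1 h1P] := pP X N g f1 gs; have [h2 h2P] := pQ X N g f2 gs.
have [h hE] : exists h : {linear (P * Q)%type -> X},
    forall x, h x = h1 x.1 + h2 x.2.
  by apply: linear_ex => c x y; rewrite !linearP scalerDr addrACA.
exists h => -[p q]; rewrite hE raddfD /= h1P h2P f1E f2E -raddfD.
by congr (f _); congr pair; rewrite /= ?addr0 ?add0r.
Qed.

Lemma projective_regular : projective (A^o : lmodType A).
Proof.
move=> M N g f gs; have [m gm] := gs (f 1).
have [h hE] : exists h : {linear A^o -> M}, forall a, h a = (a : A) *: m.
  apply: linear_ex => c x y.
  by rewrite scalerDl scalerA.
exists h => a; rewrite hE linearZ /= gm -linearZ; congr (f _).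
by rewrite /GRing.scale /= mulr1.
Qed.

Lemma projective_zero P : (forall p : P, p = 0) -> projective P.
Proof.
move=> p0 M N g f gs; exists (\0 : {linear P -> M}) => p.
by rewrite (p0 p) !raddf0.
Qed.

(** Recursive form of [pdim_le]: one syzygy is peeled off at a time, so that the comparison lemmas
    become inductions on [n] without any complexes. *)
Fixpoint pd_le (n : nat) M : Prop :=
  if n is m.+1 then
    exists (K P : lmodType A) (i : {linear K -> P}) (g : {linear P -> M}),
      [/\ ses i g, projective P & pd_le m K]
  else projective M.

Lemma pd_le_projective n P : projective P -> pd_le n P.
Proof.
elim: n P => [//|n IH] P pP.
have [|K [i si]] := @ker_ses P P idfun; first by move=> y; exists y.
exists K, P, i, idfun; split=> //; apply/IH/projective_zero => k.
by have [ii _ ex] := si; apply: ii; rewrite raddf0; apply/(ex (i k)); exists k.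
Qed.

(** Horseshoe lemma: lifting the cover of [N] to [M] makes the sum of the two covers a cover of [M],
    and the three kernels again form a short exact sequence. *)
Lemma pd_le_ext n K M N (i : {linear K -> M}) (g : {linear M -> N}) :
  ses i g -> pd_le n K -> pd_le n N -> pd_le n M.
Proof.
elim: n K M N i g => [|n IH] K M N i g sig.
  move=> pK pN; have [s [r [gs rs ri r0]]] := ses_split sig pN.
  have [a aE] : exists a : {linear (K * N)%type -> M},
      forall x, a x = i x.1 + s x.2.
    by apply: linear_ex => c x y; rewrite !linearP scalerDr addrACA.
  have [b bE] : exists b : {linear M -> (K * N)%type},
      forall x, b x = (r x, g x).
    by apply: linear_ex => c x y; rewrite !linearP.
  apply: (@projective_retract _ _ b a) (projective_pair pK pN) => m.
  by rewrite aE bE /= rs.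
move=> [KK [P [kK [pK [sK prP dK]]]]] [KN [Q [kN [pN [sN prQ dN]]]]].
have [ii gs ex] := sig; have [kKi pKs exK] := sK; have [kNi pNs exN] := sN.
have [l lE] := prQ M N g pN gs.
have [h hE] : exists h : {linear (P * Q)%type -> M},
    forall x, h x = i (pK x.1) + l x.2.
  by apply: linear_ex => c x y; rewrite !linearP scalerDr addrACA.
have gi k : g (i k) = 0 by apply/ex; exists k.
have hs : surj_map h.
  move=> m; have [q qE] := pNs (g m).
  have /ex [k kE] : g (m - l q) = 0 by rewrite raddfB /= lE qE subrr.
  have [p pE] := pKs k.
  by exists (p, q); rewrite hE /= pE kE subrK.
have [KM [j sj]] := ker_ses hs; have [ji _ exj] := sj.
exists KM, (P * Q)%type, j, h; split=> //; first exact: projective_pair.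
have [e0 e0E] : exists e : {linear KK -> (P * Q)%type}, forall k, e k = (kK k, 0).
  apply: linear_ex => c x y; rewrite linearP; congr pair.
  by rewrite /= scaler0 addr0.
have [|e eE] := @ses_lift _ _ _ _ j h e0 sj.
  move=> k; rewrite e0E hE /= raddf0 addr0 (_ : pK _ = 0) ?raddf0 //.
  by apply/exK; exists k.
have [|d dE] := @ses_lift _ _ _ _ kN pN (snd \o j : {linear KM -> Q}) sN.
  move=> k /=; rewrite -lE; have /eqP : h (j k) = 0 by apply/exj; exists k.
  rewrite hE addrC addr_eq0 => /eqP ->.
  by rewrite raddfN /= gi oppr0.
apply: (IH _ _ _ e d) => //; split.
- move=> k1 k2 /(congr1 j); rewrite !eE !e0E => -[]; exact: kKi.
- move=> k; have /ex [k' k'E] : g (l (kN k)) = 0.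
    by rewrite lE; apply/exN; exists k.
  have [p pE] := pKs k'.
  have /exj [m mE] : h (- p, kN k) = 0.
    by rewrite hE /= raddfN /= pE raddfN /= k'E addNr.
  by exists m; apply: kNi; rewrite dE /= mE.
- move=> m; split=> [dm0|[k <-]].
    have jm2 : (j m).2 = 0 by rewrite -[LHS]dE dm0 raddf0.
    have : h (j m) = 0 by apply/exj; exists m.
    rewrite hE jm2 raddf0 addr0 -(raddf0 i) => /ii /exK [k kE].
    exists k; apply: ji; rewrite eE e0E kE -jm2.
    by case: (j m).
  by apply: kNi; rewrite dE /= eE e0E raddf0.
Qed.

Lemma pd_le_pair n M N : pd_le n M -> pd_le n N -> pd_le n (M * N)%type.
Proof.
have [e0 e0E] : exists e : {linear M -> (M * N)%type}, forall k, e k = (k, 0).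
  apply: linear_ex => c x y; congr pair.
  by rewrite /= scaler0 addr0.
apply: (@pd_le_ext n M (M * N)%type N e0 snd); split.
- by move=> x y; rewrite !e0E => -[].
- by move=> y; exists (0, y).
- move=> [m k]; split=> /= [->|[l]]; first by exists m; rewrite e0E.
  by rewrite e0E => -[].
Qed.

(** A cover of [M] also covers [N]; its kernel over [N] is an extension of [K] by its kernel over
    [M]. *)
Lemma pd_le_quotient n K M N (i : {linear K -> M}) (g : {linear M -> N}) :
  ses i g -> pd_le n K -> pd_le n.+1 M -> pd_le n.+1 N.
Proof.
move=> [ii gs ex] dK [KM [F [kM [pM [sM prF dM]]]]].
have [kMi pMs exM] := sM.
have hs : surj_map (g \o pM : {linear F -> N}).
  by move=> y; have [m <-] := gs y; have [f <-] := pMs m; exists f.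
have [X [j sj]] := ker_ses hs; have [ji _ exj] := sj.
exists X, F, j, (g \o pM : {linear F -> N}); split=> //.
have pMk k : pM (kM k) = 0 by apply/exM; exists k.
have [|e eE] := @ses_lift _ _ _ _ j _ kM sj.
  by move=> k; rewrite /= pMk raddf0.
have [|d dE] := @ses_lift _ _ _ _ i g (pM \o j : {linear X -> M}) (And3 ii gs ex).
  by move=> k; apply/(exj (j k)); exists k.
apply: (@pd_le_ext n _ _ _ e d) => //; split.
- by move=> x y /(congr1 j); rewrite !eE; apply: kMi.
- move=> k; have [f fE] := pMs (i k).
  have /exj [x xE] : (g \o pM : {linear F -> N}) f = 0.
    by rewrite /= fE; apply/ex; exists k.
  by exists x; apply: ii; rewrite dE /= xE.
- move=> x; split=> [dx|[k <-]].
    have /exM [k kE] : pM (j x) = 0 by rewrite -[LHS]dE dx raddf0.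
    by exists k; apply: ji; rewrite eE.
  by apply: ii; rewrite dE /= eE pMk raddf0.
Qed.

(** The sequence splits, so a cover of [M] projects onto [K]; the kernel of this new cover is an
    extension of [P] by the old kernel. *)
Lemma pd_le_summand n K M P (i : {linear K -> M}) (g : {linear M -> P}) :
  ses i g -> projective P -> pd_le n M -> pd_le n K.
Proof.
move=> sig pP; have [s [r [gs rs ri r0]]] := ses_split sig pP.
have [ii _ ex] := sig.
case: n => [|n]; first exact: (@projective_retract _ _ i r).
move=> [N [F [kM [pM [sM prF dM]]]]]; have [kMi pMs exM] := sM.
have hs : surj_map (r \o pM : {linear F -> K}).
  by move=> k; have [f fE] := pMs (i k); exists f; rewrite /= fE ri.
have [Y [j sj]] := ker_ses hs; have [ji _ exj] := sj.
exists Y, F, j, (r \o pM : {linear F -> K}); split=> //.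
have pMk k : pM (kM k) = 0 by apply/exM; exists k.
have [|e eE] := @ses_lift _ _ _ _ j _ kM sj.
  by move=> k; rewrite /= pMk raddf0.
apply: (@pd_le_ext n _ _ _ e (g \o pM \o j : {linear Y -> P})) => //.
  split.
  - by move=> x y /(congr1 j); rewrite !eE; apply: kMi.
  - move=> q; have [f fE] := pMs (s q).
    have /exj [y yE] : (r \o pM : {linear F -> K}) f = 0 by rewrite /= fE r0.
    by exists y; rewrite /= yE fE gs.
  - move=> y; split=> /= [gy|[k <-]]; last by rewrite eE pMk raddf0.
    have ry : r (pM (j y)) = 0 by apply/(exj (j y)); exists y.
    have /exM [k kE] : pM (j y) = 0.
      by rewrite -(rs (pM (j y))) ry gy !raddf0 addr0.
    by exists k; apply: ji; rewrite eE.
exact: pd_le_projective.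
Qed.

(** Schanuel's lemma: the pullback [Q] of two covers of [M] is an extension of [P] by [K'] and also
    of [P'] by [K]. *)
Lemma pd_le_syzygy n K P M (i : {linear K -> P}) (g : {linear P -> M}) :
  ses i g -> projective P -> pd_le n.+1 M -> pd_le n K.
Proof.
move=> [ii gs ex] pP [K' [P' [i' [g' [[ii' gs' ex'] pP' dK']]]]].
have [h hE] : exists h : {linear (P * P')%type -> M},
    forall x, h x = g x.1 - g' x.2.
  by apply: linear_ex => c x y; rewrite !linearP scalerDr addrACA.
have hs : surj_map h.
  by move=> m; have [p <-] := gs m; exists (p, 0); rewrite hE raddf0 subr0.
have [Q [j sj]] := ker_ses hs; have [ji _ exj] := sj.
have jE q : g (j q).1 = g' (j q).2.
  by apply/subr0_eq; rewrite -hE; apply/exj; exists q.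
have gi k : g (i k) = 0 by apply/ex; exists k.
have gi' k : g' (i' k) = 0 by apply/ex'; exists k.
have dQ : pd_le n Q.
  have [e0 e0E] : exists e : {linear K' -> (P * P')%type}, forall k, e k = (0, i' k).
    by apply: linear_ex => c x y; rewrite linearP; congr pair; rewrite /= scaler0 addr0.
  have [|e eE] := @ses_lift _ _ _ _ j _ e0 sj.
    by move=> k; rewrite e0E hE /= gi' raddf0 subr0.
  apply: (@pd_le_ext n _ _ _ e (fst \o j : {linear Q -> P})) => //; last exact: pd_le_projective.
  split.
  - by move=> x y /(congr1 j); rewrite !eE !e0E => -[]; apply: ii'.
  - move=> p; have [p' pE] := gs' (g p).
    have /exj [q qE] : h (p, p') = 0 by rewrite hE /= pE subrr.
    by exists q; rewrite /= qE.
  - move=> q; split=> /= [jq|[k <-]]; last by rewrite eE e0E.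
    have /ex' [k kE] : g' (j q).2 = 0 by rewrite -jE jq raddf0.
    by exists k; apply: ji; rewrite eE e0E kE -jq; case: (j q).
have [e0 e0E] : exists e : {linear K -> (P * P')%type}, forall k, e k = (i k, 0).
  by apply: linear_ex => c x y; rewrite linearP; congr pair; rewrite /= scaler0 addr0.
have [|e eE] := @ses_lift _ _ _ _ j _ e0 sj.
  by move=> k; rewrite e0E hE /= gi raddf0 subr0.
apply: (@pd_le_summand n _ _ _ e (snd \o j : {linear Q -> P'})) => //.
split.
- by move=> x y /(congr1 j); rewrite !eE !e0E => -[]; apply: ii.
- move=> p'; have [p pE] := gs (g' p').
  have /exj [q qE] : h (p, p') = 0 by rewrite hE /= pE subrr.
  by exists q; rewrite /= qE.
- move=> q; split=> /= [jq|[k <-]]; last by rewrite eE e0E.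
  have /ex [k kE] : g (j q).1 = 0 by rewrite jE jq raddf0.
  by exists k; apply: ji; rewrite eE e0E kE -jq; case: (j q).
Qed.

Lemma pdim_le_pd_le n M : pdim_le M n -> pd_le n M.
Proof.
elim: n M => [|n IH] M [P [d [e [prP es ex0 ex z]]]] /=.
  (* For n = 0 the term [P 1] vanishes, so [e] is bijective and its inverse is the section. *)
  have [s sE] : exists s : {linear M -> P 0%N}, forall m, e (s m) = m.
    have ei x : e x = 0 -> x = 0.
      by move=> /ex0 [l <-]; rewrite (z 1%N erefl l) raddf0.
    have /choice [s sE] := es.
    have [|s' s'E] := @linear_ex _ _ s.
      move=> c x y; apply/subr0_eq/ei.
      by rewrite raddfB /= linearP !sE subrr.
    by exists s' => m; rewrite s'E.
  exact: projective_retract (prP 0%N).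
have [K [i si]] := ker_ses es; have [ii _ exi] := si.
exists K, (P 0%N), i, e; split=> //; apply: IH.
have [|e' e'E] := @ses_lift _ _ _ _ i e (d 0%N) si.
  by move=> x; apply/ex0; exists x.
exists (fun j => P j.+1), (fun j => d j.+1), e'; split=> //.
- move=> k; have /ex0 [l lE] : e (i k) = 0 by apply/exi; exists k.
  by exists l; apply: ii; rewrite e'E.
- move=> m; rewrite -(ex 0%N m) -e'E; split=> [->|]; first by rewrite raddf0.
  by rewrite -[X in _ = X -> _](raddf0 i); apply: ii.
- by move=> j lj; apply: z.
Qed.

(** [M] is its own first syzygy, so each use of Schanuel's lemma lowers the bound by one. *)
Lemma pd_le_periodic n M (P : lmodType A) (i : {linear M -> P}) (g : {linear P -> M}) :
  ses i g -> projective P -> pd_le n M -> projective M.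
Proof.
by move=> sig pP; elim: n => // n IH /(pd_le_syzygy sig pP).
Qed.

(* If pd I <= n+1, then pd L <= n+1 by the first sequence, so pd K <= n+1 by
   the second one, and pd I <= n by the third. *)
Lemma pd_le_descent n (I K L P Q F : lmodType A)
  (i1 : {linear P -> (I * I)%type}) (g1 : {linear (I * I)%type -> L})
  (i2 : {linear L -> (K * Q)%type}) (g2 : {linear (K * Q)%type -> I})
  (i3 : {linear I -> F}) (g3 : {linear F -> K}) :
  ses i1 g1 -> ses i2 g2 -> ses i3 g3 ->
  projective P -> projective Q -> projective F ->
  pd_le n I -> projective I.
Proof.
move=> s1 s2 s3 pP pQ pF; elim: n => // n IH dI; apply: IH.
apply: (pd_le_syzygy s3 pF).
have dL : pd_le n.+1 L.
  by apply: (pd_le_quotient s1); [apply: pd_le_projective | apply: pd_le_pair].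
have dKQ : pd_le n.+1 (K * Q)%type by apply: pd_le_ext s2 dL dI.
have [e eE] : exists e : {linear K -> (K * Q)%type}, forall k, e k = (k, 0).
  by apply: linear_ex => c x y; congr pair; rewrite /= scaler0 addr0.
apply: (@pd_le_summand _ _ _ _ e snd _ pQ dKQ); split.
- by move=> x y; rewrite !eE => -[].
- by move=> y; exists (0, y).
- move=> [m k]; split=> /= [->|[l]]; first by exists m; rewrite eE.
  by rewrite eE => -[].
Qed.

End Homology.

(** * Quadratic algebras and their Ore extensions *)

Section FreeAlgebra.
Variable K : fieldType.

(** Replaces an algebra structure on [C], so that the universal properties can be applied to plain
    rings such as matrices over A or over polynomials. *)
Definition central_morph (C : nzRingType) (s : {rmorphism K -> C}) : Prop :=
  forall k c, s k * c = c * s k.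

Lemma rmorphism_ex (B C : nzRingType) (f : B -> C) :
  f 1 = 1 -> {morph f : a b / a + b} -> {morph f : a b / a * b} ->
  exists g : {rmorphism B -> C}, forall b, g b = f b.
Proof.
move=> f1 fD fM.
have fB : Algebra.zmod_morphism f.
  move=> a b; apply: (addIr (f b)); rewrite subrK -fD subrK //.
pose F1 := GRing.isZmodMorphism.Build B C f fB.
pose F2 := GRing.isMonoidMorphism.Build B C f (conj f1 fM).
by exists (HB.pack_for {rmorphism B -> C} f F1 F2).
Qed.

Lemma lrmorphism_ex (B C : algType K) (f : B -> C) :
  f 1 = 1 -> {morph f : a b / a + b} -> {morph f : a b / a * b} ->
  (forall k a, f (k *: a) = k *: f a) ->
  exists g : {lrmorphism B -> C}, forall b, g b = f b.
Proof.
move=> f1 fD fM fZ.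
have fB : Algebra.zmod_morphism f.
  move=> a b; apply: (addIr (f b)); rewrite subrK -fD subrK //.
pose F1 := GRing.isZmodMorphism.Build B C f fB.
pose F2 := GRing.isMonoidMorphism.Build B C f (conj f1 fM).
pose F3 := GRing.isScalable.Build K B C *:%R f fZ.
by exists (HB.pack_for {lrmorphism B -> C} f F1 F2 F3).
Qed.

Section Univ.
Variables (C : nzRingType) (s : {rmorphism K -> C}) (c d : C).

Definition word_eval (w : monalg.fmonom 'I_2) : C :=
  \prod_(i <- monalg.fmonom_val w) (if i == ord0 then c else d).

Lemma word_evalM : monalg.mmorphism word_eval.
Proof.
by split=> [w1 w2|]; rewrite /word_eval ?monalg.fmM ?monalg.fm1 ?big_cat ?big_nil.
Qed.

Definition word_morph : monalg.MMorphism.type (monalg.fmonom 'I_2) C :=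
  monalg.MMorphism.Pack
    (monalg.MMorphism.Class (monalg.isMultiplicative.Axioms_ C word_eval word_evalM)).

Lemma free_alg2_univ : central_morph s ->
  exists f : {rmorphism free_alg2 K -> C},
    [/\ f (free_var K ord0) = c, f (free_var K ord_max) = d
      & forall k p, f (k *: p) = s k * f p].
Proof.
move=> sC.
have [||| f fE] := @rmorphism_ex (free_alg2 K) C (monalg.mmap s word_morph).
- exact: monalg.mmap1.
- exact: monalg.mmapD.
- move=> a b; apply: (@monalg.commr_mmap_is_multiplicative _ K C s word_morph _).1.
  by move=> g m m'; apply: sC.
exists f; split=> [||k p]; rewrite !fE ?monalg.mmapZ //.
  by rewrite monalg.mmapU /= rmorph1 mul1r /word_eval monalg.fmU big_seq1.
by rewrite monalg.mmapU /= rmorph1 mul1r /word_eval monalg.fmU big_seq1.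
Qed.

End Univ.

Lemma free_alg2_ind (S : free_alg2 K -> Prop) :
  S 0 -> S 1 -> (forall a b, S a -> S b -> S (a + b)) ->
  (forall k a, S a -> S (k *: a)) -> (forall a b, S a -> S b -> S (a * b)) ->
  S (free_var K ord0) -> S (free_var K ord_max) -> forall a, S a.
Proof.
move=> S0 S1 SD SZ SM Sx Sy a; rewrite [a]monalg.monalgE.
elim/big_ind : _ => // w _; move: (monalg.mcoeff w a) => {a} c.
have -> : monalg.mkmalgU w c = c *: (monalg.mkmalgU w 1 : free_alg2 K).
  by apply/monalg.malgP => w'; rewrite monalg.mcoeffZ !monalg.mcoeffU mulr_natr.
apply: SZ; case: w; elim=> [|i w IH].
  suff -> : monalg.mkmalgU (monalg.FMonom [::]) 1 = 1 :> free_alg2 K by [].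
  by congr (monalg.mkmalgU _ _); apply/eqP; rewrite monalg.fmP monalg.fm1.
have -> : monalg.mkmalgU (monalg.FMonom (i :: w)) 1 =
    free_var K i * monalg.mkmalgU (monalg.FMonom w) 1 :> free_alg2 K.
  rewrite monalg.malgM_def monalg.fgmulUU mulr1; congr (monalg.mkmalgU _ _).
  by apply/eqP; rewrite monalg.fmP monalg.fmM monalg.fmU.
apply: SM => //; have : (i == ord0) || (i == ord_max) by case: i => [[|[]]].
by case/orP => /eqP ->.
Qed.

End FreeAlgebra.

Lemma rmorph_quadric_rel (B C : nzRingType) (f : {rmorphism B -> C}) q (u v : B) :
  f (quadric_rel q u v) = quadric_rel q (f u) (f v).
Proof. by case: q; rewrite /= ?rmorphB ?rmorphD ?rmorphM ?rmorphXn. Qed.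

Section Quadric.
Variables (K : fieldType) (q : quadric) (B : algType K) (bu bv : B).
Hypothesis hB : quadric_algebra q bu bv.

Lemma quadric_algebra_rel : quadric_rel q bu bv = 0.
Proof.
have [phi [<- <- _ phi0]] := hB.
rewrite -rmorph_quadric_rel; apply/phi0.
by exists [:: (1, 1)]; rewrite big_seq1 mul1r mulr1.
Qed.

Lemma quadric_algebra_ind (S : B -> Prop) :
  S 0 -> S 1 -> (forall a b, S a -> S b -> S (a + b)) ->
  (forall k a, S a -> S (k *: a)) -> (forall a b, S a -> S b -> S (a * b)) ->
  S bu -> S bv -> forall a, S a.
Proof.
have [phi [<- <- phis _]] := hB.
move=> S0 S1 SD SZ SM Su Sv a; have [p <-] := phis a.
elim/free_alg2_ind : p => //; first by rewrite raddf0.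
- by rewrite rmorph1.
- by move=> x y Sx Sy; rewrite raddfD; apply: (SD).
- by move=> k x Sx; rewrite linearZ; apply: (SZ).
- by move=> x y Sx Sy; rewrite rmorphM; apply: (SM).
Qed.

(** The map on the free algebra kills the relation ideal, so its value on any chosen preimage under
    [phi] is well defined. *)
Lemma quadric_algebra_univ (C : nzRingType) (s : {rmorphism K -> C}) (c d : C) :
  central_morph s -> quadric_rel q c d = 0 ->
  exists f : {rmorphism B -> C},
    [/\ f bu = c, f bv = d & forall k b, f (k *: b) = s k * f b].
Proof.
move=> sC rel0; have [phi [<- <- phis phi0]] := hB.
have [f [fu fv fZ]] := free_alg2_univ c d sC.
have f0 p : phi p = 0 -> f p = 0.
  move=> /phi0 [l ->]; rewrite raddf_sum big1 // => -[a b] _ /=.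
  by rewrite !rmorphM rmorph_quadric_rel /= fu fv rel0 mulr0 mul0r.
have /choice [g gE] := phis.
have fg p b : phi p = b -> f (g b) = f p.
  move=> pb; apply/subr0_eq; rewrite -rmorphB; apply: f0.
  by rewrite rmorphB /= gE pb subrr.
have [||| h hE] := @rmorphism_ex B C (f \o g).
- by rewrite /= (fg 1) rmorph1.
- by move=> a b; rewrite /= (fg (g a + g b)) ?rmorphD //= !gE.
- by move=> a b; rewrite /= (fg (g a * g b)) ?rmorphM //= !gE.
exists h; rewrite !hE /= !(fg _ _ erefl) fu fv; split=> // k b.
by rewrite !hE /= (fg (k *: g b)) ?linearZ ?fZ //= gE.
Qed.

End Quadric.

(** * Ore extensions: universal property and cancellation of t *)

Section Ore.
Variables (K : fieldType) (q : quadric) (alpha : K) (B A : algType K).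
Variables (bu bv : B) (sigma : {lrmorphism B -> B}) (iota : {lrmorphism B -> A}).
Variables (u v t : A).
Hypotheses (hB : quadric_algebra q bu bv) (sb : bijective sigma).
Hypotheses (su : sigma bu = alpha *: bu) (sv : sigma bv = - alpha *: bv).
Hypothesis hO : Ore_extension sigma iota t.
Hypotheses (iu : iota bu = u) (iv : iota bv = v).

(** The normal form map. With coefficients on the left, evaluation at [t] is compatible with left
    multiplication by B and right multiplication by ['X], although it is not multiplicative. *)
Let ev (p : {poly B}) : A := (map_poly iota p).[t].

Let evE p : ev p = \sum_(i < size p) iota p`_i * t ^+ i.
Proof.
rewrite /ev (@horner_coef_wide _ (size p)); last first.
  by rewrite size_poly.
by apply: eq_bigr => i _; rewrite coef_map.
Qed.

Let tcomm b : t * iota b = iota (sigma b) * t. Proof. by case: hO. Qed.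

Let ev_ex a : exists p, ev p = a.
Proof. by have [_ /(_ a) [p [-> _]]] := hO; exists p; rewrite evE. Qed.

Let ev_inj p p' : ev p = ev p' -> p = p'.
Proof.
move=> e; have [_ /(_ (ev p)) [p0 [_ p0u]]] := hO.
by rewrite -(p0u p) ?evE // -(p0u p') // e evE.
Qed.

Let evD p p' : ev (p + p') = ev p + ev p'.
Proof. by rewrite /ev rmorphD hornerD. Qed.

Let evC b : ev b%:P = iota b.
Proof. by rewrite /ev map_polyC hornerC. Qed.

Let evMX p : ev (p * 'X) = ev p * t.
Proof. by rewrite /ev rmorphM /= map_polyX hornerMX. Qed.

Let evCM b p : ev (b%:P * p) = iota b * ev p.
Proof. by rewrite /ev rmorphM /= map_polyC hornerCM. Qed.

Let evt p : t * ev p = ev (map_poly sigma p * 'X).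
Proof.
rewrite evMX; elim/poly_ind : p => [|p b IH].
  by rewrite map_poly0 /ev !map_poly0 !horner0 mulr0 mul0r.
rewrite rmorphD rmorphM /= map_polyX map_polyC /= !evD !evMX !evC.
by rewrite mulrDr mulrDl mulrA IH tcomm.
Qed.

Lemma ore_ind (S : A -> Prop) :
  S 0 -> S 1 -> (forall a b, S a -> S b -> S (a + b)) ->
  (forall k a, S a -> S (k *: a)) -> (forall a b, S a -> S b -> S (a * b)) ->
  S u -> S v -> S t -> forall a, S a.
Proof.
move=> S0 S1 SD SZ SM Su Sv St a; have [p <-] := ev_ex a.
elim/poly_ind: p => [|p b IH]; first by rewrite /ev map_poly0 horner0.
rewrite evD evMX evC; apply: (SD); first exact: (SM).
elim/(quadric_algebra_ind hB) : b; rewrite ?raddf0 ?rmorph1 ?iu ?iv //.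
- by move=> x y Sx Sy; rewrite raddfD; apply: (SD).
- by move=> k x Sx; rewrite linearZ; apply: (SZ).
- by move=> x y Sx Sy; rewrite rmorphM; apply: (SM).
Qed.

Lemma ore_rel : [/\ quadric_rel q u v = 0, t * u = alpha *: u * t
  & t * v = - alpha *: v * t].
Proof.
rewrite -iu -iv -rmorph_quadric_rel (quadric_algebra_rel hB) raddf0.
by rewrite !tcomm su sv !linearZ.
Qed.

(** The map is defined on normal forms. The rule e g(b) = g(sigma b) e extends from the generators
    to all b, which shows f(t a) = e f(a); multiplicativity then follows by induction on the left
    factor. *)
Lemma ore_univ (C : nzRingType) (s : {rmorphism K -> C}) (c d e : C) :
  central_morph s -> quadric_rel q c d = 0 ->
  e * c = s alpha * c * e -> e * d = - s alpha * d * e ->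
  exists f : {rmorphism A -> C},
    [/\ f u = c, f v = d, f t = e & forall k b, f (k *: b) = s k * f b].
Proof.
move=> sC rel0 ec ed; have [g [gu gv gZ]] := quadric_algebra_univ hB sC rel0.
have eg b : e * g b = g (sigma b) * e.
  elim/(quadric_algebra_ind hB) : b.
  - by rewrite !raddf0 mulr0 mul0r.
  - by rewrite !rmorph1 mulr1 mul1r.
  - by move=> a b IHa IHb; rewrite !rmorphD mulrDr mulrDl IHa IHb.
  - by move=> k a IH; rewrite linearZ /= !gZ mulrA -sC -mulrA IH mulrA.
  - by move=> a b IHa IHb; rewrite !rmorphM mulrA IHa -mulrA IHb mulrA.
  - by rewrite su gZ gu.
  - by rewrite sv gZ gv ed rmorphN.
have /choice [pol polE] := ev_ex.
have polP p : pol (ev p) = p by apply: ev_inj.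
pose f a := (map_poly g (pol a)).[e].
have fev p : f (ev p) = (map_poly g p).[e] by rewrite /f polP.
have fD a b : f (a + b) = f a + f b.
  by rewrite -(polE a) -(polE b) -evD !fev rmorphD hornerD.
have fi b a : f (iota b * a) = g b * f a.
  by rewrite -(polE a) -evCM !fev rmorphM /= map_polyC hornerCM.
have ft a : f (t * a) = e * f a.
  rewrite -(polE a) evt !fev rmorphM /= map_polyX hornerMX.
  elim/poly_ind: (pol a) => [|p b IH].
    by rewrite !map_poly0 !horner0 mulr0 mul0r.
  rewrite !rmorphD !rmorphM /= !map_polyX !map_polyC /= !hornerD !hornerMX !hornerC.
  by rewrite mulrDl mulrDr IH eg mulrA.
have f1 : f 1 = 1.
  have := fev 1%:P; rewrite evC map_polyC hornerC (rmorph1 iota) => f1.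
  exact: etrans f1 (rmorph1 g).
have f0 : f 0 = 0 by apply: (addrI (f 0)); rewrite -fD !addr0.
have fZ k x : f (k *: x) = s k * f x.
  have -> : k *: x = iota (k *: 1) * x by rewrite linearZ /= rmorph1 mulr_algl.
  by rewrite fi gZ rmorph1 mulr1.
have fM a b : f (a * b) = f a * f b.
  elim/ore_ind : a b => [b|b|a a' IH IH' b|k a IH b|a a' IH IH' b|b|b|b].
  - by rewrite mul0r f0 mul0r.
  - by rewrite f1 !mul1r.
  - by rewrite mulrDl !fD IH IH' mulrDl.
  - by rewrite -scalerAl !fZ IH mulrA.
  - by rewrite -mulrA !IH IH' mulrA.
  - by rewrite -iu fi -[iota bu]mulr1 fi f1 mulr1.
  - by rewrite -iv fi -[iota bv]mulr1 fi f1 mulr1.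
  - by rewrite ft -[t in RHS]mulr1 ft f1 mulr1.
have [h hE] := rmorphism_ex f1 fD fM.
exists h; split=> [|||k b]; rewrite !hE //.
- by rewrite -iu -[iota bu]mulr1 fi f1 mulr1.
- by rewrite -iv -[iota bv]mulr1 fi f1 mulr1.
- by rewrite -[t]mulr1 ft f1 mulr1.
Qed.

Lemma ore_regular a : a * t = 0 -> a = 0.
Proof.
have [p <-] := ev_ex a; rewrite -evMX.
have ev0 : ev 0 = 0 by rewrite /ev map_poly0 horner0.
rewrite -ev0 => /ev_inj pX0; congr ev; apply/polyP => i.
by have /(congr1 (fun r : {poly B} => r`_i.+1)) := pX0; rewrite coefMX !coef0.
Qed.

Lemma ore_decomp a : exists b a', a = iota b + a' * t.
Proof.
have [p <-] := ev_ex a; elim/poly_ind: p => [|p b _].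
  by exists 0, 0; rewrite raddf0 mul0r addr0 /ev map_poly0 horner0.
by exists b, (ev p); rewrite evD evMX evC addrC.
Qed.

Lemma ore_base a b : iota b = a * t -> b = 0.
Proof.
have [p <-] := ev_ex a; rewrite -evMX -evC => /ev_inj /(congr1 (coefp 0)).
by rewrite /coefp coefC coefMX.
Qed.

Lemma ore_swap a : exists a', t * a = a' * t.
Proof. by have [p <-] := ev_ex a; rewrite evt evMX; eexists. Qed.

(** If b is the constant term of [a], cancelling t on the right makes sigma b a multiple of t, so
    sigma b = 0, and sigma is injective. *)
Lemma ore_cancel a c : t * a = c * t ^+ 2 -> exists a', a = a' * t.
Proof.
have [b [a' ->]] := ore_decomp a; rewrite mulrDr tcomm => e.
have [a'' a'E] := ore_swap a'.
exists a'; suff -> : b = 0 by rewrite raddf0 add0r.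
apply: (bij_inj sb); rewrite raddf0; apply: (@ore_base (c - a'')).
apply/subr0_eq/ore_regular; rewrite !mulrBl -!mulrA -expr2 -e mulrA a'E -mulrA.
by rewrite opprB addrA subrr.
Qed.

End Ore.

(** * Generators a, b with b a = tau a b *)

Section Diagonal.
Variables (K : fieldType) (im : K).
Hypotheses (im2 : im ^+ 2 = -1) (two : (2 : K) != 0).

Definition diagA (q : quadric) (A : algType K) (u v : A) : A :=
  match q with Comm | Skew => u | SqDiff => u + v | SqSum => u + im *: v end.

Definition diagB (q : quadric) (A : algType K) (u v : A) : A :=
  match q with Comm | Skew => v | SqDiff => u - v | SqSum => u - im *: v end.

Definition diag_sign (q : quadric) : K := if q is Comm then 1 else -1.

Let imim : im * im = -1. Proof. by rewrite -expr2. Qed.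

Lemma diagAK q (A : algType K) (u v : A) : exists c d,
  u = c *: diagA q u v + d *: diagB q u v.
Proof.
case: q => /=; try by exists 1, 0; rewrite scale0r addr0 scale1r.
  by exists 2^-1, 2^-1; nc_prep K A; repeat split; field.
by exists 2^-1, 2^-1; nc_prep K A; repeat split; field.
Qed.

Lemma diagBK q (A : algType K) (u v : A) : exists c d,
  v = c *: diagA q u v + d *: diagB q u v.
Proof.
case: q => /=; try by exists 0, 1; rewrite scale0r add0r scale1r.
  by exists 2^-1, (- 2^-1); nc_prep K A; repeat split; field.
exists (- im / 2), (im / 2); nc_prep K A; repeat split; try by field.
rewrite [LHS](_ : _ = 1 + im * im); last by field.
by rewrite imim subrr.
Qed.

Lemma diag_rel q (A : algType K) (u v : A) : quadric_rel q u v = 0 ->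
  diagB q u v * diagA q u v = diag_sign q *: (diagA q u v * diagB q u v).
Proof.
move=> h; apply/subr0_eq; case: q h => /= h.
- have -> : v * u - 1 *: (u * v) = (-1) *: (u * v - v * u) by nc_ring K A.
  by rewrite h scaler0.
- have -> : v * u - (-1) *: (u * v) = u * v + v * u by nc_ring K A.
  by rewrite h.
- have -> : (u - v) * (u + v) - (-1) *: ((u + v) * (u - v)) =
    2 *: (u ^+ 2 - v ^+ 2) by nc_ring K A.
  by rewrite h scaler0.
- have -> : (u - im *: v) * (u + im *: v) - (-1) *: ((u + im *: v) * (u - im *: v)) =
    2 *: (u ^+ 2 - (im * im) *: v ^+ 2) by nc_ring K A.
  by rewrite imim scaleN1r opprK h scaler0.
Qed.

End Diagonal.

(** * A faithful matrix model of the quadratic algebra *)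

Section Model.
Variables (K : fieldType) (im : K).
Hypotheses (im2 : im ^+ 2 = -1) (two : (2 : K) != 0).
Variables (q : quadric) (B : algType K) (u v : B).
Hypothesis hB : quadric_algebra q u v.
Local Notation a := (diagA im q u v).
Local Notation b := (diagB im q u v).
Local Notation tau := (diag_sign K q).

Let imim : im * im = -1. Proof. by rewrite -expr2. Qed.

Let ba : b * a = tau *: (a * b).
Proof. exact/diag_rel/quadric_algebra_rel. Qed.

Let commK (c : B) : commr_rmorph (in_alg B) c.
Proof. by move=> k; rewrite /GRing.comm /= mulr_algl mulr_algr. Qed.

Let h : {rmorphism {poly K} -> B} := horner_morph (commK a).

Let hX : h 'X = a. Proof. exact: horner_morphX. Qed.
Let hC k : h k%:P = k%:A. Proof. by rewrite /h /= horner_morphC. Qed.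

(** Sends the inner variable to [a] and the outer one to [b], powers of [a] written first: [Psi]
    parametrizes the ordered combinations of the a^i b^j. *)
Let Psi (F : {poly {poly K}}) : B := (map_poly h F).[b].

Let PsiD F G : Psi (F + G) = Psi F + Psi G.
Proof. by rewrite /Psi rmorphD hornerD. Qed.

Let PsiC c : Psi c%:P = h c.
Proof. by rewrite /Psi map_polyC hornerC. Qed.

Let PsiMX F : Psi (F * 'X) = Psi F * b.
Proof. by rewrite /Psi rmorphM /= map_polyX hornerMX. Qed.

Let PsiCM c F : Psi (c%:P * F) = h c * Psi F.
Proof. by rewrite /Psi rmorphM /= map_polyC hornerCM. Qed.

Let b_h c : exists c', b * h c = h c' * b.
Proof.
elim/poly_ind: c => [|c k [c' IH]]; first by exists 0; rewrite !raddf0 mulr0 mul0r.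
exists (tau%:P * c' * 'X + k%:P).
have -> : h (c * 'X + k%:P) = h c * a + k *: 1 by rewrite rmorphD rmorphM /= hX hC.
have -> : h (tau%:P * c' * 'X + k%:P) = tau *: (h c' * a) + k *: 1.
  by rewrite rmorphD !rmorphM /= hX !hC mulr_algl -scalerAl.
have -> : b * (h c * a + k *: 1) = (b * h c) * a + k *: b by nc_ring K B.
rewrite IH -(mulrA _ b a) ba; by nc_ring K B.
Qed.

Let b_Psi F : exists G, b * Psi F = Psi G.
Proof.
elim/poly_ind: F => [|F c [G IH]].
  by exists 0; rewrite /Psi map_poly0 horner0 mulr0.
have [c' c'E] := b_h c; exists (G * 'X + c'%:P * 'X).
rewrite PsiD PsiMX PsiC mulrDr mulrA IH c'E PsiD !PsiMX PsiC //.
Qed.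

Let Psi_ex x : exists F, x = Psi F.
Proof.
suff H y : forall F, exists G, y * Psi F = Psi G.
  by have [G GE] := H x 1; exists G; rewrite -GE PsiC rmorph1 mulr1.
have Ha F : exists G, a * Psi F = Psi G by exists ('X%:P * F); rewrite PsiCM hX.
have Hlin c d (x1 x2 : B) : (forall F, exists G, x1 * Psi F = Psi G) ->
    (forall F, exists G, x2 * Psi F = Psi G) ->
    forall F, exists G, (c *: x1 + d *: x2) * Psi F = Psi G.
  move=> H1 H2 F; have [G1 E1] := H1 F; have [G2 E2] := H2 F.
  exists (c%:P%:P * G1 + d%:P%:P * G2).
  by rewrite PsiD !PsiCM !hC !mulr_algl mulrDl -!scalerAl E1 E2.
elim/(quadric_algebra_ind hB): y.
- by move=> F; exists 0; rewrite mul0r /Psi map_poly0 horner0.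
- by move=> F; exists F; rewrite mul1r.
- by move=> x1 x2 H1 H2 F; have := Hlin 1 1 _ _ H1 H2 F; rewrite !scale1r.
- by move=> k x1 H1 F; have := Hlin k 0 _ _ H1 H1 F; rewrite scale0r addr0.
- move=> x1 x2 H1 H2 F; have [G2 E2] := H2 F; have [G1 E1] := H1 G2.
  by exists G1; rewrite -mulrA E2.
- by have [c [d uE]] := diagAK im two q u v; have := Hlin c d _ _ Ha b_Psi; rewrite -uE.
- by have [c [d vE]] := diagBK im2 two q u v; have := Hlin c d _ _ Ha b_Psi; rewrite -vE.
Qed.

Local Notation PP := {poly {poly K}}.

Let scal_fun (k : K) : 'M[PP]_2 := (k%:P%:P)%:M.

Let scalM : exists s : {rmorphism K -> 'M[PP]_2}, forall k, s k = scal_fun k.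
Proof.
apply: rmorphism_ex; rewrite /scal_fun //.
- by move=> k l; rewrite !rmorphD.
- by move=> k l; rewrite !rmorphM.
Qed.

(** Exchanging the diagonal entries of [model_a] multiplies it by [tau], because tau^2 = 1;
    conjugation by the antidiagonal [model_b] does exactly that. *)
Definition model_a : 'M[PP]_2 := \matrix_(i, j)
  if i == j then (if i == ord0 then 'X%:P else tau%:P%:P * 'X%:P) else 0.

Definition model_b : 'M[PP]_2 := \matrix_(i, j) if i == j then 0 else 'X.

Lemma mx2P (S : pzRingType) (M N : 'M[S]_2) :
  M ord0 ord0 = N ord0 ord0 -> M ord0 ord_max = N ord0 ord_max ->
  M ord_max ord0 = N ord_max ord0 -> M ord_max ord_max = N ord_max ord_max ->
  M = N.
Proof.
move=> h1 h2 h3 h4; apply/matrixP => i j.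
have o2 (k : 'I_2) : k = ord0 \/ k = ord_max.
  by case: k => [[|[|]] //] lk; [left | right]; apply: val_inj.
by case: (o2 i) => ->; case: (o2 j) => ->.
Qed.

Let model_ba : model_b * model_a = (tau%:P%:P)%:M * (model_a * model_b).
Proof.
have tt : tau%:P%:P * tau%:P%:P = 1 :> PP.
  by rewrite -!rmorphM /= /diag_sign; case: q; rewrite ?mulrNN mulr1 !rmorph1.
by apply: mx2P; rewrite ?(mxE, big_ord_recl, big_ord0) /= ?(mxE, big_ord_recl, big_ord0) /=; ring: tt.
Qed.

Local Notation M2 := 'M[PP]_2.

Let modelE (k : K) (M : M2) : scal_fun k * M = k%:P%:P *: M.
Proof. exact: mul_scalar_mx. Qed.

Definition model_u : M2 :=
  match q with
  | Comm | Skew => model_a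
  | SqDiff | SqSum => (2^-1)%:P%:P *: (model_a + model_b)
  end.

(** [model_u] and [model_v] invert the change of generators; the factor - im / 2 is the inverse of 2
    im. *)
Definition model_v : M2 :=
  match q with
  | Comm | Skew => model_b
  | SqDiff => (2^-1)%:P%:P *: (model_a - model_b)
  | SqSum => (- im / 2)%:P%:P *: (model_a - model_b)
  end.

Let model_rel : quadric_rel q model_u model_v = 0.
Proof.
have ba0 : model_b * model_a = tau%:P%:P *: (model_a * model_b).
  by rewrite model_ba; apply: mul_scalar_mx.
have ba1 : model_b * model_a - tau%:P%:P *: (model_a * model_b) = 0.
  by rewrite ba0 subrr.
have im2' : (- im / 2) * (- im / 2) = - (2^-1 * 2^-1) :> K.
  by have ii := imim; field: ii.
rewrite /quadric_rel /model_u /model_v; move: ba1; rewrite /diag_sign; case: q => ba1.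
- rewrite (_ : _ - _ = -1 *: (model_b * model_a - 1%:P%:P *: (model_a * model_b))).
    by rewrite ba1 scaler0.
  by rewrite !rmorph1; nc_ring constr:(PP) constr:(M2).
- rewrite -[RHS]ba1 !rmorphN !rmorph1; by nc_ring constr:(PP) constr:(M2).
- rewrite -[RHS](scaler0 _ ((2^-1)%:P%:P * (2^-1)%:P%:P * 2)) -ba1.
  rewrite !rmorphN !rmorph1; by nc_ring constr:(PP) constr:(M2).
- rewrite -[RHS](scaler0 _ ((2^-1)%:P%:P * (2^-1)%:P%:P * 2)) -ba1.
  have im3 : (- im / 2)%:P%:P * (- im / 2)%:P%:P = - ((2^-1)%:P%:P * (2^-1)%:P%:P) :> PP.
    by rewrite -!polyCM im2' !polyCN.
  rewrite !rmorphN !rmorph1; nc_prep constr:(PP) constr:(M2); repeat split; ring: im3.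
Qed.

Let row0 (M : M2) : PP := M ord0 ord0 + M ord0 ord_max.

(* The image of [a] is diagonal and that of [b] is antidiagonal; the sum of the
   first row recovers the coordinates with respect to the monomials a^i b^j. *)
Lemma quadric_model : exists (s : {rmorphism K -> M2}) (f : {rmorphism B -> M2}),
  [/\ f a = model_a, f b = model_b, forall k x, f (k *: x) = s k * f x,
      central_morph s /\ (forall k, s k = (k%:P%:P)%:M)
    & forall x, f x = 0 -> x = 0].
Proof.
have [s sE] := scalM.
have sC : central_morph s by move=> k c; rewrite sE; apply: esym; apply: scalar_mxC.
have [f [fu fv fZ]] := quadric_algebra_univ hB sC model_rel.
have half : (2^-1)%:P%:P + (2^-1)%:P%:P = 1 :> PP.
  by rewrite -!polyCD (_ : 2^-1 + 2^-1 = 1) //; field.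
have halfi : im%:P%:P * (- im / 2)%:P%:P = (2^-1)%:P%:P :> PP.
  rewrite -!polyCM; congr (_%:P%:P); have ii := imim; by field: ii.
have fZ' k x : f (k *: x) = k%:P%:P *: f x by rewrite fZ sE; apply: modelE.
have fa : f a = model_a.
  rewrite /diagA; move: fu fv; rewrite /model_u /model_v; case: q => // fu fv.
    rewrite rmorphD fu fv; nc_prep constr:(PP) constr:(M2); repeat split; ring: half.
  rewrite rmorphD fZ' fu fv scalerA halfi.
  by nc_prep constr:(PP) constr:(M2); repeat split; ring: half.
have fb : f b = model_b.
  rewrite /diagB; move: fu fv; rewrite /model_u /model_v; case: q => // fu fv.
    rewrite rmorphB fu fv; nc_prep constr:(PP) constr:(M2); repeat split; ring: half.
  rewrite rmorphB fZ' fu fv scalerA halfi.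
  by nc_prep constr:(PP) constr:(M2); repeat split; ring: half.
exists s, f; split=> //.
have fh c : f (h c) ord0 ord0 = c%:P /\ f (h c) ord0 ord_max = 0.
  elim/poly_ind: c => [|c k [IH0 IH1]]; first by rewrite !raddf0 !mxE.
  rewrite rmorphD rmorphM /= hX hC rmorphD rmorphM fa fZ' rmorph1.
  rewrite !mxE !big_ord_recl !big_ord0 !mxE /= IH0.
  have -> : lift ord0 ord0 = ord_max :> 'I_2 by apply: val_inj.
  by rewrite IH1 !rmorphD !rmorphM /=; split; ring.
have fP F : row0 (f (Psi F)) = F.
  elim/poly_ind: F => [|F c IH].
    by rewrite /Psi map_poly0 horner0 raddf0 /row0 !mxE addr0.
  have [h0 h1] := fh c.
  rewrite PsiD PsiMX PsiC rmorphD rmorphM fb /row0.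
  rewrite !mxE !big_ord_recl !big_ord0 !mxE /= h0 h1 -[in RHS]IH /row0.
  have -> : lift ord0 ord0 = ord_max :> 'I_2 by apply: val_inj.
  by ring.
move=> x fx; have [F xE] := Psi_ex x.
rewrite xE -(fP F) -xE fx /row0 !mxE addr0 /Psi map_poly0 horner0 //.
Qed.

End Model.

Section QuadricOre.
Variables (K : fieldType) (q : quadric) (alpha : K) (A : cgAlg K) (u v t : A).
Hypothesis hA : quadric_Ore q alpha u v t.

Lemma quadric_Ore_ind (S : A -> Prop) :
  S 0 -> S 1 -> (forall a b, S a -> S b -> S (a + b)) ->
  (forall k a, S a -> S (k *: a)) -> (forall a b, S a -> S b -> S (a * b)) ->
  S u -> S v -> S t -> forall a, S a.
Proof.
have [_ _ _ [B [bu [bv [sigma [iota [hB sb [su sv] hO [iu iv]]]]]]]] := hA.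
exact: (ore_ind hB hO iu iv).
Qed.

Lemma quadric_Ore_rel : [/\ quadric_rel q u v = 0, t * u = alpha *: u * t
  & t * v = - alpha *: v * t].
Proof.
have [_ _ _ [B [bu [bv [sigma [iota [hB sb [su sv] hO [iu iv]]]]]]]] := hA.
exact: (ore_rel hB su sv hO iu iv).
Qed.

Lemma quadric_Ore_univ (C : nzRingType) (s : {rmorphism K -> C}) (c d e : C) :
  central_morph s -> quadric_rel q c d = 0 ->
  e * c = s alpha * c * e -> e * d = - s alpha * d * e ->
  exists f : {rmorphism A -> C},
    [/\ f u = c, f v = d, f t = e & forall k b, f (k *: b) = s k * f b].
Proof.
have [_ _ _ [B [bu [bv [sigma [iota [hB sb [su sv] hO [iu iv]]]]]]]] := hA.
exact: (ore_univ hB su sv hO iu iv).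
Qed.

Lemma quadric_Ore_regular (a : A) : a * t = 0 -> a = 0.
Proof.
have [_ _ _ [B [bu [bv [sigma [iota [hB sb [su sv] hO [iu iv]]]]]]]] := hA.
exact: (ore_regular hO).
Qed.

Lemma quadric_Ore_swap (a : A) : exists a', t * a = a' * t.
Proof.
have [_ _ _ [B [bu [bv [sigma [iota [hB sb [su sv] hO [iu iv]]]]]]]] := hA.
exact: (ore_swap hO).
Qed.

Lemma quadric_Ore_cancel (a c : A) : t * a = c * t ^+ 2 -> exists a', a = a' * t.
Proof.
have [_ _ _ [B [bu [bv [sigma [iota [hB sb [su sv] hO [iu iv]]]]]]]] := hA.
exact: (ore_cancel sb hO).
Qed.

(** The model of the base composed with the quotient by t: membership in A t becomes the vanishing
    of a matrix over a commutative domain. *)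
Lemma quadric_Ore_model (im : K) : im ^+ 2 = -1 -> (2 : K) != 0 ->
  exists (s : {rmorphism K -> 'M[{poly {poly K}}]_2})
         (f : {rmorphism A -> 'M[{poly {poly K}}]_2}),
  [/\ f (diagA im q u v) = model_a K q, f (diagB im q u v) = model_b K,
      (forall k, s k = (k%:P%:P)%:M) /\ (forall k x, f (k *: x) = s k * f x), f t = 0
    & forall x, f x = 0 -> exists x', x = x' * t].
Proof.
move=> im2 two.
have [_ _ _ [B [bu [bv [sigma [iota [hB sb [su sv] hO [iu iv]]]]]]]] := hA.
have [s [g [ga gb gZ [sC sE] g0]]] := quadric_model im2 two hB.
have rel0 : quadric_rel q (g bu) (g bv) = 0.
  by rewrite -rmorph_quadric_rel (quadric_algebra_rel hB) raddf0.
have [f [fu fv ft fZ]] : exists f : {rmorphism A -> 'M[{poly {poly K}}]_2},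
    [/\ f u = g bu, f v = g bv, f t = 0 & forall k b, f (k *: b) = s k * f b].
  by apply: quadric_Ore_univ => //; rewrite mulr0 mul0r.
have fi b : f (iota b) = g b.
  elim/(quadric_algebra_ind hB) : b.
  - by rewrite !raddf0.
  - by rewrite !rmorph1.
  - by move=> x y IHx IHy; rewrite !rmorphD IHx IHy.
  - by move=> k x IH; rewrite linearZ fZ gZ IH.
  - by move=> x y IHx IHy; rewrite !rmorphM IHx IHy.
  - by rewrite iu.
  - by rewrite iv.
exists s, f; split=> //.
- rewrite -ga -fi -iu -iv; congr (f _); rewrite /diagA.
  by case: (q) => //; rewrite rmorphD //; congr (_ + _); rewrite [RHS]linearZ.
- rewrite -gb -fi -iu -iv; congr (f _); rewrite /diagB.
  by case: (q) => //; rewrite rmorphB //; congr (_ - _); rewrite [RHS]linearZ.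
- move=> x; have [b [x' ->]] := ore_decomp hO x.
  rewrite rmorphD rmorphM ft mulr0 addr0 fi => /g0 ->.
  by exists x'; rewrite raddf0 add0r.
Qed.

End QuadricOre.

(** * Operators on A prescribed on u, v and t *)

Section Operators.
Variables (K : fieldType) (q : quadric) (alpha : K) (A : cgAlg K) (u v t : A).
Hypothesis hA : quadric_Ore q alpha u v t.

Lemma in_alg_central : central_morph (in_alg A : {rmorphism K -> A}).
Proof. by move=> k c; rewrite /= mulr_algl mulr_algr. Qed.

(** Equal squares are what the relations u^2 = +-v^2 demand. Besides x and y, this provides the
    substitutions t -> -t and t -> 0 used to study the invariants. *)
Lemma diagonal_morph (cu cv ct : K) : cu ^+ 2 = cv ^+ 2 ->
  exists f : {lrmorphism A -> A}, [/\ f u = cu *: u, f v = cv *: v & f t = ct *: t].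
Proof.
move=> cc; have [rel0 tu tv] := quadric_Ore_rel hA.
have [|||f [fu fv ft fZ]] := @quadric_Ore_univ _ _ _ _ _ _ _ hA A (in_alg A)
    (cu *: u) (cv *: v) (ct *: t) in_alg_central.
- move: rel0; case: q => /= rel0.
  + transitivity ((cu * cv) *: (u * v - v * u)); last by rewrite rel0 scaler0.
    by nc_ring K A.
  + transitivity ((cu * cv) *: (u * v + v * u)); last by rewrite rel0 scaler0.
    by nc_ring K A.
  + transitivity (cu ^+ 2 *: (u ^+ 2 - v ^+ 2)); last by rewrite rel0 scaler0.
    by nc_prep K A; repeat split; ring: cc.
  + transitivity (cu ^+ 2 *: (u ^+ 2 + v ^+ 2)); last by rewrite rel0 scaler0.
    by nc_prep K A; repeat split; ring: cc.
- transitivity ((ct * cu) *: (t * u)); first by nc_ring K A.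
  by rewrite tu /= mulr_algl; nc_ring K A.
- transitivity ((ct * cv) *: (t * v)); first by nc_ring K A.
  by rewrite tv /= mulNr mulr_algl; nc_ring K A.
have [] := @lrmorphism_ex K A A f; rewrite ?rmorph1 //.
- exact: rmorphD.
- exact: rmorphM.
- by move=> k a; rewrite fZ /= mulr_algl.
by move=> g gE; exists g; rewrite !gE.
Qed.

(* The multiplicativity of [Z] is twisted by the parities of [Y] and [X2]; it is
   read off the ring homomorphism that maps a Y-homogeneous [a] of parity [e] to
   diag (Z a, X2 (Z a)) * w ^ e, where [w] is the permutation matrix of order 2. *)
Lemma twisted_morph (Y X2 : {lrmorphism A -> A}) (c kappa eps : K) :
  (2 : K) != 0 -> c ^+ 2 = 1 -> kappa ^+ 2 = 1 ->
  Y u = - u -> Y v = - v -> Y t = t ->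
  X2 u = c *: u -> X2 v = c *: v -> X2 t = - t ->
  exists Z : {linear A -> A},
    [/\ [/\ Z u = v, Z v = kappa *: u & Z t = eps *: t], Z 1 = 1
      & forall a b, Z (a * b) = 2^-1 *: (Z a * Z b + Y (Z a) * Z b
                              + Z a * X2 (Z b) - Y (Z a) * X2 (Z b))].
Proof.
move=> two c2 k2 Yu Yv Yt Xu Xv Xt; have [rel0 tu tv] := quadric_Ore_rel hA.
pose scal_fun k : 'M[A]_2 := (k%:A)%:M.
have [|||s sE] := @rmorphism_ex K 'M[A]_2 scal_fun.
- by rewrite /scal_fun scale1r.
- by move=> k l; rewrite /scal_fun scalerDl; apply: rmorphD.
- move=> k l; rewrite /scal_fun.
  have -> : (k * l) *: 1 = (k *: 1) * (l *: 1) :> A by nc_ring K A.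
  exact: scalar_mxM.
have sC : central_morph s.
  move=> k M; rewrite sE /scal_fun; apply/matrixP => i j.
  rewrite !mxE (bigD1 i) //= [RHS](bigD1 j) //= !mxE !eqxx !mulr1n.
  rewrite !big1 ?addr0 ?mulr_algl ?mulr_algr //.
    by move=> l lj; rewrite mxE (negPf lj) mulr0.
  by move=> l lj; rewrite mxE eq_sym (negPf lj) mul0r.
pose anti (a b : A) : 'M[A]_2 := \matrix_(i, j)
  if i == j then 0 else if i == ord0 then a else b.
pose dia (a b : A) : 'M[A]_2 := \matrix_(i, j)
  if i == j then if i == ord0 then a else b else 0.
have mxE2 := (mxE, big_ord_recl, big_ord0).
have [|||G [Gu Gv Gt GZ]] := @quadric_Ore_univ _ _ _ _ _ _ _ hA _ s
   (anti v (c *: v)) (anti (kappa *: u) ((kappa * c) *: u)) (dia (eps *: t) (- eps *: t)) sC.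
- move: rel0; case: q => /= rel0.
  + apply: mx2P; rewrite ?mxE2 /= ?mxE2 /=.
    * transitivity ((- kappa * c) *: (u * v - v * u)); last by rewrite rel0 scaler0.
      by nc_ring K A.
    * by nc_ring K A.
    * by nc_ring K A.
    * transitivity ((- kappa * c) *: (u * v - v * u)); last by rewrite rel0 scaler0.
      by nc_ring K A.
  + apply: mx2P; rewrite ?mxE2 /= ?mxE2 /=.
    * transitivity ((kappa * c) *: (u * v + v * u)); last by rewrite rel0 scaler0.
      by nc_ring K A.
    * by nc_ring K A.
    * by nc_ring K A.
    * transitivity ((kappa * c) *: (u * v + v * u)); last by rewrite rel0 scaler0.
      by nc_ring K A.
  + apply: mx2P; rewrite ?mxE2 /= ?mxE2 /=.
    * transitivity ((- c) *: (u ^+ 2 - v ^+ 2)); last by rewrite rel0 scaler0.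
      by nc_prep K A; repeat split; ring: k2.
    * by nc_ring K A.
    * by nc_ring K A.
    * transitivity ((- c) *: (u ^+ 2 - v ^+ 2)); last by rewrite rel0 scaler0.
      by nc_prep K A; repeat split; ring: k2.
  + apply: mx2P; rewrite ?mxE2 /= ?mxE2 /=.
    * transitivity (c *: (u ^+ 2 + v ^+ 2)); last by rewrite rel0 scaler0.
      by nc_prep K A; repeat split; ring: k2.
    * by nc_ring K A.
    * by nc_ring K A.
    * transitivity (c *: (u ^+ 2 + v ^+ 2)); last by rewrite rel0 scaler0.
      by nc_prep K A; repeat split; ring: k2.
- rewrite sE; apply: mx2P; rewrite ?mxE2 /= ?mxE2 /= !mulr1n !mulr0n.
  + by nc_ring K A.
  + transitivity (eps *: (t * v)); first by nc_ring K A.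
    by rewrite tv; nc_ring K A.
  + transitivity ((- eps * c) *: (t * v)); first by nc_ring K A.
    by rewrite tv; nc_ring K A.
  + by nc_ring K A.
- rewrite sE; apply: mx2P; rewrite ?mxE2 /= ?mxE2 /= !mulr1n !mulr0n.
  + by nc_ring K A.
  + transitivity ((eps * kappa) *: (t * u)); first by nc_ring K A.
    by rewrite tu; nc_ring K A.
  + transitivity ((- eps * kappa * c) *: (t * u)); first by nc_ring K A.
    by rewrite tu; nc_ring K A.
  + by nc_ring K A.
have XZ k a : X2 (k *: a) = k *: X2 a by rewrite linearZ.
have YZ k a : Y (k *: a) = k *: Y a by rewrite linearZ.
have XX a : X2 (X2 a) = a.
  elim/(quadric_Ore_ind hA) : a => [|| a b Ha Hb | k a Ha | a b Ha Hb |||].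
  - by rewrite !raddf0.
  - by rewrite !rmorph1.
  - by rewrite !rmorphD /= Ha Hb.
  - by rewrite !XZ Ha.
  - by rewrite !rmorphM /= Ha Hb.
  - by rewrite Xu XZ Xu scalerA -expr2 c2 scale1r.
  - by rewrite Xv XZ Xv scalerA -expr2 c2 scale1r.
  - by rewrite Xt rmorphN /= Xt opprK.
have YX a : Y (X2 a) = X2 (Y a).
  elim/(quadric_Ore_ind hA) : a => [|| a b Ha Hb | k a Ha | a b Ha Hb |||].
  - by rewrite !raddf0.
  - by rewrite !rmorph1.
  - by rewrite !rmorphD /= Ha Hb.
  - by rewrite XZ !YZ XZ Ha.
  - by rewrite !rmorphM /= Ha Hb.
  - by rewrite Xu Yu YZ Yu rmorphN /= Xu scalerN.
  - by rewrite Xv Yv YZ Yv rmorphN /= Xv scalerN.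
  - by rewrite Xt Yt rmorphN /= Yt Xt.
have l00 : lift ord0 ord0 = ord_max :> 'I_2 by apply: val_inj.
have GZE k a i j : G (k *: a) i j = k *: G a i j.
  rewrite GZ sE mxE (bigD1 i) //= big1 ?addr0; last first.
    by move=> l li; rewrite mxE eq_sym (negPf li) mul0r.
  by rewrite mxE eqxx mulr1n mulr_algl.
have GM a b i j : G (a * b) i j = G a i ord0 * G b ord0 j + G a i ord_max * G b ord_max j.
  by rewrite rmorphM mxE !big_ord_recl big_ord0 addr0 l00.
(* The second row is the image of the first under [X2] with the columns exchanged, and [Y] fixes
   entry (0,0) and negates entry (0,1). These two entries are the Y-even and Y-odd parts of Z a, so
   the product of matrices encodes the twist. *)
have circ a : [/\ G a ord_max ord_max = X2 (G a ord0 ord0),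
    G a ord_max ord0 = X2 (G a ord0 ord_max),
    Y (G a ord0 ord0) = G a ord0 ord0
  & Y (G a ord0 ord_max) = - G a ord0 ord_max].
  elim/(quadric_Ore_ind hA) : a => [|| a b Ha Hb | k a Ha | a b Ha Hb |||].
  - by rewrite !raddf0 !mxE /= !raddf0.
  - by rewrite rmorph1 !mxE /= !rmorph1 !raddf0.
  - have [a1 a2 a3 a4] := Ha; have [b1 b2 b3 b4] := Hb.
    rewrite !rmorphD !mxE a1 a2 b1 b2.
    by split; rewrite [RHS]rmorphD || rewrite rmorphD /= ?a3 ?a4 ?b3 ?b4 // opprD.
  - have [a1 a2 a3 a4] := Ha.
    by rewrite !GZE; split; rewrite ?XZ ?YZ ?a1 ?a2 ?a3 ?a4 ?scalerN.
  - have [a1 a2 a3 a4] := Ha; have [b1 b2 b3 b4] := Hb.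
    rewrite !GM a1 a2 b1 b2; split; rewrite rmorphD !rmorphM /= ?XX ?a3 ?a4 ?b3 ?b4.
    + by rewrite addrC.
    + by rewrite addrC.
    + by rewrite YX b4 rmorphN mulrNN.
    + by rewrite YX b3 opprD mulrN mulNr.
  - by rewrite Gu !mxE /= Xv Yv !raddf0.
  - rewrite Gv !mxE /= XZ Xu !YZ Yu !raddf0 scalerA; split=> //.
    by rewrite scalerN.
  - rewrite Gt !mxE /= XZ Xt !YZ Yt !raddf0; split=> //.
    by rewrite scaleNr scalerN.
have [Z ZE] : exists Z : {linear A -> A}, forall a, Z a = G a ord0 ord0 + G a ord0 ord_max.
  apply: linear_ex => k a b.
  by rewrite rmorphD !mxE !GZE scalerDr addrACA.
exists Z; rewrite !ZE Gu Gv Gt rmorph1 !mxE /= !add0r !addr0; split=> // a b.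
have [a1 a2 a3 a4] := circ a; have [b1 b2 b3 b4] := circ b.
rewrite !ZE !GM !rmorphD /= a3 a4 b1 b2.
move: (G a ord0 ord0) (G a ord0 ord_max) (G b ord0 ord0) (G b ord0 ord_max).
by move=> g0 g1 h0 h1; nc_prep K A; repeat split; field.
Qed.

End Operators.

(** * Actions of the Kashina algebras *)

Lemma cg_compD (K : fieldType) (A : cgAlg K) n (a b : A) : cg_comp n a -> cg_comp n b -> cg_comp n (a + b).
Proof.
have [c0 cB _ _] := cg_graded A.
by move=> ca cb; rewrite -[b]opprK; apply: (cB) => //; rewrite -sub0r; apply: (cB).
Qed.

(** * Sums over coproducts *)

Section SweedlerSums.
Variable K : fieldType.

Definition bilinear_map (V W : vectType K) (U : lmodType K) (F : V -> W -> U) :=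
  (forall w, linear (fun v => F v w)) /\ (forall v, linear (F v)).

Section Tlift.
Variables (V W : vectType K) (U : lmodType K).
Implicit Type F : V -> W -> U.

Lemma tlift_linear F : linear (tlift F).
Proof.
move=> k M N; rewrite /tlift scaler_sumr -big_split; apply: eq_bigr => i _ /=.
rewrite scaler_sumr -big_split; apply: eq_bigr => j _ /=.
by rewrite !mxE scalerDl scalerA.
Qed.

Lemma tliftD F M N : tlift F (M + N) = tlift F M + tlift F N.
Proof. by have := tlift_linear F 1 M N; rewrite !scale1r. Qed.

Lemma tliftZ F k M : tlift F (k *: M) = k *: tlift F M.
Proof.
have t0 : tlift F 0 = 0 by apply: (addrI (tlift F 0)); rewrite -tliftD !addr0.
by have := tlift_linear F k M 0; rewrite t0 !addr0.
Qed.

Lemma tliftB F M N : tlift F (M - N) = tlift F M - tlift F N.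
Proof. by rewrite -(scaleN1r N) tliftD tliftZ scaleN1r. Qed.

Lemma tlift_sum F (I : Type) (r : seq I) (M : I -> 'M[K]_(_, _)) :
  tlift F (\sum_(i <- r) M i) = \sum_(i <- r) tlift F (M i).
Proof.
apply: (big_morph (tlift F)) => [M1 M2|]; first exact: tliftD.
by apply: (addrI (tlift F 0)); rewrite -tliftD !addr0.
Qed.

Lemma tlift_tens F v w : bilinear_map F -> tlift F (tens v w) = F v w.
Proof.
move=> [Fl Fr].
have FlD k a b c : F (k *: a + b) c = k *: F a c + F b c by apply: Fl.
have FrD k a b c : F a (k *: b + c) = k *: F a b + F a c by apply: Fr.
have Fl0 c : F 0 c = 0.
  by apply: (addrI (F 0 c)); rewrite -[X in X + _]scale1r -FlD scale1r !addr0.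
have Fr0 c : F c 0 = 0.
  by apply: (addrI (F c 0)); rewrite -[X in X + _]scale1r -FrD scale1r !addr0.
have Fls (I : Type) (r : seq I) (k : I -> K) (g : I -> V) c :
    F (\sum_(i <- r) k i *: g i) c = \sum_(i <- r) k i *: F (g i) c.
  by elim: r => [|i r IH]; rewrite ?big_nil ?Fl0 // !big_cons FlD IH.
have Frs (I : Type) (r : seq I) (k : I -> K) (g : I -> W) c :
    F c (\sum_(i <- r) k i *: g i) = \sum_(i <- r) k i *: F c (g i).
  by elim: r => [|i r IH]; rewrite ?big_nil ?Fr0 // !big_cons FrD IH.
rewrite [in RHS](coord_vbasis (memvf v)) [in RHS](coord_vbasis (memvf w)) Fls.
apply: eq_bigr => i _; rewrite Frs scaler_sumr; apply: eq_bigr => j _.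
by rewrite mxE scalerA.
Qed.

Lemma eq_tlift F G M : (forall v w, F v w = G v w) -> tlift F M = tlift G M.
Proof. by move=> FG; apply: eq_bigr => i _; apply: eq_bigr => j _; rewrite FG. Qed.

End Tlift.

Lemma tlift_comp (V W V' W' : vectType K) (U : lmodType K) (F : V' -> W' -> U)
    (G : V -> W -> 'M[K]_(\dim {:V'}, \dim {:W'})) M :
  tlift F (tlift G M) = tlift (fun v w => tlift F (G v w)) M.
Proof.

rewrite [X in tlift F X]/tlift tlift_sum; apply: eq_bigr => i _.
by rewrite tlift_sum; apply: eq_bigr => j _; rewrite tliftZ.
Qed.

Lemma tlift_tmul (B : falgType K) (U : lmodType K) (F : B -> B -> U) M N :
  bilinear_map F ->
  tlift F (tmul M N) = tlift (fun a b => tlift (fun c d => F (a * c) (b * d)) N) M.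
Proof.
move=> bF; rewrite /tmul tlift_comp; apply: eq_tlift => a b.
by rewrite tlift_comp; apply: eq_tlift => c d; apply: tlift_tens.
Qed.

Lemma exchange_tlift (V W V' W' : vectType K) (U : lmodType K)
    (F : V -> W -> V' -> W' -> U) M N :
  tlift (fun a b => tlift (F a b) N) M =
  tlift (fun c d => tlift (fun a b => F a b c d) M) N.
Proof.
transitivity (\sum_i \sum_j \sum_k \sum_l M i j *: (N k l *:
   F (vbasis {:V})`_i (vbasis {:W})`_j (vbasis {:V'})`_k (vbasis {:W'})`_l)).
  apply: eq_bigr => i _; apply: eq_bigr => j _; rewrite scaler_sumr.
  by apply: eq_bigr => k _; rewrite scaler_sumr.
transitivity (\sum_k \sum_l \sum_i \sum_j M i j *: (N k l *:
   F (vbasis {:V})`_i (vbasis {:W})`_j (vbasis {:V'})`_k (vbasis {:W'})`_l)).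
  under eq_bigr => i _ do rewrite exchange_big.
  rewrite exchange_big; apply: eq_bigr => k _.
  under eq_bigr => i _ do rewrite exchange_big.
  by rewrite exchange_big.
apply: eq_bigr => k _; apply: eq_bigr => l _; rewrite scaler_sumr.
apply: eq_bigr => i _; rewrite scaler_sumr; apply: eq_bigr => j _.
by rewrite !scalerA mulrC.
Qed.

End SweedlerSums.

(** * The monomial basis of H *)

Section KashinaBasis.
Variables (R : realType) (k : kashina) (H : hopfAlg R[i]) (x y z : H).
Hypothesis hH : is_kashina k x y z.

Definition kmon (i j l : nat) : H := x ^+ i * y ^+ j * z ^+ l.

(** With this exponent, z^2 = y^is9 holds for both algebras. *)
Definition is9 : nat := if k is Kashina9 then 1 else 0.

Let xy : x * y = y * x. Proof. by case: hH. Qed.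
Let x4 : x ^+ 4 = 1. Proof. by case: hH. Qed.
Let y2 : y ^+ 2 = 1. Proof. by case: hH. Qed.
Let zx : z * x = x * y * z. Proof. by case: hH. Qed.
Let zy : z * y = y * z. Proof. by case: hH. Qed.
Let z2 : z ^+ 2 = y ^+ is9. Proof. by rewrite (kashina_z2 hH) /is9; case: (k); rewrite ?expr0 ?expr1. Qed.

Lemma kmon_red i j l :
  kmon i j l = kmon (i %% 4) ((j + is9 * (l %/ 2)) %% 2) (l %% 2).
Proof.
have expm (g : H) n m : g ^+ n = 1 -> g ^+ m = g ^+ (m %% n).
  by move=> gn; rewrite {1}(divn_eq m n) exprD mulnC exprM gn expr1n mul1r.
rewrite /kmon -(expm _ _ _ x4) -(expm _ _ _ y2).
rewrite {1}(divn_eq l 2) [z ^+ (_ + _)]exprD mulnC exprM z2 -exprM !mulrA.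
by rewrite [y ^+ (j + _)]exprD !mulrA.
Qed.

Lemma kmon_x i j l : x * kmon i j l = kmon i.+1 j l.
Proof. by rewrite /kmon exprS !mulrA. Qed.

Lemma kmon_y i j l : y * kmon i j l = kmon i j.+1 l.
Proof.
have yx : GRing.comm y (x ^+ i) by apply: commrX; rewrite /GRing.comm xy.
by rewrite /kmon [y ^+ j.+1]exprS !mulrA yx.
Qed.

Lemma kmon_z i j l : z * kmon i j l = kmon i (i + j) l.+1.
Proof.
have zyj n : z * y ^+ n = y ^+ n * z by apply: commrX; rewrite /GRing.comm zy.
have zxi n : z * x ^+ n = x ^+ n * y ^+ n * z.
  elim: n => [|n IH]; first by rewrite !expr0 !mulr1 mul1r.
  have yx : GRing.comm x (y ^+ n) by apply: commrX; rewrite /GRing.comm xy.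
  rewrite [x ^+ n.+1]exprSr mulrA IH -mulrA zx [y ^+ n.+1]exprSr !mulrA.
  by congr (_ * _ * _); rewrite -!mulrA yx.
by rewrite /kmon !mulrA zxi -!mulrA [z * (_ * _)]mulrA zyj exprD exprS !mulrA.
Qed.

Definition kidx (n : nat) : H := kmon (n %% 4) ((n %/ 4) %% 2) (n %/ 8).

Definition kbasis : 16.-tuple H := [tuple kidx n | n < 16].

Lemma kmon_in i j l : kmon i j l \in <<kbasis>>%VS.
Proof.
rewrite kmon_red; set i' := (i %% 4)%N; set j' := (_ %% 2)%N; set l' := (l %% 2)%N.
have hi : (i' < 4)%N by rewrite ltn_mod.
have hj : (j' < 2)%N by rewrite ltn_mod.
have hl : (l' < 2)%N by rewrite ltn_mod.
have hn : (i' + 4 * j' + 8 * l' < 16)%N.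
  by move: i' j' l' hi hj hl => [|[|[|[|]]]] // [|[|]] // [|[|]].
have -> : kmon i' j' l' = kidx (i' + 4 * j' + 8 * l').
  by move: i' j' l' hi hj hl {hn} => [|[|[|[|]]]] // [|[|]] // [|[|]].
apply: memv_span; apply/tnthP; exists (Ordinal hn).
by rewrite tnth_mktuple.
Qed.

(** The span of the sixteen monomials contains 1 and is stable under left multiplication by the
    generators, so it is all of H; freeness comes from the dimension 16. *)
Lemma kbasisP : basis_of {:H}%VS kbasis.
Proof.
rewrite basisEdim size_tuple (kashina_dim hH) leqnn andbT.
rewrite -(kashina_gen hH); apply: agenv_sub_modl.
  by apply/subvP => h /vlineP [c ->]; rewrite memvZ // (_ : 1 = kmon 0 0 0) ?kmon_in // /kmon !expr0 !mulr1.
apply/prodvP => g h.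
rewrite -[[:: x; y; z]]/(tval [tuple x; y; z]) => /coord_span -> /coord_span ->.
rewrite mulr_suml memv_suml // => a _; rewrite mulr_sumr memv_suml // => b _.
rewrite -scalerAl -scalerAr !memvZ // nth_mktuple.
by case: a => [[|[|[]]]] //= _; rewrite /kidx (kmon_x, kmon_y, kmon_z) kmon_in.
Qed.

Lemma kashina_lin_ind (S : H -> Prop) :
  S 0 -> (forall a b, S a -> S b -> S (a + b)) -> (forall c a, S a -> S (c *: a)) ->
  (forall i j l, S (kmon i j l)) -> forall h, S h.
Proof.
move=> S0 SD SZ Sm h; rewrite (coord_basis kbasisP (memvf h)).
elim/big_ind: _ => // n _; apply: (SZ); rewrite nth_mktuple; exact: (Sm).
Qed.

Lemma kashina_ind (S : H -> Prop) :
  S 0 -> S 1 -> (forall a b, S a -> S b -> S (a + b)) ->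
  (forall c a, S a -> S (c *: a)) -> (forall a b, S a -> S b -> S (a * b)) ->
  S x -> S y -> S z -> forall h, S h.
Proof.
move=> S0 S1 SD SZ SM Sx Sy Sz; apply: kashina_lin_ind => // i j l.
have SX g n : S g -> S (g ^+ n).
  by move=> Sg; elim: n => [|n IH]; rewrite ?expr0 // exprS; apply: (SM).
by apply: (SM); [apply: (SM) |]; apply: (SX).
Qed.

Lemma tlift_comul_x (U : lmodType R[i]) (F : H -> H -> U) :
  bilinear_map F -> tlift F (comul H x) = F x x.
Proof. by move=> bF; have [-> _] := kashina_grouplike_x hH; apply: tlift_tens. Qed.

Lemma tlift_comul_y (U : lmodType R[i]) (F : H -> H -> U) :
  bilinear_map F -> tlift F (comul H y) = F y y.
Proof. by move=> bF; have [-> _] := kashina_grouplike_y hH; apply: tlift_tens. Qed.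

Lemma tlift_comul_z (U : lmodType R[i]) (F : H -> H -> U) : bilinear_map F ->
  tlift F (comul H z) = 2^-1 *: (F z z + F (y * z) z + F z (x ^+ 2 * z)
                                 - F (y * z) (x ^+ 2 * z)).
Proof.
move=> bF; rewrite (kashina_comul_z hH) tlift_tmul //.
have bF' a b : bilinear_map (fun c d => F (a * c) (b * d)).
  have [Fl Fr] := bF; split=> w c v1 v2; rewrite mulrDr -scalerAr.
    exact: Fl.
  exact: Fr.
under eq_tlift => a b do rewrite tlift_tens //.
have bG : bilinear_map (fun a b => F (a * z) (b * z)).
  have [Fl Fr] := bF; split=> w c v1 v2; rewrite mulrDl -scalerAl.
    exact: Fl.
  exact: Fr.
by rewrite tliftZ tliftB !tliftD !tlift_tens // !mul1r.
Qed.

End KashinaBasis.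

(** * From operators X, Y, Z with the right relations to an action of H *)

Section KashinaAction.
Variables (R : realType) (k : kashina) (H : hopfAlg R[i]) (x y z : H).
Hypothesis hH : is_kashina k x y z.
Variables (A : cgAlg R[i]) (X Y : {lrmorphism A -> A}) (Z : {linear A -> A}).
Hypotheses (X4 : forall a, iter 4 X a = a) (Y2 : forall a, Y (Y a) = a)
  (XY : forall a, X (Y a) = Y (X a)) (ZX : forall a, Z (X a) = X (Y (Z a)))
  (ZY : forall a, Z (Y a) = Y (Z a))
  (Z2 : forall a, Z (Z a) = if k is Kashina8 then a else Y a).
Hypotheses (Z1 : Z 1 = 1)
  (ZM : forall a b, Z (a * b) = 2^-1 *: (Z a * Z b + Y (Z a) * Z b
     + Z a * X (X (Z b)) - Y (Z a) * X (X (Z b)))).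
Hypotheses (grX : forall n a, cg_comp n a -> cg_comp n (X a))
  (grY : forall n a, cg_comp n a -> cg_comp n (Y a))
  (grZ : forall n a, cg_comp n a -> cg_comp n (Z a)).

Definition kop (i j l : nat) (a : A) : A := iter i X (iter j Y (iter l Z a)).

Let iter_mod (f : A -> A) n m a : (forall b, iter n f b = b) ->
  iter m f a = iter (m %% n) f a.
Proof.
move=> fn; rewrite {1}(divn_eq m n) addnC iterD; congr (iter _ f _).
elim: (m %/ n)%N => [|d IH] //; by rewrite mulSn iterD IH.
Qed.

Lemma kop_red i j l a :
  kop i j l a = kop (i %% 4) ((j + is9 k * (l %/ 2)) %% 2) (l %% 2) a.
Proof.
rewrite /kop (iter_mod i _ X4); congr (iter _ X _).
rewrite -(@iter_mod Y 2) // iterD; congr (iter _ Y _).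
have Z2i b : iter 2 Z b = iter (is9 k) Y b by rewrite /= Z2 /is9; case: (k).
rewrite {1}(divn_eq l 2); elim: (l %/ 2)%N => [|d IH]; first by rewrite muln0.
by rewrite mulSn -addnA iterD IH mulnS iterD Z2i.
Qed.

Lemma kop_lin i j l : linear (kop i j l).
Proof.
have il (f : {linear A -> A}) n c a b :
    iter n f (c *: a + b) = c *: iter n f a + iter n f b.
  by elim: n => //= n ->; rewrite linearP.
by move=> c a b; rewrite /kop (il Z) (il Y) (il X).
Qed.

Definition kact (h : H) (a : A) : A :=
  \sum_(n < 16) coord (kbasis x y z) n h *: kop (n %% 4) ((n %/ 4) %% 2) (n %/ 8) a.

Lemma kact_linl a : linear (kact^~ a).
Proof.
move=> c g h; rewrite /kact scaler_sumr -big_split; apply: eq_bigr => n _ /=.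
by rewrite linearP /= scalerDl scalerA.
Qed.

Lemma kact_linr h : linear (kact h).
Proof.
move=> c a b; rewrite /kact scaler_sumr -big_split; apply: eq_bigr => n _ /=.
by rewrite kop_lin scalerDr !scalerA mulrC.
Qed.

Let kactD g h a : kact (g + h) a = kact g a + kact h a.
Proof. by have := kact_linl a 1 g h; rewrite !scale1r. Qed.

Let kact0 a : kact 0 a = 0.
Proof. by apply: (addrI (kact 0 a)); rewrite -kactD !addr0. Qed.

Let kactZ c g a : kact (c *: g) a = c *: kact g a.
Proof. by have := kact_linl a c g 0; rewrite kact0 !addr0. Qed.

Let kactDr g a b : kact g (a + b) = kact g a + kact g b.
Proof. by have := kact_linr g 1 a b; rewrite !scale1r. Qed.

Let kact0r g : kact g 0 = 0.
Proof. by apply: (addrI (kact g 0)); rewrite -kactDr !addr0. Qed.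

Let kactZr c g a : kact g (c *: a) = c *: kact g a.
Proof. by have := kact_linr g c a 0; rewrite kact0r !addr0. Qed.

Lemma kact_kmon i j l a : kact (kmon x y z i j l) a = kop i j l a.
Proof.
rewrite (kmon_red hH) kop_red.
set i' := (i %% 4)%N; set j' := (_ %% 2)%N; set l' := (l %% 2)%N.
have hi : (i' < 4)%N by rewrite ltn_mod.
have hj : (j' < 2)%N by rewrite ltn_mod.
have hl : (l' < 2)%N by rewrite ltn_mod.
have hn : (i' + 4 * j' + 8 * l' < 16)%N.
  by move: i' j' l' hi hj hl => [|[|[|[|]]]] // [|[|]] // [|[|]].
pose n := Ordinal hn.
have [e1 e2 e3] : [/\ (n %% 4 = i')%N, ((n %/ 4) %% 2 = j')%N & (n %/ 8 = l')%N].
  rewrite /n /=; move: i' j' l' hi hj hl {hn n}.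
  by move=> [|[|[|[|]]]] // [|[|]] // [|[|]].
have -> : kmon x y z i' j' l' = (kbasis x y z)`_n.
  by rewrite nth_mktuple /kidx e1 e2 e3.
have fr := basis_free (kbasisP hH).
rewrite /kact (bigD1 n) // (coord_free n n fr) eqxx scale1r.
rewrite e1 e2 e3 big1 => [|m mn]; first exact: addr0.
by rewrite (coord_free n m fr) eq_sym (negPf mn) scale0r.
Qed.

Lemma kact_x a : kact x a = X a.
Proof. by have := kact_kmon 1 0 0 a; rewrite /kmon !expr0 !mulr1 expr1. Qed.

Lemma kact_y a : kact y a = Y a.
Proof. by have := kact_kmon 0 1 0 a; rewrite /kmon !expr0 mul1r mulr1 expr1. Qed.

Lemma kact_z a : kact z a = Z a.
Proof. by have := kact_kmon 0 0 1 a; rewrite /kmon !expr0 !mul1r expr1. Qed.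

Lemma kact_1 a : kact 1 a = a.
Proof. by have := kact_kmon 0 0 0 a; rewrite /kmon !expr0 !mul1r. Qed.

(** Linearity reduces the left factor to a generator and the right one to a monomial; there the
    rewriting rules of [kmon] match the commutation rules of X, Y and Z. *)
Lemma kact_comp g h a : kact (g * h) a = kact g (kact h a).
Proof.
elim/(kashina_ind hH): g h a => [h a|h a|g g' IH IH' h a|c g IH h a|g g' IH IH' h a|h|h|h].
- by rewrite mul0r !kact0.
- by rewrite mul1r kact_1.
- by rewrite mulrDl !kactD IH IH'.
- by rewrite -scalerAl !kactZ IH.
- by rewrite -mulrA !IH IH'.
- elim/(kashina_lin_ind hH): h => [a|g h IH IH' a|c h IH a|i j l a].
  + by rewrite mulr0 !kact0 kact0r.
  + by rewrite mulrDr !kactD IH IH' kactDr.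
  + by rewrite -scalerAr !kactZ IH kactZr.
  + by rewrite kmon_x !kact_kmon kact_x.
- elim/(kashina_lin_ind hH): h => [a|g h IH IH' a|c h IH a|i j l a].
  + by rewrite mulr0 !kact0 kact0r.
  + by rewrite mulrDr !kactD IH IH' kactDr.
  + by rewrite -scalerAr !kactZ IH kactZr.
  + rewrite (kmon_y hH) !kact_kmon kact_y /kop.
    by elim: i => [|i IH] //=; rewrite -XY -IH.
- elim/(kashina_lin_ind hH): h => [a|g h IH IH' a|c h IH a|i j l a].
  + by rewrite mulr0 !kact0 kact0r.
  + by rewrite mulrDr !kactD IH IH' kactDr.
  + by rewrite -scalerAr !kactZ IH kactZr.
  + rewrite (kmon_z hH) !kact_kmon kact_z /kop.
    have ZYi n b : Z (iter n Y b) = iter n Y (Z b).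
      by elim: n => [|n IH] //=; rewrite ZY IH.
    have YXi n b : Y (iter n X b) = iter n X (Y b).
      by elim: n => [|n IH] //=; rewrite -XY IH.
    have ZXi n b : Z (iter n X b) = iter n X (iter n Y (Z b)).
      elim: n b => [|n IH] b //=; rewrite ZX IH YXi; congr (X (iter _ _ _)).
    by rewrite ZXi ZYi -iterD.
Qed.

Let kact_bilinear a b : bilinear_map (fun g h => kact g a * kact h b).
Proof.
split=> h c g1 g2; rewrite kactD kactZ.
  by rewrite mulrDl -scalerAl.
by rewrite mulrDr -scalerAr.
Qed.

(** Since the coproduct is multiplicative, the elements h with this property form a subalgebra, and
    only x, y, z remain to be checked. *)
Lemma kact_mul h a b :
  kact h (a * b) = tlift (fun h1 h2 => kact h1 a * kact h2 b) (comul H h).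
Proof.
elim/(kashina_ind hH): h a b => [a b|a b|g h IH IH' a b|c h IH a b|g h IH IH' a b|a b|a b|a b].
- by rewrite kact0 raddf0 -(scale0r (0 : 'M_(_, _))) tliftZ scale0r.
- by rewrite comul_unit tlift_tens // !kact_1.
- by rewrite kactD raddfD tliftD IH IH'.
- by rewrite kactZ linearZ tliftZ IH.
- rewrite kact_comp comul_mul tlift_tmul // IH'.
  rewrite -(exchange_tlift (fun c d a1 b1 => kact (a1 * c) a * kact (b1 * d) b)).
  have kl : exists f : {linear A -> A}, forall a, f a = kact g a.
    by apply: linear_ex; apply: kact_linr.
  have [f fE] := kl.
  rewrite -fE /tlift raddf_sum; apply: eq_bigr => i _.
  rewrite raddf_sum; apply: eq_bigr => j _; rewrite /= fE kactZr IH; congr (_ *: _).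
  by apply: eq_bigr => i1 _; apply: eq_bigr => j1 _; rewrite !kact_comp.
- by rewrite (tlift_comul_x hH) // !kact_x rmorphM.
- by rewrite (tlift_comul_y hH) // !kact_y rmorphM.
- by rewrite (tlift_comul_z hH) // !kact_comp !kact_y !kact_x !kact_z ZM.
Qed.

Lemma kact_unit h : kact h 1 = counit H h *: 1.
Proof.
elim/(kashina_ind hH): h => [||g h IH IH'|c h IH|g h IH IH'|||].
- by rewrite kact0 raddf0 scale0r.
- by rewrite kact_1 counit_unit scale1r.
- by rewrite kactD raddfD scalerDl IH IH'.
- by rewrite kactZ linearZ /= IH scalerA.
- by rewrite kact_comp IH' kactZr IH scalerA counit_mul mulrC.
- by rewrite kact_x rmorph1; have [_ ->] := kashina_grouplike_x hH; rewrite scale1r.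
- by rewrite kact_y rmorph1; have [_ ->] := kashina_grouplike_y hH; rewrite scale1r.
- by rewrite kact_z Z1 (kashina_counit_z hH) scale1r.
Qed.

Lemma kact_graded h n a : cg_comp n a -> cg_comp n (kact h a).
Proof.
have [c0 _ _ _] := cg_graded A.
elim/(kashina_ind hH): h a => [a ca|a ca|g h IH IH' a ca|c h IH a ca|g h IH IH' a ca|a ca|a ca|a ca].
- by rewrite kact0.
- by rewrite kact_1.
- by rewrite kactD; apply: cg_compD; [apply: IH | apply: IH'].
- by rewrite kactZ; apply/cg_scale/IH.
- by rewrite kact_comp; apply/IH/IH'.
- by rewrite kact_x; apply: grX.
- by rewrite kact_y; apply: grY.
- by rewrite kact_z; apply: grZ.
Qed.

Lemma kashina_action_ex : exists rho : hopfAction H A,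
  forall a, [/\ rho x a = X a, rho y a = Y a & rho z a = Z a].
Proof.
exists (HopfAction kact_linl kact_linr kact_1 kact_comp kact_unit kact_mul kact_graded).
by move=> a /=; rewrite kact_x kact_y kact_z.
Qed.

End KashinaAction.

(** * The grading of A is the grading by word length *)

Section Homogeneous.
Variables (K : fieldType) (q : quadric) (alpha : K) (A : cgAlg K) (u v t : A).
Hypothesis hA : quadric_Ore q alpha u v t.

(** The grading [cg_comp] is abstract and only known to have u, v, t in degree 1. Identifying it
    with word length lets degree preservation be proved by induction from the generators. *)
Inductive homog : nat -> A -> Prop :=
| homog0 n : homog n 0
| homogD n a b of homog n a & homog n b : homog n (a + b)
| homogZ n k a of homog n a : homog n (k *: a)
| homogM m n a b of homog m a & homog n b : homog (m + n) (a * b)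
| homog1 : homog 0 1
| homog_u : homog 1 u
| homog_v : homog 1 v
| homog_t : homog 1 t.

Lemma homog_cg_comp n a : homog n a -> cg_comp n a.
Proof.
have [cu cv ct _] := hA; have [c0 _ _ _] := cg_graded A.
elim=> //.
- by move=> m b c _ cb _ cc; apply: cg_compD.
- by move=> m k b _ cb; apply: cg_scale.
- by move=> m l b c _ cb _ cc; apply: cg_mul.
- by apply/cg_conn; exists 1; rewrite scale1r.
Qed.

Lemma homog_sum n (I : Type) (r : seq I) (f : I -> A) :
  (forall i, homog n (f i)) -> homog n (\sum_(i <- r) f i).
Proof.
move=> hf; elim/big_ind: _ => //; first exact: homog0.
by move=> a b; apply: homogD.
Qed.

Lemma homog_decomp a : exists p : {poly A}, p.[1] = a /\ forall i, homog i p`_i.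
Proof.
have C1 b : homog 1 b -> exists p : {poly A}, p.[1] = b /\ forall i, homog i p`_i.
  move=> hb; exists (b%:P * 'X); rewrite hornerMX hornerC mulr1; split=> // i.
  by rewrite coefMX coefC; case: i => [|[|i]] //=; apply: homog0.
elim/(quadric_Ore_ind hA): a => [||a b [p [pa hp]] [r [rb hr]]
    |k a [p [pa hp]]|a b [p [pa hp]] [r [rb hr]]|||].
- by exists 0; rewrite horner0; split=> // i; rewrite coef0; apply: homog0.
- exists 1; rewrite hornerC; split=> // i; rewrite coef1.
  by case: i => [|i] /=; [apply: homog1 | apply: homog0].
- exists (p + r); rewrite hornerD pa rb; split=> // i; rewrite coefD.
  exact: homogD.
- exists ((k%:A)%:P * p); rewrite hornerCM pa mulr_algl; split=> // i.
  by rewrite coefCM mulr_algl; apply: homogZ.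
- exists (p * r); rewrite hornerM_comm ?pa ?rb; last by rewrite /comm_poly mulr1 mul1r.
  split=> // i; rewrite coefM; apply: homog_sum => j.
  have ji : (j <= i)%N by have := ltn_ord j.
  by rewrite -[X in homog X](subnKC ji); apply: homogM.
- exact/C1/homog_u.
- exact/C1/homog_v.
- exact/C1/homog_t.
Qed.

(** Uniqueness of homogeneous components: the expansion of [a] by word length must reduce to its
    part of degree n. *)
Lemma cg_comp_homog n a : cg_comp n a -> homog n a.
Proof.
move=> ca; have [p [pa hp]] := homog_decomp a; have [c0 cB _ cu] := cg_graded A.
(* The range also exceeds n, so that index n occurs in it even when the coefficient of degree n is
   0. *)
pose N := maxn (size p) n.+1.
have aE : a = \sum_(i <- iota 0 N) p`_i.
  rewrite -pa (@horner_coef_wide _ N) ?leq_maxl // -(big_mkord xpredT (fun i => p`_i * 1 ^+ i)).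
  by rewrite /index_iota subn0; apply: eq_bigr => i _; rewrite expr1n mulr1.
suff : p`_n - a = 0 by move/subr0_eq => <-.
have nN : n \in iota 0 N by rewrite mem_iota /= leq_max ltnSn orbT.
have := cu (iota 0 N) (fun i => p`_i - (if i == n then a else 0)) (iota_uniq _ _) _ _ n nN.
rewrite eqxx; apply.
  move=> i _; apply: (cB); first exact: homog_cg_comp.
  by case: eqP => [->|_] //; apply: c0.
rewrite sumrB -aE (bigD1_seq n) ?iota_uniq //= eqxx big1 ?addr0 ?subrr //.
by move=> i /negPf ->.
Qed.

End Homogeneous.

Lemma quadric_Ore_ext (K : fieldType) (q : quadric) (alpha : K) (A : cgAlg K) (u v t : A)
    (f g : {lrmorphism A -> A}) : quadric_Ore q alpha u v t ->
  f u = g u -> f v = g v -> f t = g t -> f =1 g.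
Proof.
move=> hA fu fv ft a.
elim/(quadric_Ore_ind hA): a => [||a b Ha Hb|n a Ha|a b Ha Hb|||] //.
- by rewrite !raddf0.
- by rewrite !rmorph1.
- by rewrite !rmorphD /= Ha Hb.
- have fZ : f (n *: a) = n *: f a by rewrite linearZ.
  by rewrite fZ Ha linearZ.
- by rewrite !rmorphM /= Ha Hb.
Qed.

(** * Existence of the actions *)

Section Existence.
Variables (R : realType) (k : kashina) (H : hopfAlg R[i]) (x y z : H).
Hypothesis hH : is_kashina k x y z.
Variables (p : rep2) (q : quadric) (alpha : R[i]).
Variables (sx sz : bool) (A : cgAlg R[i]) (u v t : A).
Hypothesis hA : quadric_Ore q alpha u v t.

Lemma complex_two : (2 : R[i]) != 0.
Proof. by rewrite pnatr_eq0. Qed.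

Lemma kashina_acts : exists rho : hopfAction H A, acts_as k p sx sz x y z u v t rho.
Proof.
pose c : R[i] := if p is Pi1 then 'i%C else 1.
(* The scalar by which x^2 acts on u and v. *)
pose s : R[i] := if p is Pi1 then -1 else 1.
pose kappa : R[i] := if k is Kashina8 then 1 else -1.
have cc : c * c = s by rewrite /c /s; case: p; rewrite ?mulr1 // -expr2 sqr_i.
have ss : s * s = 1 by rewrite /s; case: p; rewrite ?mulrNN mulr1.
have kk : kappa * kappa = 1 by rewrite /kappa; case: (k); rewrite ?mulrNN mulr1.
have ct : ((-1) ^+ sx * 'i%C) * ((-1) ^+ sx * 'i%C) = -1 :> R[i].
  by rewrite mulrACA -expr2 sqrr_sign mul1r -expr2 sqr_i.
have [|X [Xu Xv Xt]] := diagonal_morph hA (cu := c) (cv := - c) ((-1) ^+ sx * 'i%C).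
  by rewrite sqrrN.
have [|Y [Yu Yv Yt]] := diagonal_morph hA (cu := -1) (cv := -1) 1; first by [].
rewrite !scaleN1r in Yu Yv; rewrite scale1r in Yt.
have XE n a : X (n *: a) = n *: X a by rewrite linearZ.
have YE n a : Y (n *: a) = n *: Y a by rewrite linearZ.
have XXu : X (X u) = s *: u by rewrite Xu XE Xu scalerA cc.
have XXv : X (X v) = s *: v by rewrite Xv XE Xv scalerA mulrNN cc.
have XXt : X (X t) = - t by rewrite Xt XE Xt scalerA ct scaleN1r.
have [||||||||Z [[Zu Zv Zt] Z1 ZM]] :=
  @twisted_morph _ _ _ _ _ _ _ hA Y (X \o X : {lrmorphism A -> A}) s kappa ((-1) ^+ sz) complex_two; rewrite ?expr2 //.
have ZE n a : Z (n *: a) = n *: Z a by rewrite linearZ.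
have XY : forall a, X (Y a) = Y (X a).
  apply: (quadric_Ore_ext hA (f := X \o Y) (g := Y \o X)) => /=.
  - by rewrite Yu Xu YE Yu rmorphN /= Xu scalerN.
  - by rewrite Yv Xv YE Yv rmorphN /= Xv scalerN.
  - by rewrite Yt Xt YE Yt.
have Y2 : forall a, Y (Y a) = a.
  apply: (quadric_Ore_ext hA (f := Y \o Y) (g := idfun)) => /=.
  - by rewrite Yu rmorphN /= Yu opprK.
  - by rewrite Yv rmorphN /= Yv opprK.
  - by rewrite !Yt.
have X4 : forall a, iter 4 X a = a.
  apply: (quadric_Ore_ext hA (f := X \o X \o X \o X) (g := idfun)) => /=.
  - by rewrite XXu !XE XXu scalerA ss scale1r.
  - by rewrite XXv !XE XXv scalerA ss scale1r.
  - by rewrite XXt !rmorphN /= XXt opprK.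
have X4' a : X (X (X (X a))) = a by apply: (X4 a).
have ZMX a b : Z (a * b) = 2^-1 *: (Z a * Z b + Y (Z a) * Z b
     + Z a * X (X (Z b)) - Y (Z a) * X (X (Z b))) by rewrite ZM.
have ZX a : Z (X a) = X (Y (Z a)).
  elim/(quadric_Ore_ind hA): a => [||a b Ha Hb|n a Ha|a b Ha Hb|||].
  - by rewrite !raddf0.
  - by rewrite !(rmorph1, Z1).
  - by rewrite !raddfD /= Ha Hb.
  - by rewrite XE ZE ZE YE XE Ha.
  - rewrite rmorphM ZMX Ha Hb ZMX YE XE; congr (_ *: _).
    rewrite !(rmorphB, rmorphD, rmorphM) /=.
    by rewrite !XY !Y2.
  - by rewrite Xu ZE Zu Yv rmorphN /= Xv scaleNr opprK.
  - by rewrite Xv ZE Zv YE Yu XE rmorphN /= Xu scalerN !scalerA mulNr scaleNr mulrC.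
  - by rewrite Xt ZE Zt YE Yt XE Xt !scalerA mulrC.
have ZY a : Z (Y a) = Y (Z a).
  elim/(quadric_Ore_ind hA): a => [||a b Ha Hb|n a Ha|a b Ha Hb|||].
  - by rewrite !raddf0.
  - by rewrite !(rmorph1, Z1).
  - by rewrite !raddfD /= Ha Hb.
  - by rewrite YE ZE ZE YE Ha.
  - rewrite rmorphM ZMX Ha Hb ZMX YE; congr (_ *: _).
    rewrite !(rmorphB, rmorphD, rmorphM) /=.
    by rewrite !XY !Y2.
  - by rewrite Yu Zu Yv raddfN /= Zu.
  - by rewrite Yv Zv YE Yu raddfN /= Zv scalerN.
  - by rewrite Yt Zt YE Yt.
have Z2 a : Z (Z a) = if k is Kashina8 then a else Y a.
  elim/(quadric_Ore_ind hA): a => [||a b Ha Hb|n a Ha|a b Ha Hb|||].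
  - by rewrite !raddf0; case: (k).
  - by rewrite !Z1; case: (k); rewrite ?rmorph1.
  - by rewrite !raddfD /= Ha Hb; case: (k); rewrite ?rmorphD.
  - by rewrite !ZE Ha; case: (k); rewrite ?YE.
  - transitivity (Z (Z a) * Z (Z b)); last first.
      by rewrite Ha Hb; case: (k); rewrite ?rmorphM.
    (* The twist, half of 1 (x) 1 + y (x) 1 + 1 (x) x^2 - y (x) x^2, has square 1 because y^2 = x^4
       = 1; hence the square of Z is multiplicative. *)
    rewrite ZMX ZE raddfB !raddfD /= !ZMX !(ZX, ZY) !(XY, Y2).
    rewrite !X4'; move: (Z (Z a)) (Z (Z b)) => a2 b2; move: (Y a2) (X (X b2)) => ya xb.
    by have two := complex_two; nc_prep constr:(R[i]) A; repeat split; field.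
  - by rewrite Zu Zv /kappa; case: (k); rewrite ?scale1r // scaleN1r Yu.
  - by rewrite Zv ZE Zu /kappa; case: (k); rewrite ?scale1r // scaleN1r Yv.
  - by rewrite Zt ZE Zt scalerA -expr2 sqrr_sign scale1r Yt; case: (k).
have grM (L : {lrmorphism A -> A}) cu cv c3 :
    L u = cu *: u -> L v = cv *: v -> L t = c3 *: t ->
    forall n a, homog u v t n a -> homog u v t n (L a).
  move=> Lu Lv Lt n a; elim=> {n a} [n|n a b _ IH _ IH'|n e a _ IH|m n a b _ IH _ IH'||||].
  - by rewrite raddf0; apply: homog0.
  - by rewrite raddfD; apply: homogD.
  - by rewrite linearZ; apply: homogZ.
  - by rewrite rmorphM; apply: homogM.
  - by rewrite rmorph1; apply: homog1.
  - by rewrite Lu; apply/homogZ/homog_u.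
  - by rewrite Lv; apply/homogZ/homog_v.
  - by rewrite Lt; apply/homogZ/homog_t.
have hX := grM X _ _ _ Xu Xv Xt.
have hY : forall n a, homog u v t n a -> homog u v t n (Y a).
  by apply: (grM Y (-1) (-1) 1); rewrite ?scaleN1r ?scale1r.
have hZ n a : homog u v t n a -> homog u v t n (Z a).
  elim=> {n a} [n|n a b _ IH _ IH'|n e a _ IH|m n a b _ IH _ IH'||||].
  - by rewrite raddf0; apply: homog0.
  - by rewrite raddfD; apply: homogD.
  - by rewrite ZE; apply: homogZ.
  - rewrite ZMX -scaleN1r; apply: homogZ.
    by do ![apply: homogD | apply: homogZ | apply: homogM | apply: (hX) | apply: (hY)].
  - by rewrite Z1; apply: homog1.
  - by rewrite Zu; apply: homog_v.
  - by rewrite Zv; apply/homogZ/homog_u.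
  - by rewrite Zt; apply/homogZ/homog_t.
have [|||rho rhoE] := kashina_action_ex hH X4 Y2 XY ZX ZY Z2 Z1 ZMX.
- by move=> n a /(cg_comp_homog hA)/hX/(homog_cg_comp hA).
- by move=> n a /(cg_comp_homog hA)/hY/(homog_cg_comp hA).
- by move=> n a /(cg_comp_homog hA)/hZ/(homog_cg_comp hA).
exists rho; rewrite /acts_as.
have [rxu ryu rzu] := rhoE u; have [rxv ryv rzv] := rhoE v; have [rxt ryt rzt] := rhoE t.
rewrite rxu ryu rzu rxv ryv rzv rxt ryt rzt; split; split=> //.
by rewrite Zv /kappa; case: (k); rewrite ?scale1r ?scaleN1r.
Qed.

End Existence.

(** * Invariants *)

Section Action.
Variables (R : realType) (k : kashina) (H : hopfAlg R[i]) (x y z : H).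
Hypothesis hH : is_kashina k x y z.
Variables (A : cgAlg R[i]) (rho : hopfAction H A).

Lemma actDl g h a : rho (g + h) a = rho g a + rho h a.
Proof. by have := act_linear_l rho a 1 g h; rewrite !scale1r. Qed.

Lemma act0l a : rho 0 a = 0.
Proof. by apply: (addrI (rho 0 a)); rewrite -actDl !addr0. Qed.

Lemma actZl c h a : rho (c *: h) a = c *: rho h a.
Proof. by have := act_linear_l rho a c h 0; rewrite act0l !addr0. Qed.

Lemma actB h a b : rho h (a - b) = rho h a - rho h b.
Proof. by rewrite -(scaleN1r b) act_add act_scale scaleN1r. Qed.

Lemma actN h a : rho h (- a) = - rho h a.
Proof. by rewrite -(scaleN1r a) act_scale scaleN1r. Qed.

Let bil a b : bilinear_map (fun g h => rho g a * rho h b).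
Proof.
split=> h c g1 g2; rewrite actDl actZl.
  by rewrite mulrDl -scalerAl.
by rewrite mulrDr -scalerAr.
Qed.

Lemma act_xM a b : rho x (a * b) = rho x a * rho x b.
Proof. by rewrite act_mul (tlift_comul_x hH). Qed.

Lemma act_yM a b : rho y (a * b) = rho y a * rho y b.
Proof. by rewrite act_mul (tlift_comul_y hH). Qed.

Lemma act_zM a b : rho z (a * b) = 2^-1 *: (rho z a * rho z b
  + rho y (rho z a) * rho z b + rho z a * rho x (rho x (rho z b))
  - rho y (rho z a) * rho x (rho x (rho z b))).
Proof. by rewrite act_mul (tlift_comul_z hH) // expr2 !act_comp. Qed.

Lemma act_x1 : rho x 1 = 1.
Proof. by rewrite act_unit; have [_ ->] := kashina_grouplike_x hH; rewrite scale1r. Qed.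

Lemma act_y1 : rho y 1 = 1.
Proof. by rewrite act_unit; have [_ ->] := kashina_grouplike_y hH; rewrite scale1r. Qed.

Lemma act_z1 : rho z 1 = 1.
Proof. by rewrite act_unit (kashina_counit_z hH) scale1r. Qed.

Lemma act_xX a n : rho x (a ^+ n) = rho x a ^+ n.
Proof. by elim: n => [|n IH]; rewrite ?expr0 ?act_x1 // !exprS act_xM IH. Qed.

Lemma act_yX a n : rho y (a ^+ n) = rho y a ^+ n.
Proof. by elim: n => [|n IH]; rewrite ?expr0 ?act_y1 // !exprS act_yM IH. Qed.

Lemma act_zy a : rho z (rho y a) = rho y (rho z a).
Proof. by rewrite -!act_comp (kashina_zy hH). Qed.

(** The twist in the coproduct of z is trivial when y fixes the first factor; when y negates it, the
    twist is x^2 on the second factor, which is [act_z_odd]. *)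
Lemma act_z_even a b : rho y a = a -> rho z (a * b) = rho z a * rho z b.
Proof.
move=> ya; rewrite act_zM -act_zy ya.
have two := @complex_two R.
move: (rho z a) (rho z b) (rho x _) => c d e.
by nc_prep constr:(R[i]) A; repeat split; field.
Qed.

Lemma act_z_evenX a n : rho y a = a -> rho z (a ^+ n) = rho z a ^+ n.
Proof.
by move=> ya; elim: n => [|n IH]; rewrite ?expr0 ?act_z1 // !exprS act_z_even ?IH.
Qed.

Lemma act_invariantP a : act_invariant rho a <->
  [/\ rho x a = a, rho y a = a & rho z a = a].
Proof.
split=> [inv|[xa ya za] h].
  have [_ ex] := kashina_grouplike_x hH; have [_ ey] := kashina_grouplike_y hH.
  by rewrite !inv ex ey (kashina_counit_z hH) !scale1r.
elim/(kashina_ind hH): h => [||g h IH IH'|c h IH|g h IH IH'|||].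
- by rewrite act0l raddf0 scale0r.
- by rewrite act_one counit_unit scale1r.
- by rewrite actDl raddfD scalerDl IH IH'.
- by rewrite actZl linearZ /= IH scalerA.
- by rewrite act_comp IH' act_scale IH scalerA counit_mul mulrC.
- by have [_ ->] := kashina_grouplike_x hH; rewrite scale1r.
- by have [_ ->] := kashina_grouplike_y hH; rewrite scale1r.
- by rewrite (kashina_counit_z hH) scale1r.
Qed.

Lemma act_invariantD a b :
  act_invariant rho a -> act_invariant rho b -> act_invariant rho (a + b).
Proof. by move=> ia ib h; rewrite act_add ia ib scalerDr. Qed.

Lemma act_invariantZ c a : act_invariant rho a -> act_invariant rho (c *: a).
Proof. by move=> ia h; rewrite act_scale ia !scalerA mulrC. Qed.

Lemma act_invariantM a b :
  act_invariant rho a -> act_invariant rho b -> act_invariant rho (a * b).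
Proof.
move=> /asboolP ia /asboolP ib; apply/asboolP.
by have [_ _ _ clM] := invariant_subsemialg rho; apply: clM.
Qed.

Lemma subalg_gen_invariant (s : seq A) :
  (forall a, a \in s -> act_invariant rho a) ->
  forall a, subalg_gen s a -> act_invariant rho a.
Proof.
move=> hs a; elim=> {a} [a|c|a b _ ia _ ib|a b _ ia _ ib].
- exact: hs.
- by move=> h; rewrite act_scale act_unit !scalerA mulrC.
- exact: act_invariantD.
- exact: act_invariantM.
Qed.

(** The action of the normalized sum of the sixteen monomials x^i y^j z^l, which is an integral of
    H. *)
Definition average (a : A) : A :=
  let b := a + rho z a in let c := b + rho y b in
  16^-1 *: (c + rho x c + rho x (rho x c) + rho x (rho x (rho x c))).

Lemma averageD a b : average (a + b) = average a + average b.
Proof.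
rewrite /average !act_add -scalerDr; congr (_ *: _).
by nc_ring constr:(R[i]) A.
Qed.

Lemma averageZ c a : average (c *: a) = c *: average a.
Proof.
rewrite /average !(act_scale, act_add).
by nc_ring constr:(R[i]) A.
Qed.

Let y2 a : rho y (rho y a) = a.
Proof. by rewrite -act_comp -expr2 (kashina_y2 hH) act_one. Qed.

Let x4 a : rho x (rho x (rho x (rho x a))) = a.
Proof.
transitivity (rho (x ^+ 4) a); last by rewrite (kashina_x4 hH) act_one.
by rewrite !exprS expr0 mulr1 !act_comp.
Qed.

Let xy a : rho x (rho y a) = rho y (rho x a).
Proof. by rewrite -!act_comp (kashina_xy hH). Qed.

Let zx a : rho z (rho x a) = rho y (rho x (rho z a)).
Proof. by rewrite -!act_comp (kashina_zx hH) (kashina_xy hH). Qed.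

Let z2 a : rho z (rho z a) = if k is Kashina8 then a else rho y a.
Proof.
by rewrite -act_comp -expr2 (kashina_z2 hH); case: (k); rewrite ?act_one.
Qed.

Lemma average_x a : average (rho x a) = average a.
Proof.
rewrite /average !act_add !(zx, xy, y2, x4).
congr (_ *: _); by nc_ring constr:(R[i]) A.
Qed.

Lemma average_y a : average (rho y a) = average a.
Proof.
rewrite /average !act_add !(act_zy, xy, y2, x4).
congr (_ *: _); by nc_ring constr:(R[i]) A.
Qed.

Lemma average_z a : average (rho z a) = average a.
Proof.
rewrite /average !act_add z2; case: (k); congr (_ *: _); rewrite ?y2.
  by nc_ring constr:(R[i]) A.
by rewrite !xy; nc_ring constr:(R[i]) A.
Qed.

Lemma average_invariant a : act_invariant rho a -> average a = a.
Proof.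
move=> /act_invariantP [xa ya za]; rewrite /average za !act_add ya !xa.
have t16 : (16 : R[i]) != 0 by rewrite pnatr_eq0.
by nc_prep constr:(R[i]) A; repeat split; field.
Qed.

End Action.

(* On the monomials p^m E^k T^l, where E = a^2, F = b^2, p = a b and T = t^2, the
   generators x and z act by signs, possibly exchanging E and F. *)
Record sign_data := SignData {
  x_swaps : bool; z_swaps : bool;
  x_sign_p : bool; x_sign_E : bool; z_sign_p : bool; z_sign_E : bool
}.

Definition sign_data_of (k : kashina) (p : rep2) (q : quadric) : sign_data :=
  let s := if p is Pi1 then true else false in
  let n := if k is Kashina9 then true else false in
  match q with
  | Comm => SignData false true (~~ s) s (s (+) n) s
  | Skew => SignData false true (~~ s) s (s (+) ~~ n) s
  | SqDiff => SignData true n (~~ s) s (s (+) ~~ n) s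
  | SqSum => SignData true (~~ n) (~~ s) s (s (+) ~~ n) (~~ s)
  end.

(* The sign s for which p^m (E^k + (-1)^s F^k) T^l is invariant, if any. *)
Definition orbit_sign (xsw zsw x0 z0 : bool) : option bool :=
  if xsw then
    if zsw then (if x0 (+) z0 then None else Some x0)
    else if z0 then None else Some x0
  else if x0 then None else Some z0.

Definition orbit_sign_at (d : sign_data) (m k l : bool) : option bool :=
  orbit_sign (x_swaps d) (z_swaps d)
    ((x_sign_p d && m) (+) (x_sign_E d && k) (+) l)
    ((z_sign_p d && m) (+) (z_sign_E d && k)).

(** * How x, y and z act on E, F, P and T *)

Section Invariants.
Variables (R : realType) (k : kashina) (H : hopfAlg R[i]) (x y z : H).
Hypothesis hH : is_kashina k x y z.
Variables (p : rep2) (q : quadric) (alpha : R[i]).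
Variables (sx sz : bool) (A : cgAlg R[i]) (u v t : A).
Hypothesis hA : quadric_Ore q alpha u v t.
Variable rho : hopfAction H A.
Hypothesis hact : acts_as k p sx sz x y z u v t rho.

Local Notation K := (R[i]).
Local Notation a := (diagA 'i%C q u v).
Local Notation b := (diagB 'i%C q u v).
Local Notation tau := (diag_sign K q).
Local Notation E := (a ^+ 2).
Local Notation F := (b ^+ 2).
Local Notation P := (a * b).
Local Notation T := (t ^+ 2).
Local Notation d := (sign_data_of k p q).
Local Notation lam := (alpha ^+ 4).

Let ii : 'i%C * 'i%C = -1 :> K. Proof. by rewrite -expr2 sqr_i. Qed.
Let tt : tau * tau = 1.
Proof. by rewrite /diag_sign; case: (q); rewrite ?mulrNN mulr1. Qed.

Lemma diag_swap : b * a = tau *: (a * b).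
Proof. by have [rel0 _ _] := quadric_Ore_rel hA; apply: diag_rel; rewrite ?sqr_i. Qed.

Lemma comm_EP : E * P = P * E.
Proof.
have -> : P * E = a * (b * a) * a by nc_ring constr:(K) A.
rewrite diag_swap.
have -> : a * (tau *: (a * b)) * a = tau *: (a * a * (b * a)) by nc_ring constr:(K) A.
by rewrite diag_swap; nc_prep constr:(K) A; repeat split; have h := tt; ring: h.
Qed.

Lemma comm_FP : F * P = P * F.
Proof.
have -> : F * P = b * (b * a) * b by nc_ring constr:(K) A.
rewrite diag_swap.
have -> : b * (tau *: (a * b)) * b = tau *: ((b * a) * b * b) by nc_ring constr:(K) A.
by rewrite diag_swap; nc_prep constr:(K) A; repeat split; have h := tt; ring: h.
Qed.

Lemma mul_EF : E * F = tau *: P ^+ 2.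
Proof.
have -> : P ^+ 2 = a * (b * a) * b by nc_ring constr:(K) A.
by rewrite diag_swap; nc_prep constr:(K) A; repeat split; have h := tt; ring: h.
Qed.

Lemma comm_EF : E * F = F * E.
Proof.
rewrite mul_EF.
have -> : F * E = b * (b * a) * a by nc_ring constr:(K) A.
rewrite diag_swap.
have -> : b * (tau *: (a * b)) * a = tau *: ((b * a) * (b * a)) by nc_ring constr:(K) A.
by rewrite diag_swap; nc_prep constr:(K) A; repeat split; have h := tt; ring: h.
Qed.

Lemma t2_u : T * u = alpha ^+ 2 *: (u * T).
Proof.
have [_ tu _] := quadric_Ore_rel hA.
have -> : T * u = t * (t * u) by nc_ring constr:(K) A.
rewrite tu; have -> : t * (alpha *: u * t) = alpha *: ((t * u) * t) by nc_ring constr:(K) A.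
by rewrite tu; nc_ring constr:(K) A.
Qed.

Lemma t2_v : T * v = alpha ^+ 2 *: (v * T).
Proof.
have [_ _ tv] := quadric_Ore_rel hA.
have -> : T * v = t * (t * v) by nc_ring constr:(K) A.
rewrite tv; have -> : t * (- alpha *: v * t) = - alpha *: ((t * v) * t) by nc_ring constr:(K) A.
by rewrite tv; nc_ring constr:(K) A.
Qed.

Lemma t2_a : T * a = alpha ^+ 2 *: (a * T).
Proof.
rewrite /diagA; case: (q); rewrite ?t2_u // mulrDr -?scalerAr t2_u t2_v.
  by nc_ring constr:(K) A.
by nc_ring constr:(K) A.
Qed.

Lemma t2_b : T * b = alpha ^+ 2 *: (b * T).
Proof.
rewrite /diagB; case: (q); rewrite ?t2_v // mulrBr -?scalerAr t2_u t2_v.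
  by nc_ring constr:(K) A.
by nc_ring constr:(K) A.
Qed.

Let t2_mul c e w w' : T * w = c *: (w * T) -> T * w' = e *: (w' * T) ->
  T * (w * w') = (c * e) *: (w * w' * T).
Proof.
move=> h h'; rewrite mulrA h.
have -> : c *: (w * T) * w' = c *: (w * (T * w')) by nc_ring constr:(K) A.
by rewrite h'; nc_ring constr:(K) A.
Qed.

Lemma t2_E : T * E = lam *: (E * T).
Proof. by rewrite [E]expr2 (t2_mul t2_a t2_a) -exprD. Qed.

Lemma t2_F : T * F = lam *: (F * T).
Proof. by rewrite [F]expr2 (t2_mul t2_b t2_b) -exprD. Qed.

Lemma t2_P : T * P = lam *: (P * T).
Proof. by rewrite (t2_mul t2_a t2_b) -exprD. Qed.

Let c : K := if p is Pi1 then 'i%C else 1.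
Let cc : c * c = (-1) ^+ (x_sign_E d).
Proof.
by rewrite /c; case: (p); case: (q); rewrite /= ?expr0 ?expr1 ?mulr1 ?ii.
Qed.

Lemma act_x_diag : exists c1 c2,
  [/\ rho x a = c1 *: (if x_swaps d then b else a),
      rho x b = c2 *: (if x_swaps d then a else b),
      c1 ^+ 2 = (-1) ^+ x_sign_E d, c2 ^+ 2 = (-1) ^+ x_sign_E d &
      c1 * c2 * (if x_swaps d then tau else 1) = (-1) ^+ x_sign_p d].
Proof.
have [[xu _ _] [xv _ _] _] := hact.
rewrite -/c in xu xv.
have cN : - (c * c) = (-1) ^+ x_sign_p d.
  rewrite cc; case: (p); case: (q); rewrite /= ?expr0 ?expr1 ?opprK //.
move: cc cN; rewrite /diagA /diagB /diag_sign; case: (q) => /= h hN.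
- exists c, (- c); rewrite xu xv expr2 sqrrN; split=> //; by rewrite mulr1 mulrN.
- exists c, (- c); rewrite xu xv expr2 sqrrN; split=> //; by rewrite mulr1 mulrN.
- exists c, c; rewrite actB act_add xu xv expr2; split=> //; last by rewrite mulrN1.
    by nc_ring constr:(K) A.
  by nc_ring constr:(K) A.
- exists c, c; rewrite actB act_add act_scale xu xv expr2; split=> //; last by rewrite mulrN1.
    by nc_ring constr:(K) A.
  by nc_ring constr:(K) A.
Qed.

(** The factor (-1)^x_sign_E is the scalar of x^2 on u and v: the twist contributes it when z is
    applied to a product of two of the letters a and b, both of which y negates. *)
Lemma act_z_diag : exists c1 c2,
  [/\ rho z a = c1 *: (if z_swaps d then b else a),
      rho z b = c2 *: (if z_swaps d then a else b),
      (-1) ^+ x_sign_E d * c1 ^+ 2 = (-1) ^+ z_sign_E d,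
      (-1) ^+ x_sign_E d * c2 ^+ 2 = (-1) ^+ z_sign_E d &
      (-1) ^+ x_sign_E d * (c1 * c2) * (if z_swaps d then tau else 1)
        = (-1) ^+ z_sign_p d].
Proof.
have [[_ _ zu] [_ _ zv] _] := hact; have h := ii.
rewrite /diagA /diagB /diag_sign; case: (q) => /=.
- exists 1, (if k is Kashina8 then 1 else -1); rewrite zu zv scale1r.
  by case: (k); case: (p); rewrite /= ?scale1r ?scaleN1r; split=> //; ring.
- exists 1, (if k is Kashina8 then 1 else -1); rewrite zu zv scale1r.
  by case: (k); case: (p); rewrite /= ?scale1r ?scaleN1r; split=> //; ring.
- exists (if k is Kashina8 then 1 else -1), (if k is Kashina8 then -1 else 1).
  rewrite actB act_add zu zv.
  by case: (k); case: (p); rewrite /=; split; (ring || nc_ring constr:(K) A).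
- exists (if k is Kashina8 then 'i%C else - 'i%C), (if k is Kashina8 then - 'i%C else 'i%C).
  rewrite actB act_add !act_scale zu zv.
  case: (k); case: (p); rewrite /=; split; try (by ring: h);
  by nc_prep constr:(K) A; repeat split; ring: h.
Qed.

Lemma act_y_diag : rho y a = - a /\ rho y b = - b.
Proof.
have [[_ yu _] [_ yv _] _] := hact.
rewrite /diagA /diagB; case: (q); rewrite ?actB ?act_add ?act_scale ?yu ?yv;
  split=> //; by nc_ring constr:(K) A.
Qed.

Lemma act_zxx w : rho z (rho x (rho x w)) = rho x (rho x (rho z w)).
Proof.
rewrite -!act_comp; congr (rho _ w).
have zx := kashina_zx hH; have xy := kashina_xy hH.
rewrite zx -(mulrA _ z x) zx !mulrA; congr (_ * z).
by rewrite -(mulrA x y x) -xy -!mulrA -expr2 (kashina_y2 hH) mulr1.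
Qed.

Lemma act_z_odd w w' (e : K) : rho y w = - w -> rho x (rho x w') = e *: w' ->
  rho z (w * w') = e *: (rho z w * rho z w').
Proof.
move=> yw xw; rewrite (act_zM hH) -(act_zy hH) yw actN -act_zxx xw act_scale.
have two := @complex_two R; move: (rho z w) (rho z w') => g h.
by nc_prep constr:(K) A; repeat split; field.
Qed.

Lemma act_xx_diag w : (w = a \/ w = b) -> rho x (rho x w) = (-1) ^+ x_sign_E d *: w.
Proof.
have [c1 [c2 [xa xb h1 h2 h3]]] := act_x_diag.
have hc : x_swaps d -> c1 * c2 = (-1) ^+ x_sign_E d.
  move: h3; rewrite /sign_data_of /diag_sign.
  case: (q) => //= h3 _; transitivity (- (c1 * c2 * -1));
    [by rewrite mulrN1 opprK | by rewrite h3; case: (p); rewrite /= ?expr0 ?expr1 ?opprK |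
     by rewrite mulrN1 opprK | by rewrite h3; case: (p); rewrite /= ?expr0 ?expr1 ?opprK].
case=> ->; rewrite ?xa ?xb act_scale.
  by move: hc xa xb; case: ifP => [_ hc xa xb|_ hc xa xb];
    rewrite ?xa ?xb scalerA ?[c1 * c2]hc // -expr2 h1.
by move: hc xa xb; case: ifP => [_ hc xa xb|_ hc xa xb];
    rewrite ?xa ?xb scalerA ?[c2 * c1]mulrC ?hc // -expr2 h2.
Qed.

Lemma act_x_EFP : [/\ rho x E = (-1) ^+ x_sign_E d *: (if x_swaps d then F else E),
  rho x F = (-1) ^+ x_sign_E d *: (if x_swaps d then E else F),
  rho x P = (-1) ^+ x_sign_p d *: P & rho x T = - T].
Proof.
have [c1 [c2 [xa xb h1 h2 h3]]] := act_x_diag.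
have [_ _ [xt _ _]] := hact.
rewrite !(act_xX hH) (act_xM hH) xa xb xt !exprZn h1 h2 -h3; split.
- by case: ifP.
- by case: ifP.
- case: ifP => _; first by rewrite -scalerAl -scalerAr diag_swap !scalerA.
  by rewrite -scalerAl -scalerAr scalerA mulr1.
- by rewrite exprMn sqrr_sign mul1r sqr_i scaleN1r.
Qed.

Lemma act_y_EFP : [/\ rho y E = E, rho y F = F, rho y P = P & rho y T = T].
Proof.
have [ya yb] := act_y_diag; have [_ _ [_ yt _]] := hact.
by rewrite !(act_yX hH) (act_yM hH) ya yb yt !sqrrN mulrNN.
Qed.

Lemma act_z_EFP : [/\ rho z E = (-1) ^+ z_sign_E d *: (if z_swaps d then F else E),
  rho z F = (-1) ^+ z_sign_E d *: (if z_swaps d then E else F),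
  rho z P = (-1) ^+ z_sign_p d *: P & rho z T = T].
Proof.
have [ya yb] := act_y_diag; have [_ _ [_ yt zt]] := hact.
have [c1 [c2 [za zb h1 h2 h3]]] := act_z_diag.
have xa := act_xx_diag (or_introl erefl); have xb := act_xx_diag (or_intror erefl).
rewrite ![E]expr2 ![F]expr2 (act_z_odd ya xa) (act_z_odd yb xb) (act_z_odd ya xb).
rewrite za zb expr2 (act_z_even hH _ yt) zt -h3; split.
- by rewrite -scalerAl -scalerAr !scalerA -mulrA -[c1 * c1]expr2 h1; case: ifP.
- by rewrite -scalerAl -scalerAr !scalerA -mulrA -[c2 * c2]expr2 h2; case: ifP.
- rewrite -scalerAl -scalerAr !scalerA; case: ifP => _; last by rewrite mulr1 mulrA.
  by rewrite diag_swap !scalerA mulrA.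
- by rewrite -scalerAl -scalerAr scalerA -expr2 sqrr_sign scale1r.
Qed.

End Invariants.

(** * Averages of monomials *)

Section Invariants.
Variables (R : realType) (k : kashina) (H : hopfAlg R[i]) (x y z : H).
Hypothesis hH : is_kashina k x y z.
Variables (p : rep2) (q : quadric) (alpha : R[i]).
Variables (sx sz : bool) (A : cgAlg R[i]) (u v t : A).
Hypothesis hA : quadric_Ore q alpha u v t.
Variable rho : hopfAction H A.
Hypothesis hact : acts_as k p sx sz x y z u v t rho.

Local Notation K := (R[i]).
Local Notation a := (diagA 'i%C q u v).
Local Notation b := (diagB 'i%C q u v).
Local Notation E := (a ^+ 2).
Local Notation F := (b ^+ 2).
Local Notation P := (a * b).
Local Notation T := (t ^+ 2).
Local Notation d := (sign_data_of k p q).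

Lemma signrX (e : bool) n : ((-1) ^+ e : K) ^+ n = (-1) ^+ (e && odd n).
Proof.
by rewrite -exprM -(signr_odd _ (e * n)) oddM; case: e.
Qed.

Lemma act_x_mon m j l :
  rho x (P ^+ m * E ^+ j * T ^+ l) =
    (-1) ^+ ((x_sign_p d && odd m) (+) (x_sign_E d && odd j) (+) odd l)
      *: (P ^+ m * (if x_swaps d then F else E) ^+ j * T ^+ l) /\
  rho x (P ^+ m * F ^+ j * T ^+ l) =
    (-1) ^+ ((x_sign_p d && odd m) (+) (x_sign_E d && odd j) (+) odd l)
      *: (P ^+ m * (if x_swaps d then E else F) ^+ j * T ^+ l).
Proof.
have [xE xF xP xT] := act_x_EFP hH hA hact.
have G (w w' w'' : A) : rho x (w ^+ m * w' ^+ j * w'' ^+ l) =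
    rho x w ^+ m * rho x w' ^+ j * rho x w'' ^+ l.
  by rewrite !(act_xM hH) !(act_xX hH).
rewrite !G xE xF xP xT -(scaleN1r T) !exprZn !signrX.
have S3 (c e f : K) (w w' w'' : A) :
    c *: w * (e *: w') * (f *: w'') = (c * e * f) *: (w * w' * w'').
  by nc_ring constr:(K) A.
by rewrite -(signr_odd _ l) !S3 !signr_addb.
Qed.

Lemma act_y_mon m j l : rho y (P ^+ m * E ^+ j * T ^+ l) = P ^+ m * E ^+ j * T ^+ l /\
  rho y (P ^+ m * F ^+ j * T ^+ l) = P ^+ m * F ^+ j * T ^+ l.
Proof.
have [yE yF yP yT] := act_y_EFP hH q hact.
have G (w w' w'' : A) : rho y (w ^+ m * w' ^+ j * w'' ^+ l) =
    rho y w ^+ m * rho y w' ^+ j * rho y w'' ^+ l.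
  by rewrite !(act_yM hH) !(act_yX hH).
by rewrite !G yE yF yP yT.
Qed.

Lemma act_z_mon m j l :
  rho z (P ^+ m * E ^+ j * T ^+ l) =
    (-1) ^+ ((z_sign_p d && odd m) (+) (z_sign_E d && odd j))
      *: (P ^+ m * (if z_swaps d then F else E) ^+ j * T ^+ l) /\
  rho z (P ^+ m * F ^+ j * T ^+ l) =
    (-1) ^+ ((z_sign_p d && odd m) (+) (z_sign_E d && odd j))
      *: (P ^+ m * (if z_swaps d then E else F) ^+ j * T ^+ l).
Proof.
have [zE zF zP zT] := act_z_EFP hH hA hact.
have [yE yF yP yT] := act_y_EFP hH q hact.
have G (w w' w'' : A) : rho y w = w -> rho y w' = w' -> rho y w'' = w'' ->
    rho z (w ^+ m * w' ^+ j * w'' ^+ l) = rho z w ^+ m * rho z w' ^+ j * rho z w'' ^+ l.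
  move=> yw yw' yw''.
  have yX (g : A) n : rho y g = g -> rho y (g ^+ n) = g ^+ n.
    by move=> e; rewrite (act_yX hH) e.
  by rewrite !(act_z_even hH) ?(act_z_evenX hH) ?(act_yM hH) ?yX.
rewrite !G // zE zF zP zT !exprZn !signrX.
have S2 (c e : K) (w w' w'' : A) : c *: w * (e *: w') * w'' = (c * e) *: (w * w' * w'').
  by nc_ring constr:(K) A.
by rewrite !S2 !signr_addb.
Qed.

(** [average] takes the same value on w, x w and z w. If x or z, or both together, send n to -n, the
    average equals its opposite and vanishes. Otherwise n and +-n' have the same average, and their
    sum is invariant, hence equal to its own average. *)
Lemma average_orbit (n n' : A) (xsw zsw x0 z0 : bool) : xsw || zsw ->
  rho x n = (-1) ^+ x0 *: (if xsw then n' else n) ->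
  rho x n' = (-1) ^+ x0 *: (if xsw then n else n') ->
  rho y n = n -> rho y n' = n' ->
  rho z n = (-1) ^+ z0 *: (if zsw then n' else n) ->
  rho z n' = (-1) ^+ z0 *: (if zsw then n else n') ->
  if orbit_sign xsw zsw x0 z0 is Some s then
    act_invariant rho (n + (-1) ^+ s *: n') /\
    average x y z rho n = 2^-1 *: (n + (-1) ^+ s *: n')
  else average x y z rho n = 0.
Proof.
move=> sw xn xn' yn yn' zn zn'.
have two := @complex_two R.
have half (w : A) : w = (2^-1 : K) *: (w + w).
  by nc_prep constr:(K) A; repeat split; field.
have neg : average x y z rho n = - average x y z rho n -> average x y z rho n = 0.
  by move=> e; rewrite [LHS]half [X in _ + X]e subrr scaler0.
have sgn (e : bool) : (-1) ^+ e * (-1) ^+ e = 1 :> K by rewrite -expr2 sqrr_sign.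
have orbit s : rho x (n + (-1) ^+ s *: n') = n + (-1) ^+ s *: n' ->
    rho z (n + (-1) ^+ s *: n') = n + (-1) ^+ s *: n' ->
    average x y z rho n = average x y z rho ((-1) ^+ s *: n') ->
    act_invariant rho (n + (-1) ^+ s *: n') /\
    average x y z rho n = 2^-1 *: (n + (-1) ^+ s *: n').
  move=> hx hz e.
  have inv : act_invariant rho (n + (-1) ^+ s *: n').
    by apply/(act_invariantP hH); split=> //; rewrite act_add act_scale yn yn'.
  split=> //.
  by rewrite [LHS]half [X in _ + X]e -averageD (average_invariant hH inv).
have Ax := average_x hH rho n; have Az := average_z hH rho n.
rewrite /orbit_sign; move: sw xn xn' zn zn'; case: xsw; case: zsw => //= _ xn xn' zn zn'.
- case: ifP => [e|/negbT e].
    apply: neg; rewrite -{1}Ax xn averageZ.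
    rewrite -[average _ _ _ _ n]Az zn averageZ.
    move: e; case: (x0); case: (z0) => //= _;
      by rewrite ?expr0 ?expr1 ?scale1r ?scaleN1r ?opprK.
  have e0 : z0 = x0 by move: e; case: (x0); case: (z0).
  apply: orbit.
  + by rewrite act_add act_scale xn xn' scalerA sgn scale1r addrC.
  + by rewrite act_add act_scale zn zn' e0 scalerA sgn scale1r addrC.
  + by rewrite -xn (average_x hH).
- case: ifP => [e|/negbT e].
    by apply: neg; rewrite -{1}Az zn e expr1 scaleN1r -scaleN1r averageZ scaleN1r.
  apply: orbit.
  + by rewrite act_add act_scale xn xn' scalerA sgn scale1r addrC.
  + by rewrite act_add act_scale zn zn' (negPf e) expr0 !scale1r.
  + by rewrite -xn (average_x hH).
- case: ifP => [e|/negbT e].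
    by apply: neg; rewrite -{1}Ax xn e expr1 scaleN1r -scaleN1r averageZ scaleN1r.
  apply: orbit.
  + by rewrite act_add act_scale xn xn' (negPf e) expr0 !scale1r.
  + by rewrite act_add act_scale zn zn' scalerA sgn scale1r addrC.
  + by rewrite -zn (average_z hH).
Qed.

Definition orbit_sum (s : bool) (m j l : nat) : A :=
  P ^+ m * (E ^+ j + (-1) ^+ s *: F ^+ j) * T ^+ l.

Let orbit_sumE s m j l : orbit_sum s m j l =
  P ^+ m * E ^+ j * T ^+ l + (-1) ^+ s *: (P ^+ m * F ^+ j * T ^+ l).
Proof. by rewrite /orbit_sum mulrDr mulrDl -scalerAr -scalerAl. Qed.

Let swaps : x_swaps d || z_swaps d. Proof. by case: (q). Qed.

Lemma orbit_sum_invariant s m j l :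
  orbit_sign_at d (odd m) (odd j) (odd l) = Some s ->
  act_invariant rho (orbit_sum s m j l).
Proof.
have [x1 x2] := act_x_mon m j l; have [y1 y2] := act_y_mon m j l.
have [z1 z2] := act_z_mon m j l.
have := @average_orbit (P ^+ m * E ^+ j * T ^+ l) (P ^+ m * F ^+ j * T ^+ l) _ _ _ _ swaps.
move: x1 x2 z1 z2; rewrite /orbit_sign_at orbit_sumE.
case: (x_swaps d); case: (z_swaps d) => x1 x2 z1 z2 h;
  by move: (h _ _ x1 x2 y1 y2 z1 z2); case: (orbit_sign _ _ _ _) => // s0 [? _] [<-].
Qed.

Lemma average_mon m j l :
  if orbit_sign_at d (odd m) (odd j) (odd l) is Some s then
    average x y z rho (P ^+ m * E ^+ j * T ^+ l) = 2^-1 *: orbit_sum s m j l /\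
    average x y z rho (P ^+ m * F ^+ j * T ^+ l) = (2^-1 * (-1) ^+ s) *: orbit_sum s m j l
  else
    average x y z rho (P ^+ m * E ^+ j * T ^+ l) = 0 /\
    average x y z rho (P ^+ m * F ^+ j * T ^+ l) = 0.
Proof.
have [x1 x2] := act_x_mon m j l; have [y1 y2] := act_y_mon m j l.
have [z1 z2] := act_z_mon m j l.
have := @average_orbit (P ^+ m * E ^+ j * T ^+ l) (P ^+ m * F ^+ j * T ^+ l) _ _ _ _ swaps.
have := @average_orbit (P ^+ m * F ^+ j * T ^+ l) (P ^+ m * E ^+ j * T ^+ l) _ _ _ _ swaps.
move: x1 x2 z1 z2; rewrite /orbit_sign_at.
case: (x_swaps d); case: (z_swaps d) => x1 x2 z1 z2 h h';
  move: (h _ _ x2 x1 y2 y1 z2 z1) (h' _ _ x1 x2 y1 y2 z1 z2);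
  case: (orbit_sign _ _ _ _) => // s0 [_ e1] [_ e2];
  rewrite orbit_sumE e1 e2; split=> //; rewrite -scalerA; congr (_ *: _);
  by rewrite scalerDr scalerA -expr2 sqrr_sign scale1r addrC.
Qed.

End Invariants.

(** * The invariants are spanned by orbit sums *)

Section Invariants.
Variables (R : realType) (k : kashina) (H : hopfAlg R[i]) (x y z : H).
Hypothesis hH : is_kashina k x y z.
Variables (p : rep2) (q : quadric) (alpha : R[i]).
Variables (sx sz : bool) (A : cgAlg R[i]) (u v t : A).
Hypothesis hA : quadric_Ore q alpha u v t.
Variable rho : hopfAction H A.
Hypothesis hact : acts_as k p sx sz x y z u v t rho.

Local Notation K := (R[i]).
Local Notation a := (diagA 'i%C q u v).
Local Notation b := (diagB 'i%C q u v).
Local Notation tau := (diag_sign K q).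
Local Notation E := (a ^+ 2).
Local Notation F := (b ^+ 2).
Local Notation P := (a * b).
Local Notation T := (t ^+ 2).
Local Notation d := (sign_data_of k p q).

Inductive mon_span : A -> Prop :=
| mon_span0 : mon_span 0
| mon_spanD f g of mon_span f & mon_span g : mon_span (f + g)
| mon_spanZ c f of mon_span f : mon_span (c *: f)
| mon_span_mon i j l : mon_span (a ^+ i * b ^+ j * t ^+ l).

Let b_a i : b * a ^+ i = tau ^+ i *: (a ^+ i * b).
Proof.
elim: i => [|i IH]; first by rewrite !expr0 mulr1 mul1r scale1r.
rewrite exprSr mulrA IH -scalerAl -(mulrA _ b a) (diag_swap hA) -scalerAr scalerA.
by rewrite [tau ^+ i.+1]exprSr !mulrA.
Qed.

(** Because sigma has eigenvalues alpha and -alpha on u and v, moving t past u + v turns it into a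
    multiple of u - v: for u^2 = +-v^2 the letters a and b are exchanged. *)
Let t_swap : exists c1 c2 w1 w2, [/\ t * a = c1 *: (w1 * t), t * b = c2 *: (w2 * t)
  & (w1 = a /\ w2 = b) \/ (w1 = b /\ w2 = a)].
Proof.
have [_ tu tv] := quadric_Ore_rel hA; rewrite /diagA /diagB; case: (q).
- by exists alpha, (- alpha), u, v; rewrite tu tv -!scalerAl; split=> //; left.
- by exists alpha, (- alpha), u, v; rewrite tu tv -!scalerAl; split=> //; left.
- exists alpha, alpha, (u - v), (u + v); split; last by right.
    by rewrite mulrDr tu tv; nc_ring constr:(K) A.
  by rewrite mulrBr tu tv; nc_ring constr:(K) A.
- exists alpha, alpha, (u - 'i%C *: v), (u + 'i%C *: v); split; last by right.
    by rewrite mulrDr -scalerAr tu tv; nc_ring constr:(K) A.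
  by rewrite mulrBr -scalerAr tu tv; nc_ring constr:(K) A.
Qed.

(** The span of the ordered monomials contains 1 and is stable under left multiplication by the
    generators. *)
Lemma mon_span_all f : mon_span f.
Proof.
suff H0 g : forall f, mon_span f -> mon_span (g * f).
  have := H0 f 1; rewrite mulr1; apply.
  by have := mon_span_mon 0 0 0; rewrite !expr0 !mulr1.
have mul_gen h : (forall i j l, mon_span (h * (a ^+ i * b ^+ j * t ^+ l))) ->
    forall f, mon_span f -> mon_span (h * f).
  move=> hm f' sf; elim: sf => [|f1 f2 _ IH1 _ IH2|c f1 _ IH1|i j l].
  - by rewrite mulr0; apply: mon_span0.
  - by rewrite mulrDr; apply: mon_spanD.
  - by rewrite -scalerAr; apply: mon_spanZ.
  - exact: hm.
have lin c1 c2 h1 h2 : (forall f, mon_span f -> mon_span (h1 * f)) ->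
    (forall f, mon_span f -> mon_span (h2 * f)) ->
    forall f, mon_span f -> mon_span ((c1 *: h1 + c2 *: h2) * f).
  move=> m1 m2 f' sf; rewrite mulrDl -!scalerAl.
  by apply: mon_spanD; apply: mon_spanZ; [apply: m1 | apply: m2].
have ma : forall f, mon_span f -> mon_span (a * f).
  by apply: mul_gen => i j l; rewrite !mulrA -exprS; apply: mon_span_mon.
have mb : forall f, mon_span f -> mon_span (b * f).
  apply: mul_gen => i j l; rewrite !mulrA b_a -!scalerAl; apply: mon_spanZ.
  by rewrite -(mulrA _ b) -exprS; apply: mon_span_mon.
have two := @complex_two R.
elim/(quadric_Ore_ind hA): g => [||g h Hg Hh|c g Hg|g h Hg Hh|||].
- by move=> f' _; rewrite mul0r; apply: mon_span0.
- by move=> f'; rewrite mul1r.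
- by move=> f' sf; rewrite mulrDl; apply: mon_spanD; [apply: Hg | apply: Hh].
- by move=> f' sf; rewrite -scalerAl; apply/mon_spanZ/Hg.
- by move=> f' sf; rewrite -mulrA; apply/Hg/Hh.
- by have [c1 [c2 uE]] := diagAK 'i%C two q u v; have := lin c1 c2 _ _ ma mb; rewrite -uE.
- have [c1 [c2 vE]] := diagBK (sqr_i R) two q u v.
  by have := lin c1 c2 _ _ ma mb; rewrite -vE.
- have [c1 [c2 [w1 [w2 [ta tb w12]]]]] := t_swap.
  apply: mul_gen => i j l.
  have tX c w w' n : t * w = c *: (w' * t) -> t * w ^+ n = c ^+ n *: (w' ^+ n * t).
    move=> h; elim: n => [|n IH]; first by rewrite !expr0 mulr1 mul1r scale1r.
    by rewrite exprSr mulrA IH -scalerAl -mulrA h -scalerAr scalerA mulrA -!exprSr.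
  rewrite !mulrA (tX _ _ _ i ta) -!scalerAl; apply: mon_spanZ.
  rewrite -(mulrA _ t) (tX _ _ _ j tb) -scalerAr -scalerAl; apply: mon_spanZ.
  rewrite mulrA -(mulrA _ t) -exprS.
  case: w12 => -[-> ->]; first exact: mon_span_mon.
  elim: i => [|i IH]; first by have := mon_span_mon j 0 l.+1; rewrite !expr0 mulr1 mul1r.
  by rewrite exprS -!mulrA; apply: mb; rewrite mulrA.
Qed.

Lemma diag_power j : exists c, a ^+ j * b ^+ j = c *: P ^+ j.
Proof.
have bP n : b ^+ n * P = tau ^+ n *: (P * b ^+ n).
  elim: n => [|n IH]; first by rewrite !expr0 mulr1 mul1r scale1r.
  rewrite exprS -mulrA IH -scalerAr !mulrA (diag_swap hA) -!scalerAl scalerA.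
  by rewrite -exprSr -!mulrA.
elim: j => [|j [c IH]]; first by exists 1; rewrite !expr0 mulr1 scale1r.
have tt : tau ^+ j * tau ^+ j = 1.
  by rewrite -exprMn /diag_sign; case: (q); rewrite ?mulrNN mulr1 expr1n.
exists (tau ^+ j * c); rewrite exprSr exprS -mulrA (mulrA a b).
have -> : P * b ^+ j = tau ^+ j *: (b ^+ j * P) by rewrite bP scalerA tt scale1r.
by rewrite -scalerAr (mulrA (a ^+ j)) IH -scalerAl scalerA [P ^+ j.+1]exprSr.
Qed.

(** An invariant is the average of its ordered monomials a^i b^j t^l. Those with i + j odd are
    negated by y and those with i + j even and l odd by x^2, so they average to 0; in the others a^i
    b^j is a multiple of some P^m E^n or P^m F^n. *)
Lemma invariant_ind (S : A -> Prop) :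
  S 0 -> (forall f g, S f -> S g -> S (f + g)) -> (forall c f, S f -> S (c *: f)) ->
  (forall s m j l, orbit_sign_at d (odd m) (odd j) (odd l) = Some s ->
     S (orbit_sum q u v t s m j l)) ->
  forall f, act_invariant rho f -> S f.
Proof.
move=> S0 SD SZ Sm f inv; rewrite -(average_invariant hH inv).
have a0 w : average x y z rho w = - average x y z rho w -> average x y z rho w = 0.
  move=> e; have two := @complex_two R.
  suff -> : average x y z rho w = (2^-1 : K) *: (average x y z rho w + average x y z rho w).
    by rewrite [X in _ + X]e subrr scaler0.
  by nc_prep constr:(K) A; repeat split; field.
elim: (mon_span_all f) => [|f1 f2 _ IH1 _ IH2|c f1 _ IH1|i j l].
- by have := averageZ x y z rho 0 0; rewrite !scale0r => ->.
- by rewrite averageD; apply: (SD).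
- by rewrite averageZ; apply: (SZ).
have [ya yb] := act_y_diag q hact; have [_ _ [xt yt _]] := hact.
have [oij|eij] := boolP (odd (i + j)).
  rewrite a0 //; rewrite -{1}(average_y hH) !(act_yM hH) !(act_yX hH) ya yb yt.
  have S2 (c e : K) (w w' w'' : A) : c *: w * (e *: w') * w'' = (c * e) *: (w * w' * w'').
    by nc_ring constr:(K) A.
  rewrite -(scaleN1r a) -(scaleN1r b) !exprZn S2 -exprD -(signr_odd _ (i + j)) oij.
  by rewrite expr1 averageZ scaleN1r.
have xxt : rho x (rho x t) = - t.
  rewrite xt act_scale xt scalerA -(scaleN1r t); congr (_ *: _).
  by rewrite mulrACA -expr2 sqrr_sign mul1r -expr2 sqr_i.
have xxa := act_xx_diag (q := q) hact (or_introl erefl).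
have xxb := act_xx_diag (q := q) hact (or_intror erefl).
have [ol|el] := boolP (odd l).
  rewrite a0 //; rewrite -{1}(average_x hH) -{1}(average_x hH).
  rewrite !(act_xM hH) !(act_xX hH) xxa xxb xxt -(scaleN1r t) !exprZn.
  have S3 (c e e' : K) (w w' w'' : A) :
      c *: w * (e *: w') * (e' *: w'') = (c * e * e') *: (w * w' * w'').
    by nc_ring constr:(K) A.
  rewrite S3 -exprD signrX (negPf eij) andbF expr0 mul1r -(signr_odd _ l) ol expr1.
  by rewrite averageZ scaleN1r.
have -> : t ^+ l = T ^+ l./2 by rewrite -exprM mul2n even_halfK.
have [c [m [n [e|e]]]] : exists c m n,
    a ^+ i * b ^+ j = c *: (P ^+ m * E ^+ n) \/ a ^+ i * b ^+ j = c *: (P ^+ m * F ^+ n).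
  have [ji|ij] := leqP j i.
    have [c cE] := diag_power j; exists c, j, (i - j)./2; left.
    have eE : E ^+ (i - j)./2 = a ^+ (i - j).
      by rewrite -exprM mul2n even_halfK // oddB // -oddD.
    have cEP n : E ^+ n * P ^+ j = P ^+ j * E ^+ n.
      by apply/commrX/commr_sym/commrX/commr_sym/(comm_EP hA).
    by rewrite -cEP scalerAr -cE eE mulrA -exprD subnK.
  have [c cE] := diag_power i; exists c, i, (j - i)./2; right.
  have eE : F ^+ (j - i)./2 = b ^+ (j - i).
    by rewrite -exprM mul2n even_halfK // oddB ?(ltnW ij) // -oddD addnC.
  by rewrite scalerAl -cE eE -mulrA -exprD subnKC ?(ltnW ij).
all: rewrite e -scalerAl averageZ; apply: (SZ).
all: have := average_mon hH hA hact m n l./2.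
all: case h: (orbit_sign_at _ _ _ _) => [s|] [e1 e2]; rewrite ?e1 ?e2 //.
all: by apply: (SZ); apply: (Sm).
Qed.

End Invariants.

(* The possible shapes of the invariants.  With R0 and R1 the coefficients of the
   even and of the odd powers of T, R0 is generated by [shape_gens] and R1 is
   generated as a left R0-module by [shape_f] and possibly [shape_g]. *)
Variant shape :=
| DoubleDiff | DoubleProd
| PDiff | PSum | PDiff2
| SumP | SumPDiff | SumDiff
| DiffPSum | DiffSum.

Definition shape_table (sh : shape) (m j l : bool) : option bool :=
  match sh with
  | DoubleDiff => if l then (if j then Some (~~ m) else None)
                  else if j then None else Some m
  | DoubleProd => if j then None else Some (m (+) l)
  | PDiff => if j (+) l then None else Some l
  | PSum => if j (+) l then None else Some false
  | PDiff2 => if j then None else Some l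
  | SumP => if m (+) l then None else Some false
  | SumPDiff => if m (+) l then None else Some l
  | SumDiff => if m then None else Some l
  | DiffPSum => if m (+) l then None else Some (j (+) l)
  | DiffSum => if m then None else Some (j (+) l)
  end.

Definition shape_of (k : kashina) (p : rep2) (q : quadric) : shape :=
  match k, p, q with
  | Kashina8, Pi1, Comm => DoubleDiff
  | Kashina8, Pi1, Skew => PDiff
  | Kashina8, Pi1, SqDiff => PDiff2
  | Kashina8, Pi1, SqSum => PSum
  | Kashina8, Pi2, Comm => SumP
  | Kashina8, Pi2, Skew => SumPDiff
  | Kashina8, Pi2, SqDiff => SumDiff
  | Kashina8, Pi2, SqSum => DoubleDiff
  | Kashina9, Pi1, Comm => PDiff
  | Kashina9, Pi1, Skew => DoubleDiff
  | Kashina9, Pi1, SqDiff => DiffPSum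
  | Kashina9, Pi1, SqSum => DiffSum
  | Kashina9, Pi2, Comm => SumPDiff
  | Kashina9, Pi2, Skew => SumP
  | Kashina9, Pi2, SqDiff => SumP
  | Kashina9, Pi2, SqSum => DoubleProd
  end.

Lemma shape_table_correct k p q m j l :
  orbit_sign_at (sign_data_of k p q) m j l = shape_table (shape_of k p q) m j l.
Proof. by case: k; case: p; case: q; case: m; case: j; case: l. Qed.

(** * The coefficients R0 and R1 of the even and odd powers of T *)

Section Shape.
Variables (K : fieldType) (A : algType K) (E F P : A) (tau : K).
Hypotheses (EF : E * F = F * E) (EP : E * P = P * E) (FP : F * P = P * F).
Hypotheses (EFP : E * F = tau *: P ^+ 2) (tau2 : tau * tau = 1).

(** The name of a shape records first the generators of R0 ([P]; [Sum] or [Diff] for E + F or E - F;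
    [Double] for three generators) and then [shape_f]. *)
Definition shape_gens (sh : shape) : seq A :=
  match sh with
  | DoubleDiff | DoubleProd => [:: P ^+ 2; E ^+ 2 + F ^+ 2; P * (E ^+ 2 - F ^+ 2)]
  | PDiff | PSum | PDiff2 => [:: P; E ^+ 2 + F ^+ 2]
  | SumP | SumPDiff | SumDiff => [:: P ^+ 2; E + F]
  | DiffPSum | DiffSum => [:: P ^+ 2; E - F]
  end.

Definition shape_f (sh : shape) : A :=
  match sh with
  | DoubleDiff | PDiff | SumDiff => E - F
  | DoubleProd | SumP => P
  | PSum | DiffSum => E + F
  | PDiff2 => E ^+ 2 - F ^+ 2
  | SumPDiff => P * (E - F)
  | DiffPSum => P * (E + F)
  end.

Definition shape_g (sh : shape) : A :=
  match sh with
  | DoubleDiff => P * (E + F)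
  | DoubleProd => E ^+ 2 - F ^+ 2
  | _ => 0
  end.

(** Lets [ring] prove identities between E, F and P: commuting elements are images of the variables
    of a polynomial ring. *)
Lemma commuting_hom : exists (C : comNzRingType) (h : {rmorphism C -> A}) (e f w : C),
  [/\ h e = E, h f = F & h w = P].
Proof.
have cE : commr_rmorph (in_alg A) E.
  by move=> c; rewrite /GRing.comm /= mulr_algl mulr_algr.
pose f1 : {rmorphism {poly K} -> A} := horner_morph cE.
have f1X : f1 'X = E by apply: horner_morphX.
have f1C c : f1 c%:P = c%:A by rewrite /f1 /= horner_morphC.
have com1 w : (w * E = E * w) -> commr_rmorph f1 w.
  move=> wE r; rewrite /GRing.comm; elim/poly_ind: r => [|r c IH].
    by rewrite !raddf0 mulr0 mul0r.
  by rewrite rmorphD rmorphM /= f1X f1C mulrDr mulrDl mulrA IH -!mulrA wE mulr_algl mulr_algr.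
pose f2 : {rmorphism {poly {poly K}} -> A} := horner_morph (com1 F (esym EF)).
have f2X : f2 'X = F by apply: horner_morphX.
have f2C c : f2 c%:P = f1 c by rewrite /f2 /= horner_morphC.
have com2 : commr_rmorph f2 P.
  move=> r; rewrite /GRing.comm; elim/poly_ind: r => [|r c IH].
    by rewrite !raddf0 mulr0 mul0r.
  rewrite rmorphD rmorphM /= f2X f2C mulrDr mulrDl mulrA IH -!mulrA FP.
  by congr (_ + _); apply: (com1 P (esym EP)).
exists {poly {poly {poly K}}}, (horner_morph com2), 'X%:P%:P, 'X%:P, 'X.
have f3X : horner_morph com2 'X = P by apply: horner_morphX.
have f3C c : horner_morph com2 c%:P = f2 c by rewrite /= horner_morphC.
split.
- exact: etrans (f3C _) (etrans (f2C _) f1X).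
- exact: etrans (f3C _) f2X.
- exact: f3X.
Qed.

(* [V] is stable under multiplication by p^2 = +-EF and E^2 + F^2, and
   E^(j+4) + s F^(j+4) is a combination of the same for j+2 and j. *)
Lemma orbit_sum_ind (V : A -> Prop) (m : nat) (s e : bool) :
  V 0 -> (forall w w', V w -> V w' -> V (w + w')) -> (forall c w, V w -> V (c *: w)) ->
  (forall w, V w -> V (P ^+ 2 * w)) -> (forall w, V w -> V ((E ^+ 2 + F ^+ 2) * w)) ->
  V (P ^+ odd m * (if e then E + (-1) ^+ s *: F else if s then E ^+ 2 - F ^+ 2 else 1)) ->
  forall j, odd j = e -> V (P ^+ m * (E ^+ j + (-1) ^+ s *: F ^+ j)).
Proof.
move=> V0 VD VZ VP VEF Vb j jo.
suff H : V (P ^+ odd m * (E ^+ j + (-1) ^+ s *: F ^+ j)).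
  rewrite -(odd_double_half m) exprD -mul2n exprM.
  have -> n w : P ^+ odd m * (P ^+ 2) ^+ n * w = (P ^+ 2) ^+ n * (P ^+ odd m * w).
    by rewrite mulrA -!exprM -!exprD addnC.
  elim: (m./2) => [|n IH]; first by rewrite mul1r.
  by rewrite exprS -mulrA; apply: (VP).
have VEF1 w : V w -> V (E * F * w).
  by move=> Vw; rewrite EFP -scalerAl; apply/(VZ)/(VP).
have VB w w' : V w -> V w' -> V (w - w').
  by move=> Vw Vw'; rewrite -scaleN1r; apply: (VD) => //; apply: (VZ).
have [C [h [X1 [X2 [X3 [hE hF hP]]]]]] := commuting_hom.
move: (odd m) Vb => n Vb {m}.
have step2 : P ^+ n * (E ^+ 2 + F ^+ 2) = (E ^+ 2 + F ^+ 2) * (P ^+ n * 1).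
  rewrite -hE -hF -hP mulr1 -!(rmorphXn, rmorphM, rmorphD).
  by congr (h _); ring.
have step3 : P ^+ n * (E ^+ 3 + (-1) ^+ s *: F ^+ 3) =
    (E ^+ 2 + F ^+ 2) * (P ^+ n * (E + (-1) ^+ s *: F))
    - (-1) ^+ s *: (E * F * (P ^+ n * (E + (-1) ^+ s *: F))).
  rewrite -hE -hF -hP.
  case: (s); rewrite /= ?expr0 ?expr1 ?scale1r ?scaleN1r -!(rmorphXn, rmorphM, rmorphN, rmorphD);
    by congr (h _); ring.
have step4 i : P ^+ n * (E ^+ i.+4 + (-1) ^+ s *: F ^+ i.+4) =
    (E ^+ 2 + F ^+ 2) * (P ^+ n * (E ^+ i.+2 + (-1) ^+ s *: F ^+ i.+2))
    - E * F * (E * F * (P ^+ n * (E ^+ i + (-1) ^+ s *: F ^+ i))).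
  rewrite -hE -hF -hP -(addn4 i) -(addn2 i).
  case: (s); rewrite /= ?expr0 ?expr1 ?scale1r ?scaleN1r -!(rmorphXn, rmorphM, rmorphN, rmorphD);
    congr (h _); rewrite !exprD; move: (X1 ^+ i) (X2 ^+ i) (X3 ^+ n) => Y1 Y2 Y3; ring.
suff H i : odd i = e -> V (P ^+ n * (E ^+ i + (-1) ^+ s *: F ^+ i)) /\
    V (P ^+ n * (E ^+ i.+2 + (-1) ^+ s *: F ^+ i.+2)) by have [] := H j jo.
elim/ltn_ind: i => -[|[|[|i]]] IH.
(* With the sign - the sum for j = 0 vanishes and the first nonzero even one is E^2 - F^2; with the
   sign + the sum for j = 0 is 2, whence the base element 1. *)
- move=> e0; move: Vb; rewrite -e0 !expr0; case: (s) => Vb.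
    by rewrite !expr1 !scaleN1r subrr mulr0.
  rewrite scale1r; split; first by rewrite mulrDr; apply: (VD).
  by rewrite scale1r step2; apply: (VEF).
- move=> e1; move: Vb; rewrite -e1 /= !expr1 => Vb; split=> //.
  by rewrite step3; apply: (VB); [apply: (VEF) | apply/VZ/VEF1].
- move=> e0; have [_ V2] := IH 0%N erefl e0; split=> //.
  have [V0' _] := IH 0%N erefl e0.
  by rewrite step4; apply: (VB); [apply: (VEF) | apply/VEF1/VEF1].
- move=> e1; have [Vi Vi2] := IH i.+1 (ltnW (ltnSn _)) (etrans (esym (negbK _)) e1).
  split=> //; rewrite step4; apply: (VB); [apply: (VEF) | apply/VEF1/VEF1] => //.
Qed.

Lemma subalg_genN (s : seq A) w : subalg_gen s w -> subalg_gen s (- w).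
Proof.
by move=> sw; rewrite -mulN1r -scaleN1r; apply: subalg_gen_mul => //; apply: subalg_gen_scal.
Qed.

Lemma subalg_genZ (s : seq A) c w : subalg_gen s w -> subalg_gen s (c *: w).
Proof.
by move=> sw; rewrite -mulr_algl; apply: subalg_gen_mul => //; apply: subalg_gen_scal.
Qed.

Lemma subalg_gen0 (s : seq A) : subalg_gen s 0.
Proof. by rewrite -(scale0r 1); apply: subalg_gen_scal. Qed.

Lemma subalg_gen1 (s : seq A) : subalg_gen s 1.
Proof. by rewrite -(scale1r 1); apply: subalg_gen_scal. Qed.

Lemma subalg_genB (s : seq A) w w' :
  subalg_gen s w -> subalg_gen s w' -> subalg_gen s (w - w').
Proof. by move=> sw sw'; apply: subalg_gen_add => //; apply: subalg_genN. Qed.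

Lemma subalg_genX (s : seq A) w n : subalg_gen s w -> subalg_gen s (w ^+ n).
Proof.
move=> sw; elim: n => [|n IH]; first exact: subalg_gen1.
by rewrite exprS; apply: subalg_gen_mul.
Qed.

Lemma subalg_gen_trans (s s' : seq A) : (forall w, w \in s -> subalg_gen s' w) ->
  forall w, subalg_gen s w -> subalg_gen s' w.
Proof.
move=> ss w; elim=> {w} [w|c|w w' _ sw _ sw'|w w' _ sw _ sw'].
- exact: ss.
- exact: subalg_gen_scal.
- exact: subalg_gen_add.
- exact: subalg_gen_mul.
Qed.

Variable sh : shape.
Local Notation R0 := (subalg_gen (shape_gens sh)).

Definition R1 (w : A) : Prop :=
  exists w1 w2, [/\ R0 w1, R0 w2 & w = w1 * shape_f sh + w2 * shape_g sh].

Lemma shape_P2 : R0 (P ^+ 2).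
Proof.
case: sh; rewrite /shape_gens; try (by apply: subalg_gen_gen; rewrite !inE eqxx ?orbT);
  by apply/subalg_genX/subalg_gen_gen; rewrite !inE eqxx.
Qed.

Lemma shape_EF : R0 (E ^+ 2 + F ^+ 2).
Proof.
have RP := shape_P2.
have RS : R0 (E + F) -> R0 (E ^+ 2 + F ^+ 2).
  move=> h; have -> : E ^+ 2 + F ^+ 2 = (E + F) ^+ 2 - (2 : K) *: (tau *: P ^+ 2).
    by rewrite -EFP; transitivity (E ^+ 2 + F ^+ 2 + (F * E - E * F));
      [rewrite EF subrr addr0 | nc_ring K A].
  by apply: subalg_genB; [apply: subalg_genX | do 2! apply: subalg_genZ].
have RD : R0 (E - F) -> R0 (E ^+ 2 + F ^+ 2).
  move=> h; have -> : E ^+ 2 + F ^+ 2 = (E - F) ^+ 2 + (2 : K) *: (tau *: P ^+ 2).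
    by rewrite -EFP; transitivity (E ^+ 2 + F ^+ 2 + (E * F - F * E));
      [rewrite EF subrr addr0 | nc_ring K A].
  by apply: subalg_gen_add; [apply: subalg_genX | do 2! apply: subalg_genZ].
move: RS RD; rewrite /shape_gens; case: sh => RS RD;
  try (by apply: subalg_gen_gen; rewrite !inE eqxx ?orbT);
  try (by apply: RS; apply: subalg_gen_gen; rewrite !inE eqxx ?orbT);
  by apply: RD; apply: subalg_gen_gen; rewrite !inE eqxx ?orbT.
Qed.

(** Since P^2 and E^2 + F^2 lie in R0, only the smallest exponents remain, where the table yields 1
    or a generator. *)
Lemma shape_R0 m j s : shape_table sh (odd m) (odd j) false = Some s ->
  R0 (P ^+ m * (E ^+ j + (-1) ^+ s *: F ^+ j)).
Proof.
move=> hs; apply: (@orbit_sum_ind R0 m s (odd j)) => //.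
- exact: subalg_gen0.
- exact: subalg_gen_add.
- exact: subalg_genZ.
- by move=> w; apply/subalg_gen_mul/shape_P2.
- by move=> w; apply/subalg_gen_mul/shape_EF.
move: hs; rewrite /shape_table /shape_gens; case: sh; case: (odd m); case: (odd j) => //= -[<-];
  rewrite ?expr0 ?expr1 ?mulr1 ?mul1r ?scale1r ?scaleN1r;
  try exact: subalg_gen1; by apply: subalg_gen_gen; rewrite !inE eqxx ?orbT.
Qed.

Lemma R1_mul w w' : R0 w -> R1 w' -> R1 (w * w').
Proof.
move=> Rw [w1 [w2 [h1 h2 ->]]]; exists (w * w1), (w * w2).
by rewrite mulrDr !mulrA; split=> //; apply: subalg_gen_mul.
Qed.

(** Here the smallest exponents give f, g or a generator of R0 times f. *)
Lemma shape_R1 m j s : shape_table sh (odd m) (odd j) true = Some s ->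
  R1 (P ^+ m * (E ^+ j + (-1) ^+ s *: F ^+ j)).
Proof.
move=> hs; apply: (@orbit_sum_ind R1 m s (odd j)) => //.
- by exists 0, 0; rewrite !mul0r addr0; split=> //; apply: subalg_gen0.
- move=> w w' [w1 [w2 [h1 h2 ->]]] [w3 [w4 [h3 h4 ->]]].
  by exists (w1 + w3), (w2 + w4); rewrite !mulrDl addrACA; split=> //; apply: subalg_gen_add.
- move=> c w [w1 [w2 [h1 h2 ->]]]; exists (c *: w1), (c *: w2).
  by rewrite -!scalerAl -scalerDr; split=> //; apply: subalg_genZ.
- by move=> w; apply/R1_mul/shape_P2.
- by move=> w; apply/R1_mul/shape_EF.
have Rf w : R0 w -> R1 (w * shape_f sh).
  by move=> h; exists w, 0; rewrite mul0r addr0; split=> //; apply: subalg_gen0.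
have Rf1 := Rf 1 (subalg_gen1 _).
have Rg1 : R1 (1 * shape_g sh).
  by exists 0, 1; rewrite mul0r add0r; split=> //; [apply: subalg_gen0 | apply: subalg_gen1].
have [C [h [X1 [X2 [X3 [hE hF hP]]]]]] := commuting_hom.
have SD : E ^+ 2 - F ^+ 2 = (E + F) * (E - F).
  by rewrite -hE -hF -!(rmorphXn, rmorphM, rmorphN, rmorphD); congr (h _); ring.
have DS : E ^+ 2 - F ^+ 2 = (E - F) * (E + F).
  by rewrite -hE -hF -!(rmorphXn, rmorphM, rmorphN, rmorphD); congr (h _); ring.
have PSD : P * (E ^+ 2 - F ^+ 2) = (E + F) * (P * (E - F)).
  by rewrite -hE -hF -hP -!(rmorphXn, rmorphM, rmorphN, rmorphD); congr (h _); ring.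
have PDS : P * (E ^+ 2 - F ^+ 2) = (E - F) * (P * (E + F)).
  by rewrite -hE -hF -hP -!(rmorphXn, rmorphM, rmorphN, rmorphD); congr (h _); ring.
have PS : P * (E + F) = (E + F) * P by rewrite mulrDr mulrDl EP FP.
have gen w : w \in shape_gens sh -> R0 w by apply: subalg_gen_gen.
move: hs Rf Rf1 Rg1 gen; rewrite /shape_table /shape_f /shape_g /shape_gens.
case: sh; case: (odd m); case: (odd j) => //= -[<-] Rf Rf1 Rg1 gen;
  rewrite ?expr0 ?expr1 ?mulr1 ?mul1r ?scale1r ?scaleN1r; rewrite ?mul1r in Rf1 Rg1;
  rewrite //; try (by apply: Rf; apply: gen; rewrite !inE eqxx ?orbT);
  try (by rewrite PS; apply: Rf; apply: gen; rewrite !inE eqxx ?orbT);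
  try (by rewrite PSD; apply: Rf; apply: gen; rewrite !inE eqxx ?orbT);
  try (by rewrite PDS; apply: Rf; apply: gen; rewrite !inE eqxx ?orbT);
  try (by rewrite SD; apply: Rf; apply: gen; rewrite !inE eqxx ?orbT);
  try (by rewrite DS; apply: Rf; apply: gen; rewrite !inE eqxx ?orbT).
Qed.

End Shape.

Ltac in_gens := by apply: subalg_gen_gen; rewrite !inE eqxx ?orbT.
Ltac in_subalg :=
  repeat first [ assumption | in_gens | exact: subalg_gen0 | apply: subalg_genZ | apply: subalg_genB
   | apply: subalg_gen_add | apply: subalg_genN | apply: subalg_gen_mul | apply: subalg_genX ].

(** * Comparison with the listed generators in u, v and t *)

Section Generators.
Variables (K : fieldType) (im : K).
Hypotheses (im2 : im ^+ 2 = -1) (two : (2 : K) != 0).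
Variables (A : algType K) (q : quadric) (u v t : A).
Hypothesis rel0 : quadric_rel q u v = 0.

Local Notation a := (diagA im q u v).
Local Notation b := (diagB im q u v).
Local Notation tau := (diag_sign K q).
Local Notation E := (a ^+ 2).
Local Notation F := (b ^+ 2).
Local Notation P := (a * b).
Local Notation T := (t ^+ 2).
Hypotheses (EF : E * F = F * E) (EP : E * P = P * E) (FP : F * P = P * F)
  (EFP : E * F = tau *: P ^+ 2).

Definition all_gens (sh : shape) : seq A :=
  shape_gens E F P sh ++
  [:: shape_f E F P sh * T; shape_g E F P sh * T; T ^+ 2].

Let ii : im * im = -1. Proof. by rewrite -expr2. Qed.

Let four : (4 : K) != 0.
Proof. by rewrite (_ : 4 = 2 * 2) ?mulf_neq0 //; ring. Qed.

(* Meaningful only for the relations u^2 = +-v^2. *)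
Definition sum_coef : K := if q is SqDiff then 2^-1 else - im / 2.
Definition diff_coef : K := if q is SqDiff then -1 else im.

(** Writing a = u + c v and b = u - c v with c = 1 or c = im, one finds E + F = 4 u^2, E - F = 2 c
    (u v + v u) and P = - c (u v - v u), which is the origin of the constants. *)
Lemma square_uv : (q = SqDiff \/ q = SqSum) ->
  [/\ u ^+ 2 = 4^-1 *: (E + F), u * v + v * u = sum_coef *: (E - F)
    & u * v - v * u = diff_coef *: P].
Proof.
move: rel0; rewrite /sum_coef /diff_coef => r0 [] qE; move: r0; rewrite qE /= => r0.
- split.
  + transitivity (u ^+ 2 - (2^-1 : K) *: (u ^+ 2 - v ^+ 2)).
      by rewrite r0 scaler0 subr0.
    by nc_prep K A; repeat split; field; rewrite ?two ?four.
  + by nc_prep K A; repeat split; field; rewrite ?two ?four.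
  + transitivity (u * v - v * u - (u ^+ 2 - v ^+ 2)); first by rewrite r0 subr0.
    by nc_ring K A.
- have h := ii; split.
  + transitivity (u ^+ 2 - (2^-1 : K) *: (u ^+ 2 + v ^+ 2)).
      by rewrite r0 scaler0 subr0.
    by nc_prep K A; repeat split; field: h; rewrite ?two ?four.
  + by nc_prep K A; repeat split; field: h; rewrite ?two ?four.
  + transitivity (u * v - v * u + im *: (u ^+ 2 + v ^+ 2)); first by rewrite r0 scaler0 addr0.
    by nc_prep K A; repeat split; ring: h.
Qed.

Let Sq := q = SqDiff \/ q = SqSum.

Let tauN : Sq -> tau = -1. Proof. by rewrite /diag_sign => -[] ->. Qed.

Let sum_neq0 : sum_coef != 0.
Proof.
rewrite /sum_coef; case: q; rewrite ?invr_eq0 ?mulf_neq0 ?oppr_eq0 ?invr_eq0 //;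
  by apply/eqP => i0; have /eqP := ii; rewrite i0 mul0r eq_sym oppr_eq0 oner_eq0.
Qed.

Let diff_neq0 : diff_coef != 0.
Proof.
rewrite /diff_coef; case: q; rewrite ?oppr_eq0 ?oner_eq0 //;
  by apply/eqP => i0; have /eqP := ii; rewrite i0 mul0r eq_sym oppr_eq0 oner_eq0.
Qed.

Let coefs : Sq -> sum_coef * sum_coef = 4^-1 * (diff_coef * diff_coef).
Proof.
have h := ii; rewrite /sum_coef /diff_coef => -[] ->; first by field; rewrite ?two ?four.
by field: h; rewrite ?two ?four.
Qed.

Let diff1 : Sq -> diff_coef * diff_coef * (diff_coef * diff_coef) = 1.
Proof. by have h := ii; rewrite /diff_coef => -[] ->; ring: h. Qed.

Let EFN : Sq -> E * F = - P ^+ 2.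
Proof. by move=> /tauN tN; rewrite EFP tN scaleN1r. Qed.

Local Notation X := ((u * v) ^+ 2 + (v * u) ^+ 2).
Local Notation Y := ((u * v) ^+ 2 - (v * u) ^+ 2).

Let sumsq (e f : A) : e * f = f * e -> (e + f) ^+ 2 = e ^+ 2 + f ^+ 2 + (2 : K) *: (e * f).
Proof.
move=> ef; transitivity (e ^+ 2 + f ^+ 2 + (e * f + f * e)); first by nc_ring K A.
by rewrite -ef; nc_ring K A.
Qed.

Let diffsq (e f : A) : e * f = f * e -> (e - f) ^+ 2 = e ^+ 2 + f ^+ 2 - (2 : K) *: (e * f).
Proof.
move=> ef; transitivity (e ^+ 2 + f ^+ 2 - (e * f + f * e)); first by nc_ring K A.
by rewrite -ef; nc_ring K A.
Qed.

Let u4E : Sq -> u ^+ 4 = 16^-1 *: (E ^+ 2 + F ^+ 2 - (2 : K) *: P ^+ 2).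
Proof.
move=> sq; have [uE _ _] := square_uv sq.
have -> : u ^+ 4 = (u ^+ 2) ^+ 2 by nc_ring K A.
rewrite uE exprZn (sumsq EF) (EFN sq) scalerN; congr (_ *: _).
by field; rewrite ?two ?four (_ : 16 = 4 * 4) ?mulf_neq0 //; ring.
Qed.

Local Notation dd := (diff_coef * diff_coef).

Let XE : Sq -> X = (dd * 8^-1) *: (E ^+ 2 + F ^+ 2 + (6 : K) *: P ^+ 2).
Proof.
move=> sq; have [_ sm df] := square_uv sq.
have -> : X = (2^-1 : K) *: ((u * v + v * u) ^+ 2 + (u * v - v * u) ^+ 2).
  by nc_prep K A; repeat split; field; rewrite ?two.
rewrite sm df !exprZn (diffsq EF) (EFN sq) !expr2 (coefs sq).
have eight : (8 : K) != 0 by rewrite (_ : 8 = 2 * 4) ?mulf_neq0 //; ring.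
move: (E * E) (F * F) (P * P) => e f w.
by nc_prep K A; repeat split; field; rewrite ?two ?four ?eight.
Qed.

(** As dd^2 = 1, eliminating E^2 + F^2 between [XE] and [u4E] gives 8 dd X - 16 u^4 = 8 P^2. *)
Let P2E : Sq -> P ^+ 2 = dd *: X - (2 : K) *: u ^+ 4.
Proof.
move=> sq; rewrite (XE sq) (u4E sq); have h := diff1 sq.
have eight : (8 : K) != 0 by rewrite (_ : 8 = 2 * 4) ?mulf_neq0 //; ring.
have sixteen : (16 : K) != 0 by rewrite (_ : 16 = 4 * 4) ?mulf_neq0 //; ring.
move: (E ^+ 2) (F ^+ 2) (P ^+ 2) => e f w; rewrite scalerA mulrA h mul1r.
by nc_prep K A; repeat split; field; rewrite ?two ?four ?eight ?sixteen.
Qed.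

Let EF2E : Sq -> E ^+ 2 + F ^+ 2 = (16 : K) *: u ^+ 4 + (2 : K) *: P ^+ 2.
Proof.
have sixteen : (16 : K) != 0 by rewrite (_ : 16 = 4 * 4) ?mulf_neq0 //; ring.
by move=> sq; rewrite (u4E sq) scalerA divff // scale1r subrK.
Qed.

Let P2E' : Sq -> P ^+ 2 = 4^-1 *: ((E - F) ^+ 2 - (16 : K) *: u ^+ 4).
Proof.
have sixteen : (16 : K) != 0 by rewrite (_ : 16 = 4 * 4) ?mulf_neq0 //; ring.
move=> sq; rewrite (u4E sq) scalerA divff // scale1r (diffsq EF) (EFN sq).
move: (E ^+ 2) (F ^+ 2) (P ^+ 2) => e f w.
by nc_prep K A; repeat split; field; rewrite ?two ?four.
Qed.

Let PE : Sq -> P = diff_coef^-1 *: (u * v - v * u).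
Proof. by move=> sq; have [_ _ ->] := square_uv sq; rewrite scalerA mulVf ?scale1r. Qed.

Let DE : Sq -> E - F = sum_coef^-1 *: (u * v + v * u).
Proof. by move=> sq; have [_ -> _] := square_uv sq; rewrite scalerA mulVf ?scale1r. Qed.

Let SE : Sq -> E + F = (4 : K) *: u ^+ 2.
Proof. by move=> sq; have [-> _ _] := square_uv sq; rewrite scalerA divff ?scale1r. Qed.

Let SDE : E ^+ 2 - F ^+ 2 = (E + F) * (E - F).
Proof.
have [C [h [X1 [X2 [X3 [hE hF hP]]]]]] := commuting_hom EF EP FP.
by rewrite -hE -hF -!(rmorphXn, rmorphM, rmorphN, rmorphD); congr (h _); ring.
Qed.

Let PSE : P * (E + F) = (E + F) * P. Proof. by rewrite mulrDr mulrDl EP FP. Qed.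
Let PDE : P * (E - F) = (E - F) * P. Proof. by rewrite mulrBr mulrBl EP FP. Qed.

Let YE : Sq -> Y = (sum_coef * diff_coef) *: (P * (E - F)).
Proof.
move=> sq; have [_ sm df] := square_uv sq.
have -> : Y = (2^-1 : K) *: ((u * v + v * u) * (u * v - v * u) +
                             (u * v - v * u) * (u * v + v * u)).
  by nc_prep K A; repeat split; field; rewrite ?two.
rewrite sm df.
have -> : sum_coef *: (E - F) * (diff_coef *: P) = (sum_coef * diff_coef) *: ((E - F) * P).
  by rewrite -scalerAl -scalerAr scalerA.
rewrite -PDE; have -> : diff_coef *: P * (sum_coef *: (E - F)) =
    (sum_coef * diff_coef) *: (P * (E - F)).
  by rewrite -scalerAl -scalerAr scalerA mulrC.
by rewrite -mulr2n -scaler_nat !scalerA mulVf ?mul1r.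
Qed.

Let PSDE : Sq -> P * (E ^+ 2 - F ^+ 2) =
  (4 * (sum_coef * diff_coef)^-1) *: (u ^+ 2 * Y).
Proof.
move=> sq; have [uE _ _] := square_uv sq.
rewrite (YE sq) uE SDE mulrA PSE -mulrA -scalerAl -scalerAr !scalerA.
rewrite [X in X *: _](_ : _ = 1) ?scale1r //.
by field; rewrite ?four sum_neq0 diff_neq0.
Qed.

Let SDT : Sq -> (E ^+ 2 - F ^+ 2) * T =
  (4 * sum_coef^-1) *: (u ^+ 2 * (u * v + v * u) * T).
Proof. by move=> sq; rewrite SDE (SE sq) (DE sq) -!(scalerAl, scalerAr) scalerA. Qed.

Let PST : Sq -> P * (E + F) * T = (4 * diff_coef^-1) *: (u ^+ 2 * (u * v - v * u) * T).
Proof. by move=> sq; rewrite PSE (SE sq) (PE sq) -!(scalerAl, scalerAr) scalerA. Qed.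

Let DT : Sq -> (E - F) * T = sum_coef^-1 *: ((u * v + v * u) * T).
Proof. by move=> sq; rewrite (DE sq) -scalerAl. Qed.

Let PT : Sq -> P * T = diff_coef^-1 *: ((u * v - v * u) * T).
Proof. by move=> sq; rewrite (PE sq) -scalerAl. Qed.

Let ST : Sq -> (E + F) * T = (4 : K) *: (u ^+ 2 * T).
Proof. by move=> sq; rewrite (SE sq) -scalerAl. Qed.

Ltac each_gen :=
  let w := fresh "w" in move=> w; rewrite !inE; do ?[case/orP]; move=> /eqP ->.

Let T2 : T ^+ 2 = t ^+ 4. Proof. by nc_ring K A. Qed.

Let u4 : u ^+ 4 = u ^+ 2 * u ^+ 2. Proof. by nc_ring K A. Qed.

Let P2C : P ^+ 2 = tau *: (E * F).
Proof.
by rewrite EFP scalerA /diag_sign; case: q; rewrite ?mulrNN mulr1 scale1r.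
Qed.

Let pow4 (w : A) : (w ^+ 2) ^+ 2 = w ^+ 4. Proof. by nc_ring K A. Qed.

Section Forward.
Variables (k : kashina) (p : rep2).

Lemma all_gens_sub w : w \in all_gens (shape_of k p q) ->
  subalg_gen (inv_gens k p q u v t) w.
Proof.
have [cm|sq] : (q = Comm \/ q = Skew) \/ Sq.
  by rewrite /Sq; case: q; [left; left | left; right | right; left | right; right].
  have SP2 : subalg_gen (inv_gens k p q u v t) (P ^+ 2).
    move: P2C; case: cm => ->; case: k; case: p; rewrite /inv_gens /= => p2c;
      first [solve [in_subalg] | solve [rewrite p2c; in_subalg]].
  move: SP2; rewrite /all_gens.
  case: cm => ->; case: k; case: p; rewrite /inv_gens /shape_of /shape_gens /shape_f /shape_g /cat /=;
    move=> SP2; move: w; each_gen;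
    rewrite ?mul0r ?T2 ?pow4; solve [assumption | in_subalg].
move: (PE sq) (DE sq) (SE sq) (P2E sq) (P2E' sq) (EF2E sq) (PSDE sq).
move: (SDT sq) (PST sq) (DT sq) (PT sq) (ST sq).
move=> hSDT hPST hDT hPT hST hPE hDE hSE hP2 hP2' hEF hPSD.
(* P^2 is treated first because E^2 + F^2 is recovered from u^4 with its help. *)
have SP2 : subalg_gen (inv_gens k p q u v t) (P ^+ 2).
  have [qE|qE] := sq; rewrite [in inv_gens _ _ q]qE; case: k; case: p; rewrite /inv_gens;
    first [ solve [rewrite hPE; in_subalg] | solve [rewrite hP2; in_subalg]
      | solve [rewrite hP2 u4; in_subalg] | solve [rewrite hP2' hDE; in_subalg] ].
move: SP2; rewrite /all_gens.
have [qE|qE] := sq; rewrite [in inv_gens _ _ q]qE [in shape_of _ _ q]qE;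
  case: k; case: p;
  rewrite /inv_gens /shape_of /shape_gens /shape_f /shape_g /cat => SP2; move: w; each_gen;
  rewrite ?mul0r ?T2; first [ assumption | solve [in_gens] | solve [rewrite hPSD; in_subalg]
    | solve [rewrite (hSDT, hPST, hDT, hPT, hST); in_subalg] | solve [rewrite hEF; in_subalg]
    | solve [rewrite hDE; in_subalg] | solve [rewrite hSE; in_subalg]
    | solve [rewrite hPE; in_subalg] | solve [in_subalg] ].
Qed.

Let tau2 : tau * tau = 1.
Proof. by rewrite /diag_sign; case: q; rewrite ?mulrNN mulr1. Qed.

Lemma inv_gens_sub w : w \in inv_gens k p q u v t ->
  subalg_gen (all_gens (shape_of k p q)) w.
Proof.
have sub w' : subalg_gen (shape_gens E F P (shape_of k p q)) w' ->
    subalg_gen (all_gens (shape_of k p q)) w'.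
  apply: subalg_gen_trans => w'' hw; apply: subalg_gen_gen.
  by rewrite /all_gens mem_cat hw.
have RP2 := sub _ (shape_P2 E F P (shape_of k p q)).
have REF := sub _ (shape_EF EF EFP (shape_of k p q)).
move: RP2 REF; rewrite /all_gens {sub}.
have [cm|sq] : (q = Comm \/ q = Skew) \/ Sq.
  by rewrite /Sq; case: q; [left; left | left; right | right; left | right; right].
  move: EFP; case: cm => ->; case: k; case: p;
    rewrite /inv_gens /shape_of /shape_gens /shape_f /shape_g /cat /= ?pow4;
    move=> hEFP RP2 REF; move: w; each_gen; rewrite -?T2;
    first [ solve [in_subalg] | solve [rewrite hEFP; in_subalg]].
have [uE sm df] := square_uv sq.
have u2sT : u ^+ 2 * (u * v + v * u) * T = (4^-1 * sum_coef) *: ((E ^+ 2 - F ^+ 2) * T).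
  by rewrite uE sm SDE -!(scalerAl, scalerAr) scalerA.
have u2dT : u ^+ 2 * (u * v - v * u) * T = (4^-1 * diff_coef) *: (P * (E + F) * T).
  by rewrite uE df PSE -!(scalerAl, scalerAr) scalerA.
have u2T : u ^+ 2 * T = 4^-1 *: ((E + F) * T) by rewrite uE -scalerAl.
have sT : (u * v + v * u) * T = sum_coef *: ((E - F) * T) by rewrite sm -scalerAl.
have dT : (u * v - v * u) * T = diff_coef *: (P * T) by rewrite df -scalerAl.
have u2Y : u ^+ 2 * Y = (4^-1 * (sum_coef * diff_coef)) *: (P * (E ^+ 2 - F ^+ 2)).
  rewrite uE (YE sq) SDE (mulrA P) PSE -(mulrA _ P).
  by rewrite -scalerAl -scalerAr scalerA.
have hu4 := u4E sq; have hX := XE sq.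
have [qE|qE] := sq; rewrite [in inv_gens _ _ q]qE [in shape_of _ _ q]qE;
  case: k; case: p;
  rewrite /inv_gens /shape_of /shape_gens /shape_f /shape_g /cat => RP2 REF;
  move: w; each_gen; rewrite -?T2; rewrite ?hu4 ?hX ?u2sT ?u2dT ?u2T ?sT ?dT ?u2Y;
  first [ solve [in_subalg] | solve [rewrite sm; in_subalg]
    | solve [rewrite df; in_subalg] | solve [rewrite uE; in_subalg] ].
Qed.

End Forward.

End Generators.

(** * The ring of invariants *)

Section InvariantRing.
Variables (R : realType) (k : kashina) (H : hopfAlg R[i]) (x y z : H).
Hypothesis hH : is_kashina k x y z.
Variables (p : rep2) (q : quadric) (alpha : R[i]).
Variables (sx sz : bool) (A : cgAlg R[i]) (u v t : A).
Hypothesis hA : quadric_Ore q alpha u v t.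
Variable rho : hopfAction H A.
Hypothesis hact : acts_as k p sx sz x y z u v t rho.

Local Notation K := (R[i]).
Local Notation a := (diagA 'i%C q u v).
Local Notation b := (diagB 'i%C q u v).
Local Notation E := (a ^+ 2).
Local Notation F := (b ^+ 2).
Local Notation P := (a * b).
Local Notation T := (t ^+ 2).
Local Notation sh := (shape_of k p q).
Local Notation R0 := (subalg_gen (shape_gens E F P sh)).
Local Notation f := (shape_f E F P sh).
Local Notation g := (shape_g E F P sh).

Lemma orbit_sum_shape s m j l : shape_table sh (odd m) (odd j) (odd l) = Some s ->
  act_invariant rho (P ^+ m * (E ^+ j + (-1) ^+ s *: F ^+ j) * T ^+ l).
Proof.
by rewrite -shape_table_correct => hs; apply: (orbit_sum_invariant hH hA hact).
Qed.

Let SD : E ^+ 2 - F ^+ 2 = (E + F) * (E - F).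
Proof. by rewrite mulrDl !mulrBr (comm_EF hA) addrA subrK -!expr2. Qed.

Lemma all_gens_invariant w : w \in all_gens 'i%C q u v t sh -> act_invariant rho w.
Proof.
have two := @complex_two R.
have inv0 : act_invariant rho 0 by move=> h; rewrite act_zero scaler0.
(* For j = 0 and the sign + the orbit sum is 2 P^m T^l. *)
have half w' : act_invariant rho (w' + w') -> act_invariant rho w'.
  move=> hw; have -> : w' = (2^-1 : K) *: (w' + w').
    by nc_prep constr:(K) A; repeat split; field.
  exact: act_invariantZ.
have hm m l : shape_table sh (odd m) false (odd l) = Some false ->
    act_invariant rho (P ^+ m * T ^+ l).
  move=> e; apply: half; rewrite -mulrDl.
  by have := @orbit_sum_shape false m 0 l e; rewrite !expr0 scale1r mulrDr mulr1.
have P2 : act_invariant rho (P ^+ 2).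
  by have := hm 2%N 0%N; rewrite expr0 mulr1; apply; case: sh.
have D : act_invariant rho (T ^+ 2).
  by have := hm 0%N 2%N; rewrite expr0 mul1r; apply; case: sh.
move: hm (@orbit_sum_shape) D P2; rewrite /all_gens /shape_gens /shape_f /shape_g.
case: sh => hm os D P2; rewrite /cat !inE; do ?[case/orP]; move=> /eqP ->; rewrite ?mul0r //;
 try (by have := os false 0%N 2%N 0%N; rewrite ?expr0 ?expr1 ?scale1r ?mulr1 ?mul1r; apply);
 try (by have := os false 0%N 1%N 0%N; rewrite ?expr0 ?expr1 ?scale1r ?mulr1 ?mul1r; apply);
 try (by have := os true 0%N 1%N 0%N; rewrite ?expr0 ?expr1 ?scaleN1r ?mulr1 ?mul1r; apply);
 try (by have := os true 1%N 2%N 0%N; rewrite ?expr0 ?expr1 ?scaleN1r ?mulr1 ?mul1r; apply);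
 try (by have := os true 1%N 1%N 1%N; rewrite ?expr0 ?expr1 ?scaleN1r ?mulr1 ?mul1r; apply);
 try (by have := os false 1%N 1%N 1%N; rewrite ?expr0 ?expr1 ?scale1r ?mulr1 ?mul1r; apply);
 try (by have := os true 0%N 1%N 1%N; rewrite ?expr0 ?expr1 ?scaleN1r ?mulr1 ?mul1r; apply);
 try (by have := os false 0%N 1%N 1%N; rewrite ?expr0 ?expr1 ?scale1r ?mulr1 ?mul1r; apply);
 try (by have := os true 0%N 2%N 1%N; rewrite ?expr0 ?expr1 ?scaleN1r ?mulr1 ?mul1r; apply);
 try (by have := hm 1%N 1%N; rewrite ?expr1; apply);
 try (by have := hm 1%N 0%N; rewrite ?expr1 ?expr0 ?mulr1; apply).
Qed.

Lemma R0_invariant w : R0 w -> act_invariant rho w.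
Proof.
apply: subalg_gen_invariant => w' hw; apply: all_gens_invariant.
by rewrite /all_gens mem_cat hw.
Qed.

(** Orbit sums with l = 0 lie in R0 and those with l = 1 in R1 T. From the remaining ones T^2 can be
    split off on the right, because the sign depends only on the parity of l. *)
Lemma invariant_decomp w : act_invariant rho w -> exists r0 r1 r2 r3,
  [/\ R0 r0, act_invariant rho r1, act_invariant rho r2, act_invariant rho r3
    & w = r0 + r1 * T ^+ 2 + r2 * (f * T) + r3 * (g * T)].
Proof.
have i0 : act_invariant rho 0 by move=> h; rewrite act_zero scaler0.
move: w; apply: (invariant_ind hH hA hact) => [|w w'|c w|s m j [|[|l]]].
- exists 0, 0, 0, 0; rewrite !mul0r !addr0; split=> //; exact: subalg_gen0.
- move=> [r0 [r1 [r2 [r3 [h0 h1 h2 h3 ->]]]]] [s0 [s1 [s2 [s3 [g0 g1 g2 g3 ->]]]]].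
  exists (r0 + s0), (r1 + s1), (r2 + s2), (r3 + s3); split; try exact: act_invariantD.
    exact: subalg_gen_add.
  by move: (f * T) (g * T) (T ^+ 2) => X Y Z; nc_ring constr:(K) A.
- move=> [r0 [r1 [r2 [r3 [h0 h1 h2 h3 ->]]]]].
  exists (c *: r0), (c *: r1), (c *: r2), (c *: r3); split; try exact: act_invariantZ.
    exact: subalg_genZ.
  by move: (f * T) (g * T) (T ^+ 2) => X Y Z; nc_ring constr:(K) A.
- rewrite shape_table_correct => hs.
  exists (orbit_sum q u v t s m j 0), 0, 0, 0; rewrite !mul0r !addr0; split=> //.
  rewrite /orbit_sum expr0 mulr1.
  exact: (shape_R0 (comm_EF hA) (comm_EP hA) (comm_FP hA) (mul_EF hA) hs).
- rewrite shape_table_correct => hs.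
  have [w1 [w2 [h1 h2 e]]] :=
    shape_R1 (comm_EF hA) (comm_EP hA) (comm_FP hA) (mul_EF hA) hs.
  exists 0, 0, w1, w2; split; rewrite ?mul0r ?add0r //; try exact: R0_invariant.
    exact: subalg_gen0.
  by rewrite /orbit_sum expr1 e mulrDl !mulrA.
- move=> hs; exists 0, (orbit_sum q u v t s m j l), 0, 0; split=> //.
  + exact: subalg_gen0.
  + by apply: (orbit_sum_invariant hH hA hact); move: hs; rewrite /= negbK.
  + by rewrite !mul0r !addr0 add0r /orbit_sum -(mulrA _ (T ^+ l)) -exprD addn2.
Qed.

Lemma invariant_all_gens w : act_invariant rho w ->
  subalg_gen (all_gens 'i%C q u v t sh) w.
Proof.
have sub w' : R0 w' -> subalg_gen (all_gens 'i%C q u v t sh) w'.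
  apply: subalg_gen_trans => w'' hw; apply: subalg_gen_gen.
  by rewrite /all_gens mem_cat hw.
have fT : subalg_gen (all_gens 'i%C q u v t sh) (f * T).
  by apply: subalg_gen_gen; rewrite /all_gens mem_cat !inE eqxx ?orbT.
have gT : subalg_gen (all_gens 'i%C q u v t sh) (g * T).
  by apply: subalg_gen_gen; rewrite /all_gens mem_cat !inE eqxx ?orbT.
have D : subalg_gen (all_gens 'i%C q u v t sh) (T ^+ 2).
  by apply: subalg_gen_gen; rewrite /all_gens mem_cat !inE eqxx ?orbT.
move: w; apply: (invariant_ind hH hA hact) => [|w w'|c w|s m j l].
- exact: subalg_gen0.
- exact: subalg_gen_add.
- exact: subalg_genZ.
rewrite shape_table_correct => hs.
have -> : orbit_sum q u v t s m j l =
    P ^+ m * (E ^+ j + (-1) ^+ s *: F ^+ j) * T ^+ odd l * (T ^+ 2) ^+ l./2.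
  by rewrite /orbit_sum -(exprM T) -(mulrA _ (T ^+ odd l)) -exprD mul2n odd_double_half.
apply: subalg_gen_mul; last exact: subalg_genX.
case: (odd l) hs => hs; last first.
  rewrite expr0 mulr1; apply: sub.
  exact: (shape_R0 (comm_EF hA) (comm_EP hA) (comm_FP hA) (mul_EF hA) hs).
have [w1 [w2 [h1 h2 ->]]] :=
  shape_R1 (comm_EF hA) (comm_EP hA) (comm_FP hA) (mul_EF hA) hs.
rewrite expr1 mulrDl -!mulrA; apply: subalg_gen_add;
  by apply: subalg_gen_mul => //; apply: sub.
Qed.

Lemma invariant_ring w :
  act_invariant rho w <-> subalg_gen (inv_gens k p q u v t) w.
Proof.
have [rel0 _ _] := quadric_Ore_rel hA.
have im2 : ('i%C : K) ^+ 2 = -1 by rewrite sqr_i.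
have two := @complex_two R.
split=> [/invariant_all_gens|].
  apply: subalg_gen_trans => w'.
  exact: (all_gens_sub im2 two rel0 (comm_EF hA) (comm_EP hA) (comm_FP hA) (mul_EF hA)).
apply: subalg_gen_invariant => w' hw'.
apply: (subalg_gen_invariant (@all_gens_invariant)).
exact: (inv_gens_sub im2 two rel0 (comm_EF hA) (comm_EP hA) (comm_FP hA) (mul_EF hA) hw').
Qed.

End InvariantRing.

(** * Inner faithfulness *)

Section Independence.
Variables (K : fieldType) (im : K).
Hypotheses (im2 : im ^+ 2 = -1) (two : (2 : K) != 0).
Variables (q : quadric) (alpha : K) (A : cgAlg K) (u v t : A).
Hypothesis hA : quadric_Ore q alpha u v t.

Lemma quadric_Ore_eval (C : algType K) (c d : C) : quadric_rel q c d = 0 ->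
  exists f : {rmorphism A -> C},
    [/\ f u = c, f v = d & forall e b, f (e *: b) = e *: f b].
Proof.
move=> cd0.
have cC : central_morph (in_alg C : {rmorphism K -> C}).
  by move=> e w; rewrite /= mulr_algl mulr_algr.
have [||f [fu fv _ fZ]] := quadric_Ore_univ hA (e := 0) cC cd0; rewrite ?mulr0 ?mul0r //.
by exists f; split=> // e b; rewrite fZ /= mulr_algl.
Qed.

Let ii : im * im = -1. Proof. by rewrite -expr2. Qed.

Let eq0P (c1 c2 d1 d2 e f : K) : c1 * e + d1 * f = 0 -> c2 * e + d2 * f = 0 ->
  c1 * d2 - c2 * d1 != 0 -> e = 0 /\ f = 0.
Proof.
move=> h1 h2 n0; split; apply: (mulfI n0); rewrite mulr0.
  transitivity (d2 * (c1 * e + d1 * f) - d1 * (c2 * e + d2 * f)); first by ring.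
  by rewrite h1 h2 !mulr0 subrr.
transitivity (c1 * (c2 * e + d2 * f) - c2 * (c1 * e + d1 * f)); first by ring.
by rewrite h1 h2 !mulr0 subrr.
Qed.

Let im0 : im != 0.
Proof. by apply/eqP => i0; have /eqP := ii; rewrite i0 mul0r eq_sym oppr_eq0 oner_eq0. Qed.

(** Evaluation at the characters of A that kill t: each point (c, d) of the quadric gives a linear
    equation for the coefficients, and two suitable evaluations are enough by Cramer's rule. *)
Let scal (c d : K) : quadric_rel q c d = 0 -> forall e f : K,
  (e *: u + f *: v = 0 -> c * e + d * f = 0) /\
  (e *: (u ^+ 3 * v) + f *: (v ^+ 3 * u) = 0 ->
     c ^+ 3 * d * e + d ^+ 3 * c * f = 0).
Proof.
move=> cd0 e f; have [h [hu hv hZ]] := @quadric_Ore_eval K^o c d cd0.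
split=> /(congr1 h); rewrite rmorphD !hZ ?rmorphM ?rmorphXn /= hu hv rmorph0 => <-.
  by rewrite (mulrC c) (mulrC d).
by rewrite !(mulrC _ e) !(mulrC _ f).
Qed.

Lemma indep_uv e f : e *: u + f *: v = 0 -> e = 0 /\ f = 0.
Proof.
move: scal; case: q => sc h.
- by apply: (eq0P (proj1 (sc 1 0 _ e f) h) (proj1 (sc 0 1 _ e f) h));
    rewrite /= ?mulr0 ?mul0r ?subrr // mulr1 subr0 oner_eq0.
- by apply: (eq0P (proj1 (sc 1 0 _ e f) h) (proj1 (sc 0 1 _ e f) h));
    rewrite /= ?mulr0 ?mul0r ?addr0 // mulr1 subr0 oner_eq0.
- apply: (eq0P (proj1 (sc 1 1 _ e f) h) (proj1 (sc 1 (-1) _ e f) h)).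
  + by rewrite /= subrr.
  + by rewrite /= sqrrN subrr.
  + by rewrite (_ : _ - _ = - 2) ?oppr_eq0 //; ring.
- apply: (eq0P (proj1 (sc 1 im _ e f) h) (proj1 (sc 1 (- im) _ e f) h)).
  + by rewrite /= im2 expr1n subrr.
  + by rewrite /= sqrrN im2 expr1n subrr.
  + by rewrite (_ : _ - _ = - (2 * im)) ?oppr_eq0 ?mulf_neq0 //; ring.
Qed.

(** [D] and [J] anticommute and have square 1. They supply representations where characters fail:
    for u v = -v u every character kills u v, and for u^2 = +-v^2 all characters give proportional
    equations for u^3 v and v^3 u. *)
Let D : 'M[K]_2 := \matrix_(i, j) if i == j then (-1) ^+ i else 0.
Let J : 'M[K]_2 := \matrix_(i, j) if i == j then 0 else 1.

Let DD : D ^+ 2 = 1.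
Proof.
by apply: mx2P; rewrite expr2 ?(mxE, big_ord_recl, big_ord0) /=
  ?(mxE, big_ord_recl, big_ord0) /=; ring.
Qed.

Let JJ : J ^+ 2 = 1.
Proof.
by apply: mx2P; rewrite expr2 ?(mxE, big_ord_recl, big_ord0) /=
  ?(mxE, big_ord_recl, big_ord0) /=; ring.
Qed.

Let JD : J * D = - (D * J).
Proof.
by apply: mx2P; rewrite ?(mxE, big_ord_recl, big_ord0) /=
  ?(mxE, big_ord_recl, big_ord0) /=; ring.
Qed.

Let twist (c d : K) : quadric_rel q (c *: D) (d *: J) = 0 -> forall e f : K,
  e *: (u ^+ 3 * v) + f *: (v ^+ 3 * u) = 0 -> c ^+ 3 * d * e + - (d ^+ 3 * c) * f = 0.
Proof.
move=> cd0 e f; have [h [hu hv hZ]] := quadric_Ore_eval cd0.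
move=> /(congr1 h); rewrite rmorphD !hZ rmorphM rmorphXn (rmorphM h (v ^+ 3)) rmorphXn hu hv rmorph0.
rewrite !exprZn !exprS !expr0 !mulr1 -!expr2 DD JJ !mulr1.
rewrite -!scalerAl -!scalerAr JD !scalerA scalerN -scaleNr -scalerDl.
move=> /matrixP/(_ ord0 ord_max).
rewrite ?(mxE, big_ord_recl, big_ord0) /= ?(mxE, big_ord_recl, big_ord0) /=.
by move=> h0; rewrite -[RHS]h0; ring.
Qed.

(** Degree 4 because y must fix the vectors and all four relations must keep them independent: in
    degree 2 one relation or another makes u v, v u or u^2, v^2 dependent. *)
Lemma indep_u3v e f : e *: (u ^+ 3 * v) + f *: (v ^+ 3 * u) = 0 -> e = 0 /\ f = 0.
Proof.
have i3 : im ^+ 3 = - im by rewrite exprS im2 mulrN1.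
have JD0 : D * J + J * D = 0 by rewrite JD subrr.
have n0 : 2 * im != 0 by rewrite mulf_neq0.
move: scal twist; case: q => sc tw h.
- apply: (eq0P (proj2 (sc 1 1 _ e f) h) (proj2 (sc im 1 _ e f) h)).
  + by rewrite /= subrr.
  + by rewrite /= mulrC subrr.
  + by rewrite i3 (_ : _ - _ = 2 * im) //; ring.
- apply: (eq0P (tw 1 1 _ e f h) (tw im 1 _ e f h)).
  + by rewrite !scale1r.
  + by rewrite /= scale1r -scalerAl -scalerAr -scalerDr JD0 scaler0.
  + by rewrite i3 (_ : _ - _ = - (2 * im)) ?oppr_eq0 //; ring.
- apply: (eq0P (proj2 (sc 1 1 _ e f) h) (tw 1 1 _ e f h)).
  + by rewrite /= subrr.
  + by rewrite !scale1r /= DD JJ subrr.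
  + by rewrite (_ : _ - _ = - 2) ?oppr_eq0 //; ring.
- apply: (eq0P (proj2 (sc 1 im _ e f) h) (tw 1 im _ e f h)).
  + by rewrite /= im2 expr1n subrr.
  + by rewrite scale1r /= exprZn DD JJ im2 scaleN1r subrr.
  + by rewrite i3 (_ : _ - _ = 2 * (im * im)) ?mulf_neq0 //; ring.
Qed.

Lemma mul_power_t_eq0 w n : w * t ^+ n = 0 -> w = 0.
Proof.
elim: n => [|n IH]; first by rewrite expr0 mulr1.
by rewrite exprSr mulrA => /(quadric_Ore_regular hA).
Qed.

End Independence.

(** A polynomial of degree at most 3 that vanishes at the four distinct points c e^n is 0; the
    combinations in the proof are those of the inverse discrete Fourier transform. *)
Lemma fourier4 (K : fieldType) (e c s0 s1 s2 s3 : K) :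
  e ^+ 2 = -1 -> c != 0 -> (2 : K) != 0 ->
  (forall n, s0 + s1 * (c * e ^+ n) + s2 * (c * e ^+ n) ^+ 2 + s3 * (c * e ^+ n) ^+ 3 = 0) ->
  [/\ s0 = 0, s1 = 0, s2 = 0 & s3 = 0].
Proof.
move=> e2 c0 two hs.
have h : e * e = -1 by rewrite -expr2.
have four : (4 : K) != 0 by rewrite (_ : 4 = 2 * 2) ?mulf_neq0 //; ring.
have n0 k : 4 * c ^+ k != 0 by rewrite mulf_neq0 ?expf_neq0.
pose N n := s0 + s1 * (c * e ^+ n) + s2 * (c * e ^+ n) ^+ 2 + s3 * (c * e ^+ n) ^+ 3.
have N0 n w : N n * w = 0 by rewrite /N hs mul0r.
have sol k w c0' c1 c2 c3 : 4 * c ^+ k * w = N 0%N * c0' + N 1%N * c1 + N 2%N * c2 + N 3%N * c3 ->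
  w = 0 by rewrite !N0 !addr0 => hw; apply: (mulfI (n0 k)); rewrite mulr0.
split.
- by apply: (sol 0%N _ 1 1 1 1); rewrite /N; ring: h.
- by apply: (sol 1%N _ 1 (- e) (- 1) e); rewrite /N; ring: h.
- by apply: (sol 2%N _ 1 (- 1) 1 (- 1)); rewrite /N; ring: h.
- by apply: (sol 3%N _ 1 e (- 1) (- e)); rewrite /N; ring: h.
Qed.

Section InnerFaithful.
Variables (R : realType) (k : kashina) (H : hopfAlg R[i]) (x y z : H).
Hypothesis hH : is_kashina k x y z.
Variables (p : rep2) (q : quadric) (alpha : R[i]).
Variables (sx sz : bool) (A : cgAlg R[i]) (u v t : A).
Hypothesis hA : quadric_Ore q alpha u v t.
Variable rho : hopfAction H A.
Hypothesis hact : acts_as k p sx sz x y z u v t rho.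

Local Notation K := (R[i]).

Definition xy_comb (c : nat -> nat -> K) : H :=
  \sum_(i < 4) \sum_(j < 2) c i j *: (x ^+ i * y ^+ j).

Definition xy_eval (c : nat -> nat -> K) (e f : K) : K :=
  \sum_(i < 4) \sum_(j < 2) c i j * (e ^+ i * f ^+ j).

Lemma xy_comb_delta (c : K) i' j' : (i' < 4)%N -> (j' < 2)%N ->
  xy_comb (fun i j => c *+ ((i == i') && (j == j'))) = c *: (x ^+ i' * y ^+ j').
Proof.
move=> hi hj; rewrite /xy_comb (bigD1 (Ordinal hi)) //= addrC big1 ?add0r; last first.
  move=> i ni; rewrite big1 // => j _.
  have /negPf -> : (i : nat) != i' by apply: contraNneq ni => e; apply/eqP/val_inj.
  by rewrite scale0r.
rewrite (bigD1 (Ordinal hj)) //= addrC big1 ?add0r ?eqxx // => j nj.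
have /negPf -> : (j : nat) != j' by apply: contraNneq nj => e; apply/eqP/val_inj.
by rewrite andbF scale0r.
Qed.

Lemma xy_combD c d : xy_comb (fun i j => c i j + d i j) = xy_comb c + xy_comb d.
Proof.
rewrite /xy_comb -big_split; apply: eq_bigr => i _ /=.
by rewrite -big_split; apply: eq_bigr => j _ /=; rewrite scalerDl.
Qed.

Lemma xy_combZ e c : xy_comb (fun i j => e * c i j) = e *: xy_comb c.
Proof.
rewrite /xy_comb scaler_sumr; apply: eq_bigr => i _ /=.
by rewrite scaler_sumr; apply: eq_bigr => j _ /=; rewrite scalerA.
Qed.

Lemma xy_comb0 : xy_comb (fun _ _ => 0) = 0.
Proof. by rewrite /xy_comb big1 // => i _; rewrite big1 // => j _; rewrite scale0r. Qed.

Lemma kashina_coords h : exists c d, h = xy_comb c + xy_comb d * z.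
Proof.
elim/(kashina_lin_ind hH): h => [|g h [c [d ->]] [c' [d' ->]]|e h [c [d ->]]|i j l].
- by exists (fun _ _ => 0), (fun _ _ => 0); rewrite xy_comb0 mul0r addr0.
- exists (fun i j => c i j + c' i j), (fun i j => d i j + d' i j).
  by rewrite !xy_combD mulrDl addrACA.
- exists (fun i j => e * c i j), (fun i j => e * d i j).
  by rewrite !xy_combZ scalerDr scalerAl.
- rewrite (kmon_red hH); set i' := (i %% 4)%N; set j' := (_ %% 2)%N.
  have hi : (i' < 4)%N by rewrite ltn_mod.
  have hj : (j' < 2)%N by rewrite ltn_mod.
  have : (l %% 2 < 2)%N by rewrite ltn_mod.
  case: (l %% 2)%N => [|[|]] // _.
    exists (fun i j => 1 *+ ((i == i') && (j == j'))), (fun _ _ => 0).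
    by rewrite xy_comb0 mul0r addr0 xy_comb_delta // scale1r /kmon expr0 mulr1.
  exists (fun _ _ => 0), (fun i j => 1 *+ ((i == i') && (j == j'))).
  by rewrite xy_comb0 add0r xy_comb_delta // scale1r /kmon expr1.
Qed.

Lemma act_xy_comb c w (e f : K) : rho x w = e *: w -> rho y w = f *: w ->
  rho (xy_comb c) w = xy_eval c e f *: w.
Proof.
move=> xw yw.
have actX (g : H) (n : nat) (a : K) : rho g w = a *: w -> rho (g ^+ n) w = a ^+ n *: w.
  move=> gw; elim: n => [|n IH]; first by rewrite !expr0 act_one scale1r.
  by rewrite exprSr act_comp gw act_scale IH scalerA -exprS.
have act_suml (I : Type) (r : seq I) (F : I -> H) :
    rho (\sum_(i <- r) F i) w = \sum_(i <- r) rho (F i) w.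
  by apply: (big_morph (fun h => rho h w)) => [g h|]; rewrite ?actDl ?act0l.
rewrite /xy_comb /xy_eval act_suml scaler_suml; apply: eq_bigr => i _.
rewrite act_suml scaler_suml; apply: eq_bigr => j _.
rewrite actZl act_comp (actX _ _ _ yw) act_scale (actX _ _ _ xw) !scalerA.
by rewrite -mulrA [f ^+ j * _]mulrC.
Qed.

Lemma xy_eval_eq0 (c : nat -> nat -> K) (e e' c1 c2 : K) :
  e ^+ 2 = -1 -> e' ^+ 2 = -1 -> c1 != 0 -> c2 != 0 ->
  (forall n, xy_eval c (c1 * e ^+ n) 1 = 0) ->
  (forall n, xy_eval c (c2 * e' ^+ n) (-1) = 0) -> xy_comb c = 0.
Proof.
move=> e2 e2' c10 c20 h1 h2; have two := @complex_two R.
have [|a0 a1 a2 a3] := fourier4 (s0 := c 0 0 + c 0 1) (s1 := c 1 0 + c 1 1)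
  (s2 := c 2 0 + c 2 1) (s3 := c 3 0 + c 3 1) e2 c10 two.
  move=> n; rewrite -[RHS](h1 n) /xy_eval !big_ord_recl !big_ord0 /=.
  by rewrite /bump /= !expr1n; ring.
have [|b0 b1 b2 b3] := fourier4 (s0 := c 0 0 - c 0 1) (s1 := c 1 0 - c 1 1)
  (s2 := c 2 0 - c 2 1) (s3 := c 3 0 - c 3 1) e2' c20 two.
  move=> n; rewrite -[RHS](h2 n) /xy_eval !big_ord_recl !big_ord0 /=.
  by rewrite /bump /=; ring.
have sol (a b : K) : a + b = 0 -> a - b = 0 -> a = 0 /\ b = 0.
  move=> ab ba; split; apply: (mulfI two); rewrite mulr0.
    by transitivity ((a + b) + (a - b)); [ring | rewrite ab ba addr0].
  by transitivity ((a + b) - (a - b)); [ring | rewrite ab ba subr0].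
have [c00 c01] := sol _ _ a0 b0; have [c10' c11] := sol _ _ a1 b1.
have [c20' c21] := sol _ _ a2 b2; have [c30 c31] := sol _ _ a3 b3.
rewrite /xy_comb !big_ord_recl !big_ord0 /= /bump /=.
by rewrite c00 c01 c10' c11 c20' c21 c30 c31 !scale0r !addr0.
Qed.

Let c : K := if p is Pi1 then 'i%C else 1.

(** Write h = d + d' z with d, d' in the algebra of x and y. Applied to w with w and z w
    independent, h = 0 kills d on w and d' on z w. On u t^n and v t^n, y acts as -1 and x as +-c
    e^n; on u^3 v t^n and v^3 u t^n, y acts as 1 and x as -c^4 e^n. So all eight characters
    occur. *)
Lemma faithful h : (forall a, rho h a = 0) -> h = 0.
Proof.
move=> h0; have [d [d' hE]] := kashina_coords h.
have [[xu yu zu] [xv yv zv] [xt yt zt]] := hact; rewrite -/c in xu xv.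
have two := @complex_two R.
have im2 : ('i%C : K) ^+ 2 = -1 by rewrite sqr_i.
have im0 : ('i%C : K) != 0 by apply/eqP => e; have /eqP := im2; rewrite e expr0n eq_sym oppr_eq0 oner_eq0.
have sgn0 (s : bool) n : ((-1) ^+ s) ^+ n != 0 :> K by rewrite !expf_neq0 ?oppr_eq0 ?oner_eq0.
pose e : K := (-1) ^+ sx * 'i%C.
have e2 : e ^+ 2 = -1 by rewrite exprMn sqrr_sign im2 mul1r.
have e0 n : e ^+ n != 0 by rewrite expf_neq0 // mulf_neq0 // (sgn0 sx 1%N).
have c0 : c != 0 by rewrite /c; case: (p); rewrite ?oner_eq0.
have pair w w' (g a a' f : K) : rho x w = a *: w -> rho x w' = a' *: w' ->
    rho y w = f *: w -> rho y w' = f *: w' -> rho z w = g *: w' -> g != 0 ->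
    (forall b b', b *: w + b' *: w' = 0 -> b = 0 /\ b' = 0) ->
    xy_eval d a f = 0 /\ xy_eval d' a' f = 0.
  move=> xw xw' yw yw' zw g0 ind; have := h0 w; rewrite hE actDl act_comp zw act_scale.
  rewrite (act_xy_comb _ xw yw) (act_xy_comb _ xw' yw') scalerA => /ind [-> /eqP].
  by rewrite mulf_eq0 (negPf g0) => /eqP ->.
have xtn n : rho x (t ^+ n) = e ^+ n *: t ^+ n by rewrite (act_xX hH) xt exprZn.
have ytn n : rho y (t ^+ n) = t ^+ n by rewrite (act_yX hH) yt.
have ztn n : rho z (t ^+ n) = ((-1) ^+ sz) ^+ n *: t ^+ n.
  by rewrite (act_z_evenX hH) // zt exprZn.
have mulZ (b b' : K) (w w' : A) : b *: w * (b' *: w') = (b * b') *: (w * w').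
  by rewrite -scalerAl -scalerAr scalerA.
have odd_part n : xy_eval d (c * e ^+ n) (-1) = 0 /\ xy_eval d' (- c * e ^+ n) (-1) = 0.
  apply: (pair (u * t ^+ n) (v * t ^+ n) (e ^+ n * e ^+ n * ((-1) ^+ sz) ^+ n)).
  - by rewrite (act_xM hH) xu xtn mulZ.
  - by rewrite (act_xM hH) xv xtn mulZ.
  - by rewrite (act_yM hH) yu ytn mulNr scaleN1r.
  - by rewrite (act_yM hH) yv ytn mulNr scaleN1r.
  - have xxtn : rho x (rho x (t ^+ n)) = (e ^+ n * e ^+ n) *: t ^+ n.
      by rewrite xtn act_scale xtn scalerA.
    by rewrite (act_z_odd hH yu xxtn) zu ztn -scalerAr scalerA.
  - by rewrite !mulf_neq0.
  - move=> b b'; rewrite !scalerAl -mulrDl => /(mul_power_t_eq0 hA).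
    exact: (indep_uv im2 two hA).
have xx w w' a a' : rho x (rho x w) = a *: w -> rho x (rho x w') = a' *: w' ->
    rho x (rho x (w * w')) = (a * a') *: (w * w').
  by move=> xw xw'; rewrite !(act_xM hH) xw xw' mulZ.
have xxu : rho x (rho x u) = (c * c) *: u by rewrite xu act_scale xu scalerA.
have xxv : rho x (rho x v) = (c * c) *: v by rewrite xv act_scale xv scalerA mulrNN.
have u3vE : u ^+ 3 * v = u * (u * (u * v)) by rewrite !exprS expr0 mulr1 !mulrA.
have v3uE : v ^+ 3 * u = v * (v * (v * u)) by rewrite !exprS expr0 mulr1 !mulrA.
have y3 w w' : rho y w = - w -> rho y w' = - w' -> rho y (w ^+ 3 * w') = w ^+ 3 * w'.
  by move=> yw yw'; rewrite (act_yM hH) (act_yX hH) yw yw' mulrN exprNn !exprS expr0; nc_ring constr:(K) A.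
have [g g0 zu3v] : exists2 g : K, g != 0 & rho z (u ^+ 3 * v) = g *: (v ^+ 3 * u).
  have [kap kap0 zvE] : exists2 kap : K, kap != 0 & rho z v = kap *: u.
    rewrite zv; case: (k); [exists 1 | exists (-1)]; rewrite ?oppr_eq0 ?oner_eq0 ?scale1r //.
    by rewrite scaleN1r.
  exists (c * c * (c * c * (c * c)) * (c * c * (c * c)) * (c * c) * kap);
    first by rewrite !mulf_neq0.
  rewrite u3vE (act_z_odd hH yu (xx _ _ _ _ xxu (xx _ _ _ _ xxu xxv))).
  rewrite (act_z_odd hH yu (xx _ _ _ _ xxu xxv)) (act_z_odd hH yu xxv) zu zvE v3uE.
  by nc_ring constr:(K) A.
have even_part n : xy_eval d (- (c ^+ 4) * e ^+ n) 1 = 0 /\ xy_eval d' (- (c ^+ 4) * e ^+ n) 1 = 0.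
  apply: (pair (u ^+ 3 * v * t ^+ n) (v ^+ 3 * u * t ^+ n) (g * ((-1) ^+ sz) ^+ n)).
  - rewrite (act_xM hH) (act_xM hH rho (u ^+ 3)) (act_xX hH rho u) xu xv xtn exprZn !mulZ.
    by congr (_ *: _); ring.
  - rewrite (act_xM hH) (act_xM hH rho (v ^+ 3)) (act_xX hH rho v) xu xv xtn exprZn !mulZ.
    by congr (_ *: _); ring.
  - by rewrite (act_yM hH) y3 // ytn scale1r.
  - by rewrite (act_yM hH) y3 // ytn scale1r.
  - by rewrite (act_z_even hH) ?y3 // zu3v ztn mulZ.
  - by rewrite mulf_neq0.
  - move=> b b'; rewrite !scalerAl -!mulrDl => /(mul_power_t_eq0 hA).
    rewrite -!scalerAl; exact: (indep_u3v im2 two hA).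
rewrite hE (@xy_eval_eq0 d e e (- c ^+ 4) c) // ?(@xy_eval_eq0 d' e e (- c ^+ 4) (- c)) //;
  rewrite ?oppr_eq0 ?expf_neq0 ?mul0r ?addr0 //.
- by move=> n; have [] := even_part n.
- by move=> n; have [] := odd_part n.
- by move=> n; have [] := even_part n.
- by move=> n; have [] := odd_part n.
Qed.

Lemma acts_inner_faithful : inner_faithful rho.
Proof.
move=> I _ I0; apply/eqP; rewrite -subv0; apply/subvP => h hI.
by rewrite memv0; apply/eqP/faithful => a; apply: I0.
Qed.

End InnerFaithful.

(** * Global dimension of the invariant ring *)

Lemma subm_lift (A : nzRingType) (M N : lmodType A) (S : subm N) (f : {linear M -> N}) :
  (forall m, f m \in subm_pred S) ->
  exists f' : {linear M -> subm_of S}, forall m, subm_val (f' m) = f m.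
Proof.
move=> fS; have [|f' f'E] := @linear_ex _ _ (subm_of S) (fun m => SubmOf (fS m)).
  by move=> c x y; apply: val_inj; rewrite /= linearP.
by exists f' => m; rewrite f'E.
Qed.

Lemma subm_mul (R : nzRingType) (S : subm (R^o : lmodType R)) (c r : R) :
  r \in subm_pred S -> c * r \in subm_pred S.
Proof. by have [S0 SD] := subm_closed S => rS; rewrite -[c * r]addr0; apply: SD. Qed.

Lemma subm_add (R : nzRingType) (S : subm (R^o : lmodType R)) (r r' : R) :
  r \in subm_pred S -> r' \in subm_pred S -> r + r' \in subm_pred S.
Proof. by have [S0 SD] := subm_closed S => rS; rewrite -[r]mul1r; apply: SD. Qed.

(* R stands for the ring of invariants, embedded in A by [iota]; [R_odd] holds
   because only even powers of t occur in it. *)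
Section InfiniteDimension.
Variables (K : fieldType) (A R : algType K) (iota : {lrmorphism R -> A}).
Variables (t f g : A) (D Phi Gam : R) (mu nu : K).

Local Notation T := (t ^+ 2).

Definition in_At (a : A) : Prop := exists a', a = a' * t.

Hypotheses (iota_inj : injective iota) (t_reg : forall a, a * t = 0 -> a = 0)
  (t_swap : forall a, exists a', t * a = a' * t)
  (t_cancel : forall a c, t * a = c * T -> in_At a).
Hypotheses (iD : iota D = T ^+ 2) (iPhi : iota Phi = f * T) (iGam : iota Gam = g * T).
Hypotheses (Tf : T * f = mu *: (f * T)) (Tg : T * g = nu *: (g * T))
  (mu0 : mu != 0) (nu0 : nu != 0) (fg : f * g = g * f).
Hypotheses (f_regr : forall a, in_At (a * f) -> in_At a)
  (f_regl : forall a, in_At (f * a) -> in_At a).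
Hypothesis R_div : forall a r, iota r = a * T ^+ 2 -> exists r', iota r' = a.
Hypothesis R_odd : forall a r, iota r = a * t ^+ 3 -> in_At a.
Hypothesis R_gen : forall r, in_At (iota r) ->
  exists r1 r2 r3, r = r1 * D + r2 * Phi + r3 * Gam.

Let T_reg a : a * T = 0 -> a = 0.
Proof. by rewrite expr2 mulrA => /t_reg/t_reg. Qed.

Let iM r r' : iota (r * r') = iota r * iota r'.
Proof. exact: rmorphM. Qed.

Let iA r r' : iota (r + r') = iota r + iota r'.
Proof. exact: raddfD. Qed.

Let i0 : iota 0 = 0.
Proof. exact: raddf0. Qed.

Let iZ c r : iota (c *: r) = c *: iota r.
Proof. by rewrite linearZ. Qed.

Let D_reg r : r * D = 0 -> r = 0.
Proof.
move=> /(congr1 iota); rewrite iM iD i0 expr2 mulrA => /T_reg/T_reg r0.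
by apply: iota_inj; rewrite r0 i0.
Qed.

Let D_inj r r' : r * D = r' * D -> r = r'.
Proof. by move=> e; apply/subr0_eq/D_reg; rewrite mulrBl e subrr. Qed.

Let T2_inj a b : a * T ^+ 2 = b * T ^+ 2 -> a = b.
Proof. by move=> e; apply/subr0_eq/T_reg/T_reg; rewrite -mulrA -expr2 mulrBl e subrr. Qed.

Let DPhi : D * Phi = (mu * mu) *: (Phi * D).
Proof.
apply: iota_inj; rewrite iZ !iM iD iPhi.
have -> : T ^+ 2 * (f * T) = T * (T * f) * T by nc_ring K A.
rewrite Tf; have -> : T * (mu *: (f * T)) * T = mu *: (T * f * T * T) by nc_ring K A.
by rewrite Tf; nc_ring K A.
Qed.

(** Divisibility by t improves to divisibility by T because D, f T and g T are all multiples of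
    T. *)
Let in_At_T i : in_At (iota i) -> exists w, iota i = w * T.
Proof.
move=> /R_gen [r1 [r2 [r3 ->]]]; exists (iota r1 * T + iota r2 * f + iota r3 * g).
rewrite !iA !iM.
by rewrite iD iPhi iGam; move: (iota r1) (iota r2) (iota r3) => a1 a2 a3; nc_ring K A.
Qed.

Let mul_T w h c : T * h = c *: (h * T) -> w * T * (h * T) = (c *: (w * h)) * T ^+ 2.
Proof.
move=> Th; have -> : w * T * (h * T) = w * (T * h) * T by nc_ring K A.
by rewrite Th; nc_ring K A.
Qed.

(** The quotient r is what defines the linear map [div_Phi] from I to R on which all three exact
    sequences rest. *)
Let mul_Phi i : in_At (iota i) -> exists r, i * Phi = r * D.
Proof.
move=> /in_At_T [w iw]; have e := mul_T w Tf; rewrite -iw -iPhi -iM in e.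
have [r ir] := R_div e; exists r; apply: iota_inj.
by rewrite e iM ir iD.
Qed.

Let mul_Gam i : in_At (iota i) -> exists r, i * Gam = r * D.
Proof.
move=> /in_At_T [w iw]; have e := mul_T w Tg; rewrite -iw -iGam -iM in e.
have [r ir] := R_div e; exists r; apply: iota_inj.
by rewrite e iM ir iD.
Qed.

Let prod_ex : exists ff gf gg, [/\ iota ff = f * f, iota gf = g * f & iota gg = g * g].
Proof.
have G r h c : c != 0 -> iota r = (c *: h) * T ^+ 2 -> exists r', iota r' = h.
  move=> c0 e; apply: (@R_div _ (c^-1 *: r)); rewrite iZ e -scalerAl scalerA mulVf //.
  by rewrite scale1r.
have [|ff h1] := G (Phi * Phi) (f * f) mu mu0; first by rewrite iM iPhi (mul_T f Tf).
have [|gf h2] := G (Gam * Phi) (g * f) mu mu0.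
  by rewrite iM iPhi iGam (mul_T g Tf).
have [|gg h3] := G (Gam * Gam) (g * g) nu nu0; first by rewrite iM iGam (mul_T g Tg).
by exists ff, gf, gg.
Qed.

Let in_AtM c a : in_At a -> in_At (c * a).
Proof. by move=> [a' ->]; exists (c * a'); rewrite mulrA. Qed.

Let in_AtD a b : in_At a -> in_At b -> in_At (a + b).
Proof. by move=> [a' ->] [b' ->]; exists (a' + b'); rewrite mulrDl. Qed.

Let in_At0 : in_At 0. Proof. by exists 0; rewrite mul0r. Qed.

Let subm_ex (S : R -> Prop) : S 0 -> (forall c r r', S r -> S r' -> S (c * r + r')) ->
  exists N : subm (R^o : lmodType R), forall r, r \in subm_pred N <-> S r.
Proof.
move=> S0 SD; pose p : pred (R^o : lmodType R) := fun r => `[< S r >].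
have pc : GRing.submod_closed p.
  split; first exact/asboolP.
  by move=> c r r' /asboolP Sr /asboolP Sr'; apply/asboolP/SD.
by exists (Subm pc) => r; split => /asboolP.
Qed.

Variable Lam : {rmorphism A -> {poly K}}.
Hypotheses (Lf : Lam f = 0) (Lg : Lam g = 0) (Lt : Lam t = 'X).

Definition in_K (r : R) : Prop := exists p q, r = p * D + q * Phi.

Hypothesis L_sum : g = 0 \/ forall r, in_K (r * Gam) ->
  exists i i' r', [/\ in_At (iota i), in_At (iota i'), r' * D = i' * Phi & r = i + r'].

Let projective2 : projective (R^o * R^o)%type.
Proof. by apply: projective_pair; apply: projective_regular. Qed.

Let in_KM c r : in_K r -> in_K (c * r).
Proof. by move=> [p [q ->]]; exists (c * p), (c * q); rewrite mulrDr !mulrA. Qed.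

Let in_KD r r' : in_K r -> in_K r' -> in_K (r + r').
Proof.
move=> [p [q ->]] [p' [q' ->]]; exists (p + p'), (q + q').
by rewrite !mulrDl addrACA.
Qed.

Section Ideal.
Variable I : subm (R^o : lmodType R).
Hypothesis IP : forall r, r \in subm_pred I <-> in_At (iota r).

Let memD : D \in subm_pred I.
Proof. by apply/IP; rewrite iD expr2 {2}expr2 !mulrA; eexists. Qed.

Let memPhi : Phi \in subm_pred I.
Proof. by apply/IP; rewrite iPhi expr2 !mulrA; eexists. Qed.

Let memGam : Gam \in subm_pred I.
Proof. by apply/IP; rewrite iGam expr2 !mulrA; eexists. Qed.

Let scaleRE (c r : R^o) : c *: r = c * r :> R. Proof. by []. Qed.

Lemma ideal_not_projective : ~ projective (subm_of I : lmodType R).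
Proof.
move=> pI.
pose R3 : lmodType R := ((R^o * R^o) * R^o)%type.
have [h hE] : exists h : {linear R3 -> (R^o : lmodType R)}, forall m : R3,
    h m = m.1.1 * D + m.1.2 * Phi + m.2 * Gam.
  apply: (@linear_ex _ R3 (R^o : lmodType R)) => c m m'.
  by rewrite /= !mulrDl !scaleRE !mulrDr !mulrA [RHS]addrACA; congr (_ + _); rewrite addrACA.
have [|h' h'E] := @subm_lift _ R3 (R^o : lmodType R) I h.
  by move=> m; rewrite hE; (apply: subm_add; [apply: subm_add |]); apply: subm_mul.
have hs : surj_map h'.
  move=> x; have /IP/R_gen [r1 [r2 [r3 e]]] := subm_valP x.
  by exists (r1, r2, r3); apply: val_inj; rewrite /= h'E hE.
have [s sK] := pI _ _ h' idfun hs.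
pose xD : subm_of I := SubmOf memD; pose xPhi : subm_of I := SubmOf memPhi.
(* The commutation of D with Phi, pushed through the section, links the lifts of D and Phi; its
   first coordinate reads D p1 = mu^2 Phi p. *)
have rel : D *: s xPhi = ((mu * mu) *: Phi) *: s xD.
  rewrite -!linearZ; congr (s _); apply: val_inj.
  by rewrite /= !scaleRE DPhi scalerAl.
have := sK xD; move: rel; case: (s xPhi) => [[p1 q1] q1']; case: (s xD) => [[p q] q'].
move=> /(congr1 (fun m : R3 => m.1.1)); rewrite /= !scaleRE => rel.
move=> /(congr1 (@subm_val _ _ I)); rewrite /= h'E hE /= => e.
(* Powers of t move to the right of any element, so D p1 lies in A T^2. Hence f b2 lies in A t,
   where T p = b2 T; cancelling f modulo t, and then t twice on the left, shows that p lies in A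
   t. *)
have pT : in_At (iota p).
  have [a1 e1] := t_swap (iota p1); have [a2 e2] := t_swap a1.
  have [a3 e3] := t_swap a2; have [a4 e4] := t_swap a3.
  have [b1 f1] := t_swap (iota p); have [b2 f2] := t_swap b1.
  have E1 : T ^+ 2 * iota p1 = a4 * T * T.
    have -> : T ^+ 2 * iota p1 = t * (t * (t * (t * iota p1))) by nc_ring K A.
    rewrite e1 (mulrA t a1) e2; have -> : t * (t * (a2 * t * t)) = t * ((t * a2) * t * t) by nc_ring K A.
    by rewrite e3 !(mulrA t) e4; nc_ring K A.
  have E2 : T * iota p = b2 * T.
    by rewrite expr2 -mulrA f1 mulrA f2 -mulrA.
  have [b3 f3] : in_At b2.
    apply: f_regl; exists ((mu * mu)^-1 *: (a4 * t)).
    apply/subr0_eq/T_reg; move: rel => /(congr1 iota).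
    rewrite !iM iZ iD iPhi E1 -scalerAl -(mulrA f) E2 => h0.
    have {}h0 : f * b2 * T = (mu * mu)^-1 *: (a4 * T * T).
      by rewrite h0 scalerA mulVf ?mulf_neq0 // scale1r mulrA.
    by rewrite mulrBl h0; apply/eqP; rewrite subr_eq0; apply/eqP; nc_ring K A.
  have [c1 g1] := t_swap (iota p).
  have E3 : t * c1 = b3 * T.
    apply/subr0_eq/T_reg; rewrite mulrBl; apply/eqP; rewrite subr_eq0; apply/eqP.
    transitivity (t * (c1 * t) * t); first by nc_ring K A.
    rewrite -g1; transitivity (T * iota p * t); first by nc_ring K A.
    by rewrite E2 f3; nc_ring K A.
  have [c g2] := t_cancel E3.
  apply: (t_cancel (c := c)).
  by rewrite g1 g2; nc_ring K A.
have {}e : iota p * T + iota q * f + iota q' * g = T.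
  apply/subr0_eq/T_reg; move: e => /(congr1 iota); rewrite !iA !iM iD iPhi iGam.
  rewrite mulrBl -[X in _ - X]expr2 => <-; apply/eqP; rewrite subr_eq0; apply/eqP.
  by move: (iota p) (iota q) (iota q') => a1 a2 a3; nc_ring K A.
(* Since [Lam] kills f and g and sends t to X, the identity becomes X^2 = Lam(p') X^3. *)
case: pT => p' pE; move: e => /(congr1 Lam).
rewrite !rmorphD !rmorphM /= Lf Lg !mulr0 !addr0 pE rmorphM Lt -expr2 => e.
have : Lam p' * 'X = 1.
  have X0 : 'X^2 != 0 :> {poly K} by rewrite expf_neq0 // polyX_eq0.
  by apply: (mulIf X0); rewrite mul1r.
move=> /(congr1 (horner^~ 0)); rewrite !hornerE => /eqP.
by rewrite eq_sym oner_eq0.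
Qed.

Let mul_comb (d e : R) : exists h : {linear (R^o * R^o)%type -> (R^o : lmodType R)},
  forall m, h m = m.1 * d + m.2 * e.
Proof.
apply: linear_ex => c m m'.
by rewrite /= !mulrDl !scaleRE !mulrDr !mulrA addrACA.
Qed.

Let div_Phi : exists a : {linear subm_of I -> (R^o : lmodType R)},
  forall x, a x * D = subm_val x * Phi.
Proof.
have /choice [a aE] : forall x : subm_of I, exists r, subm_val x * Phi = r * D.
  by move=> x; apply/mul_Phi/IP/subm_valP.
have [|a' a'E] := @linear_ex _ _ (R^o : lmodType R) a.
  by move=> c x x'; apply: D_inj; rewrite mulrDl -mulrA -!aE /= mulrDl scaleRE mulrA.
by exists a' => x; rewrite a'E aE.
Qed.

(** If p D + q Phi = 0 then q f = -p T, so q lies in I because f is regular modulo t, and p = -q Phi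
    / D. *)
Lemma syzygy_ses (N : subm (R^o : lmodType R)) :
  (forall r, r \in subm_pred N <-> in_K r) ->
  exists (i : {linear subm_of I -> (R^o * R^o)%type})
         (h : {linear (R^o * R^o)%type -> subm_of N}), ses i h.
Proof.
move=> NP; have [h hE] := mul_comb D Phi.
have [|h' h'E] := @subm_lift _ _ _ N h.
  by move=> m; apply/NP; rewrite hE; exists m.1, m.2.
have [a aE] := div_Phi.
have [|i iE] := @linear_ex _ _ _ (fun x : subm_of I => (- a x, subm_val x) : (R^o * R^o)%type).
  by move=> c x x'; congr pair; rewrite /= linearP opprD scalerN.
exists i, h'; split.
- by move=> x x'; rewrite !iE => -[_ e]; apply: val_inj.
- by move=> r; have /NP [p [q e]] := subm_valP r; exists (p, q); apply: val_inj; rewrite /= h'E hE.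
- move=> [p q]; split=> [|[x]].
    move=> /(congr1 (@subm_val _ _ N)); rewrite /= h'E hE /= => e.
    have qI : q \in subm_pred I.
      apply/IP/f_regr; exists (- iota p * t); apply/subr0_eq/T_reg.
      move: e => /(congr1 iota); rewrite iA !iM iD iPhi i0 => <-.
      by move: (iota p) (iota q) => a1 a2; nc_ring K A.
    exists (SubmOf qI); rewrite iE /=; congr pair; apply: D_inj.
    by rewrite mulNr aE /=; apply/esym/eqP; rewrite -addr_eq0 e.
  by rewrite iE => -[<- <-]; apply: val_inj; rewrite /= h'E hE /= mulNr aE addNr.
Qed.

Lemma in_K_I r : in_K r -> in_At (iota r).
Proof.
by move=> [p [q ->]]; rewrite iA !iM; apply: in_AtD; apply/in_AtM/IP.
Qed.

(** I = K + R Gam, and (n, r) is in the kernel of the sum map exactly when n = -r Gam, which puts r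
    in L. *)
Lemma quotient_ses (N L : subm (R^o : lmodType R)) :
  (forall r, r \in subm_pred N <-> in_K r) ->
  (forall r, r \in subm_pred L <-> in_K (r * Gam)) ->
  exists (i : {linear subm_of L -> (subm_of N * R^o)%type})
         (h : {linear (subm_of N * R^o)%type -> subm_of I}), ses i h.
Proof.
move=> NP LP.
have [h hE] : exists h : {linear (subm_of N * R^o)%type -> (R^o : lmodType R)},
    forall m, h m = subm_val m.1 + m.2 * Gam.
  by apply: linear_ex => c m m'; rewrite /= !mulrDl !scaleRE !mulrDr !mulrA addrACA.
have [|h' h'E] := @subm_lift _ _ _ I h.
  move=> [n r]; rewrite hE /=; apply: subm_add; last exact: subm_mul.
  by apply/IP/in_K_I/NP/subm_valP.
have [e eE] : exists e : {linear subm_of L -> (R^o : lmodType R)},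
    forall l, e l = - (subm_val l * Gam).
  by apply: linear_ex => c x x'; rewrite /= mulrDl !scaleRE mulrN opprD mulrA.
have [|e' e'E] := @subm_lift _ _ _ N e.
  move=> l; rewrite eE -mulN1r; apply: subm_mul.
  by apply/NP/LP/subm_valP.
have [|i iE] := @linear_ex _ _ _ (fun x : subm_of L => (e' x, subm_val x) : (subm_of N * R^o)%type).
  by move=> c x x'; congr pair; rewrite /= linearP.
exists i, h'; split.
- by move=> x x'; rewrite !iE => -[_ e1]; apply: val_inj.
- move=> x; have /IP/R_gen [r1 [r2 [r3 x3]]] := subm_valP x.
  have nN : r1 * D + r2 * Phi \in subm_pred N by apply/NP; exists r1, r2.
  by exists (SubmOf nN, r3); apply: val_inj; rewrite /= h'E hE.
- move=> [n r]; split=> [|[x]].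
    move=> /(congr1 (@subm_val _ _ I)); rewrite /= h'E hE /= => nr.
    have nE : subm_val n = - (r * Gam) by apply/eqP; rewrite -addr_eq0 nr.
    have rL : r \in subm_pred L.
      by apply/LP/NP; rewrite -[_ * _]opprK -nE -mulN1r; apply/subm_mul/subm_valP.
    by exists (SubmOf rL); rewrite iE; congr pair; apply: val_inj; rewrite /= e'E eE.
  by rewrite iE => -[<- <-]; apply: val_inj; rewrite /= h'E hE /= e'E eE addNr.
Qed.

(** The image of [div_Phi] lies in L: r is a combination of Phi, f^2 and g f, and Phi Gam is a
    multiple of D, while f^2 (g T) = g f (f T) and g f (g T) = g^2 (f T) since f and g commute. *)
Let in_K_div x r : in_At (iota x) -> r * D = x * Phi -> in_K (r * Gam).
Proof.
move=> /R_gen [q1 [q2 [q3 ->]]] e.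
have [ff [gf [gg [hff hgf hgg]]]] := prod_ex.
have [s sE] : exists s, Phi * Gam = s * D by apply/mul_Gam/IP.
have -> : r = (mu * mu) *: (q1 * Phi) + mu *: (q2 * ff) + mu *: (q3 * gf).
  apply: D_inj; rewrite e !mulrDl -(mulrA q1) DPhi -(mulrA q2) -(mulrA q3).
  have -> : Phi * Phi = mu *: (ff * D).
    by apply: iota_inj; rewrite iZ !iM hff iD iPhi (mul_T f Tf) -scalerAl.
  have -> : Gam * Phi = mu *: (gf * D).
    by apply: iota_inj; rewrite iZ !iM hgf iD iPhi iGam (mul_T g Tf) -scalerAl.
  by rewrite -!scalerAr -!scalerAl !mulrA.
have h1 : ff * Gam = gf * Phi.
  apply: iota_inj; rewrite !iM hff hgf iPhi iGam.
  by rewrite !mulrA -(mulrA f f g) fg !mulrA fg.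
have h2 : gf * Gam = gg * Phi.
  apply: iota_inj; rewrite !iM hgf hgg iPhi iGam.
  by rewrite !mulrA -(mulrA g f g) fg !mulrA.
rewrite !mulrDl -!scalerAl -!mulrA sE h1 h2.
have G c r' : in_K r' -> in_K (c *: r').
  by move=> hr; rewrite -mulr_algl; apply: in_KM.
apply: in_KD; [apply: in_KD|]; apply: (G); apply: in_KM.
- by exists s, 0; rewrite mul0r addr0.
- by exists 0, gf; rewrite mul0r add0r.
- by exists 0, gg; rewrite mul0r add0r.
Qed.

(** The map is (x, x') -> x + x' Phi / D. In its kernel x' Phi / D lies in I; with x' = w' T this
    says that w' f is in A t, hence w' is, so x' = w t^3, and by [R_odd] x' is a multiple r D. The
    kernel is therefore free on (-mu^2 Phi, D). *)
Lemma sum_ses (L : subm (R^o : lmodType R)) :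
  (forall r, r \in subm_pred L <-> in_K (r * Gam)) ->
  (forall r, in_K (r * Gam) -> exists i i' r',
     [/\ in_At (iota i), in_At (iota i'), r' * D = i' * Phi & r = i + r']) ->
  exists (i : {linear (R^o : lmodType R) -> (subm_of I * subm_of I)%type})
         (h : {linear (subm_of I * subm_of I)%type -> subm_of L}), ses i h.
Proof.
move=> LP Lsum; have [a aE] := div_Phi.
have [h hE] : exists h : {linear (subm_of I * subm_of I)%type -> (R^o : lmodType R)},
    forall m, h m = subm_val m.1 + a m.2.
  by apply: linear_ex => c m m'; rewrite /= linearP scalerDr addrACA.
have [|h' h'E] := @subm_lift _ _ _ L h.
  move=> [x x']; rewrite hE /=; apply/LP; rewrite mulrDl; apply: in_KD.
    have [r ->] := mul_Gam (proj1 (IP _) (subm_valP x)).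
    by exists r, 0; rewrite mul0r addr0.
  by apply: (in_K_div (x := subm_val x')); [apply/IP/subm_valP | apply: aE].
have [e1 e1E] : exists e : {linear (R^o : lmodType R) -> (R^o : lmodType R)},
    forall r, e r = r * (- (mu * mu) *: Phi).
  by apply: linear_ex => c x x'; rewrite mulrDl scaleRE -mulrA.
have [|e1' e1'E] := @subm_lift _ _ _ I e1.
  by move=> r; rewrite e1E -scalerAr -mulr_algl; do 2!apply: subm_mul.
have [e2 e2E] : exists e : {linear (R^o : lmodType R) -> (R^o : lmodType R)},
    forall r, e r = r * D.
  by apply: linear_ex => c x x'; rewrite mulrDl scaleRE -mulrA.
have [|e2' e2'E] := @subm_lift _ _ _ I e2.
  by move=> r; rewrite e2E; apply: subm_mul.
have [|i iE] := @linear_ex _ (R^o : lmodType R) _ (fun r => (e1' r, e2' r) : (subm_of I * subm_of I)%type).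
  by move=> c x x'; congr pair; rewrite /= linearP.
have key r (x' : subm_of I) : subm_val x' = r * D -> a x' = r * ((mu * mu) *: Phi).
  by move=> xE; apply: D_inj; rewrite aE xE -(mulrA r D) DPhi -scalerAr -(scalerAr _ r) -scalerAl mulrA.
exists i, h'; split.
- move=> x x'; rewrite !iE => -[_ /(congr1 (@subm_val _ _ I))].
  by rewrite !e2'E !e2E => /D_inj.
- move=> l; have /LP/Lsum [x [x' [r [xI x'I rE lE]]]] := subm_valP l.
  exists (SubmOf (proj2 (IP _) xI), SubmOf (proj2 (IP _) x'I)).
  apply: val_inj; rewrite /= h'E hE lE /=; congr (_ + _).
  by apply: D_inj; rewrite aE rE.
- move=> [x x']; split=> [|[r]]; last first.
    rewrite iE => -[<- <-]; apply: val_inj.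
    by rewrite /= h'E hE /= e1'E e1E (key r) ?e2'E ?e2E // scaleNr mulrN addNr.
  move=> /(congr1 (@subm_val _ _ L)); rewrite /= h'E hE /= => e.
  have xE : subm_val x = - a x' by apply/eqP; rewrite -addr_eq0 e.
  have [w' w'E] := in_At_T (proj1 (IP _) (subm_valP x')).
  have : in_At w'.
    apply: f_regr; have [b bE] := proj1 (IP _) (subm_valP x).
    have := congr1 iota (aE x'); rewrite !iM iD iPhi w'E (mul_T w' Tf) => /T2_inj aE'.
    exists (- mu^-1 *: b); rewrite -scalerAl -bE xE.
    have -> : iota (- a x') = - iota (a x') by apply: raddfN.
    by rewrite aE' scaleNr scalerN opprK scalerA mulVf ?scale1r.
  move=> [w wE].
  have [|c cE] := R_odd (a := w) (r := subm_val x').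
    by rewrite w'E wE; nc_ring K A.
  have [r rE] : exists r, iota r = c.
    by apply: (@R_div _ (subm_val x')); rewrite w'E wE cE; nc_ring K A.
  have x'E : subm_val x' = r * D.
    by apply: iota_inj; rewrite w'E wE cE iM iD rE; nc_ring K A.
  exists r; rewrite iE; congr pair; apply: val_inj; rewrite /=.
    by rewrite e1'E e1E xE (key _ _ x'E) scaleNr mulrN.
  by rewrite e2'E e2E.
Qed.

End Ideal.

Lemma infinite_gldim : ~ finite_gldim R.
Proof.
move=> [n hn].
have in_AtMD c a b : in_At (iota a) -> in_At (iota b) -> in_At (iota (c * a + b)).
  by move=> ha hb; rewrite iA iM; apply: in_AtD => //; apply: in_AtM.
have [|I IP] := @subm_ex (fun r => in_At (iota r)) _ in_AtMD.
  by rewrite i0; apply: in_At0.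
apply: (ideal_not_projective IP).
have pdI := pdim_le_pd_le (hn (subm_of I : lmodType R)).
have in_K0 : in_K 0 by exists 0, 0; rewrite !mul0r addr0.
have in_KMD c a b : in_K a -> in_K b -> in_K (c * a + b).
  by move=> ha hb; apply: in_KD => //; apply: in_KM.
case: L_sum => [g0|Lsum].
  have Gam0 : Gam = 0 by apply: iota_inj; rewrite iGam g0 mul0r i0.
  have IK r : r \in subm_pred I <-> in_K r.
    split=> [/IP/R_gen [r1 [r2 [r3 ->]]]|h].
      by exists r1, r2; rewrite Gam0 mulr0 addr0.
    by apply/IP/(in_K_I IP).
  have [i [h ih]] := syzygy_ses IP IK.
  exact: (pd_le_periodic ih projective2 pdI).
have [N NP] := subm_ex in_K0 in_KMD.
have [||L LP] := @subm_ex (fun r => in_K (r * Gam)).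
- by rewrite mul0r.
- by move=> c a b ha hb; rewrite mulrDl -mulrA; apply: in_KMD.
have [i1 [h1 s1]] := sum_ses IP LP Lsum.
have [i2 [h2 s2]] := quotient_ses IP NP LP.
have [i3 [h3 s3]] := syzygy_ses IP NP.
apply: (pd_le_descent s1 s2 s3 _ _ projective2 pdI); exact: projective_regular.
Qed.

End InfiniteDimension.

Lemma scalar_mx_comm (S : comNzRingType) (d : S) (M : 'M[S]_2) : d%:M * M = M * d%:M.
Proof. exact: esym (scalar_mxC _ _). Qed.

Lemma scalar_mx_regular (S : idomainType) (d : S) (M N : 'M[S]_2) :
  N * N = d%:M -> d != 0 -> (M * N = 0 -> M = 0) /\ (N * M = 0 -> M = 0).
Proof.
move=> NN d0; have dM : d%:M * M = 0 -> M = 0.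
  rewrite [_ * _]mul_scalar_mx => /matrixP h; apply/matrixP => i j.
  by have /eqP := h i j; rewrite !mxE mulf_eq0 (negPf d0) => /eqP.
split=> e; apply: dM.
  by rewrite scalar_mx_comm -NN mulrA e mul0r.
by rewrite -NN -mulrA e mulr0.
Qed.

Lemma subalg_gen_comm (K : fieldType) (A : algType K) (s : seq A) :
  (forall a b, a \in s -> b \in s -> a * b = b * a) ->
  forall a b, subalg_gen s a -> subalg_gen s b -> a * b = b * a.
Proof.
move=> hs; have G b a : (forall c, c \in s -> b * c = c * b) -> subalg_gen s a -> b * a = a * b.
  move=> hb; elim=> {a} [a|c|a a' _ IH _ IH'|a a' _ IH _ IH'].
  - exact: hb.
  - by rewrite mulr_algl mulr_algr.
  - by rewrite mulrDr mulrDl IH IH'.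
  - by rewrite mulrA IH -mulrA IH' mulrA.
move=> a b ha hb; apply: (G) hb => c hc; apply/esym; apply: (G) ha => d hd.
exact: hs.
Qed.

(** * Regularity of f, and R0 modulo f *)

Section ShapeModel.
Variables (K : fieldType) (A : algType K) (a b : A) (tau : K).
Local Notation E := (a ^+ 2).
Local Notation F := (b ^+ 2).
Local Notation P := (a * b).
Hypotheses (EF : E * F = F * E) (EP : E * P = P * E) (FP : F * P = P * F).
Hypotheses (EFP : E * F = tau *: P ^+ 2) (tau2 : tau * tau = 1).

Lemma EFP_comm w w' : subalg_gen [:: E; F; P] w -> subalg_gen [:: E; F; P] w' -> w * w' = w' * w.
Proof.
apply: subalg_gen_comm => c d; rewrite !inE.
by case/or3P => /eqP ->; case/or3P => /eqP ->.
Qed.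

Lemma shape_f_gen sh : subalg_gen [:: E; F; P] (shape_f E F P sh).
Proof. by case: sh; rewrite /shape_f; in_subalg. Qed.

Lemma shape_g_gen sh : subalg_gen [:: E; F; P] (shape_g E F P sh).
Proof. by case: sh; rewrite /shape_g; in_subalg. Qed.

Lemma shape_gens_gen sh w : subalg_gen (shape_gens E F P sh) w -> subalg_gen [:: E; F; P] w.
Proof.
apply: subalg_gen_trans => {}w.
by case: sh; rewrite !inE; do ?[case/orP]; move=> /eqP ->; in_subalg.
Qed.

Lemma shape_fg sh : shape_f E F P sh * shape_g E F P sh = shape_g E F P sh * shape_f E F P sh.
Proof. exact: EFP_comm (shape_f_gen sh) (shape_g_gen sh). Qed.

Lemma shape_scal (T : A) (lam : K) : lam != 0 ->
  T * E = lam *: (E * T) -> T * F = lam *: (F * T) -> T * P = lam *: (P * T) -> forall sh,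
  (exists2 mu, mu != 0 & T * shape_f E F P sh = mu *: (shape_f E F P sh * T)) /\
  (exists2 nu, nu != 0 & T * shape_g E F P sh = nu *: (shape_g E F P sh * T)).
Proof.
move=> l0 TE TF TP sh.
have mul c e w w' : T * w = c *: (w * T) -> T * w' = e *: (w' * T) ->
    T * (w * w') = (c * e) *: (w * w' * T).
  by move=> h h'; rewrite mulrA h -scalerAl -(mulrA w T) h' -scalerAr scalerA mulrA.
have add c w w' : T * w = c *: (w * T) -> T * w' = c *: (w' * T) ->
    T * (w + w') = c *: ((w + w') * T).
  by move=> h h'; rewrite mulrDr mulrDl h h' scalerDr.
have sub c w w' : T * w = c *: (w * T) -> T * w' = c *: (w' * T) ->
    T * (w - w') = c *: ((w - w') * T).
  by move=> h h'; rewrite mulrBr mulrBl h h' scalerBr.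
have TE2 : T * E ^+ 2 = (lam * lam) *: (E ^+ 2 * T) by rewrite [E ^+ 2]expr2; apply: (mul).
have TF2 : T * F ^+ 2 = (lam * lam) *: (F ^+ 2 * T) by rewrite [F ^+ 2]expr2; apply: (mul).
have ll0 : lam * lam != 0 by rewrite mulf_neq0.
have one0 : (1 : K) != 0 by rewrite oner_eq0.
have z0 : T * 0 = (1 : K) *: (0 * T) by rewrite mulr0 mul0r scaler0.
case: sh; rewrite /shape_f /shape_g; split; try (by exists 1);
  try (by exists lam => //; first [exact: TP | exact: add | exact: sub]);
  exists (lam * lam) => //; first [exact: add | exact: sub | apply: (mul) => //; first [exact: add | exact: sub]].
Qed.

Section Evaluation.
Variables (S : idomainType) (phi : {rmorphism A -> 'M[S]_2}) (x y e : S).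
Hypotheses (phi_E : phi E = (x ^+ 2)%:M) (phi_F : phi F = (y ^+ 2)%:M).
Hypotheses (phi_P : phi P * phi P = (e * x ^+ 2 * y ^+ 2)%:M).

Let sM (c d : S) : c%:M * d%:M = (c * d)%:M :> 'M_2.
Proof. by rewrite [RHS]scalar_mxM. Qed.

Let sD (c d : S) : c%:M + d%:M = (c + d)%:M :> 'M_2.
Proof. by rewrite [RHS]raddfD. Qed.

Let sB (c d : S) : c%:M - d%:M = (c - d)%:M :> 'M_2.
Proof. by rewrite [RHS]raddfB. Qed.

Lemma mul_P_square w c : phi w = c%:M ->
  phi (P * w) * phi (P * w) = (e * x ^+ 2 * y ^+ 2 * (c * c))%:M.
Proof.
move=> wc; rewrite rmorphM wc -mulrA (mulrA _ (phi P)).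
by rewrite (scalar_mx_comm c (phi P)) -(mulrA (phi P) c%:M) sM mulrA phi_P sM.
Qed.

Lemma shape_f_square sh : e != 0 -> x != 0 -> y != 0 -> x ^+ 2 != y ^+ 2 -> x ^+ 2 + y ^+ 2 != 0 ->
  exists2 d, d != 0 & phi (shape_f E F P sh) * phi (shape_f E F P sh) = d%:M.
Proof.
move=> e0 x0 y0 xy xy'.
have D : phi (E - F) = (x ^+ 2 - y ^+ 2)%:M by rewrite rmorphB phi_E phi_F sB.
have Sm : phi (E + F) = (x ^+ 2 + y ^+ 2)%:M by rewrite rmorphD phi_E phi_F sD.
have D0 : x ^+ 2 - y ^+ 2 != 0 by rewrite subr_eq0.
have p0 : e * x ^+ 2 * y ^+ 2 != 0 by rewrite !mulf_neq0 ?expf_neq0.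
have PM c w : phi w = c%:M -> c != 0 -> exists2 d, d != 0 & phi (P * w) * phi (P * w) = d%:M.
  move=> wc c0; exists (e * x ^+ 2 * y ^+ 2 * (c * c)); last exact: mul_P_square.
  by rewrite !mulf_neq0 ?expf_neq0.
have sq c w : phi w = c%:M -> c != 0 -> exists2 d, d != 0 & phi w * phi w = d%:M.
  by move=> -> c0; exists (c * c); rewrite ?mulf_neq0 ?sM.
case: sh; rewrite /shape_f; try exact: sq D D0; try exact: sq Sm xy'; try exact: PM D D0;
  try exact: PM Sm xy'; try by exists (e * x ^+ 2 * y ^+ 2).
apply: (sq ((x ^+ 2) * (x ^+ 2) - (y ^+ 2) * (y ^+ 2))).
  have phi2 w : phi (w ^+ 2) = phi w * phi w by rewrite expr2 rmorphM.
  by rewrite rmorphB (phi2 E) (phi2 F) phi_E phi_F !sM sB.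
by rewrite -!expr2 subr_sqr mulf_neq0.
Qed.

End Evaluation.

(* The relation E^2 + F^2 = (E - F)^2 + 2 tau P^2, resp. the choice f = P, shows
   that f divides all the generators but one. *)
Definition double_gen (sh : shape) : A := if sh is DoubleDiff then P ^+ 2 else E ^+ 2 + F ^+ 2.

(** Everything commutes, so it suffices to split the generators. The cofactor of f stays in R1, an
    R0-module containing f and g; this is what later makes w T an invariant. *)
Lemma double_decomp sh r : sh = DoubleDiff \/ sh = DoubleProd ->
  subalg_gen (shape_gens E F P sh) r ->
  exists (h : {poly K}) w, R1 E F P sh w /\
    r = horner_alg (double_gen sh) h + w * shape_f E F P sh.
Proof.
move=> hsh hr; set f := shape_f E F P sh; set g := shape_g E F P sh.
have R1_0 : R1 E F P sh 0.
  by exists 0, 0; rewrite !mul0r addr0; split=> //; apply: subalg_gen0.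
have R1D w w' : R1 E F P sh w -> R1 E F P sh w' -> R1 E F P sh (w + w').
  move=> [w1 [w2 [h1 h2 ->]]] [w3 [w4 [h3 h4 ->]]].
  by exists (w1 + w3), (w2 + w4); rewrite !mulrDl addrACA; split=> //; apply: subalg_gen_add.
have R1f : R1 E F P sh f.
  by exists 1, 0; rewrite mul1r mul0r addr0; split=> //; [apply: subalg_gen1 | apply: subalg_gen0].
have R1g : R1 E F P sh g.
  by exists 0, 1; rewrite mul1r mul0r add0r; split=> //; [apply: subalg_gen0 | apply: subalg_gen1].
have R0h (h : {poly K}) : subalg_gen (shape_gens E F P sh) (horner_alg (double_gen sh) h).
  elim/poly_ind: h => [|h c IH]; first by rewrite raddf0; apply: subalg_gen0.
  rewrite rmorphD rmorphM /= horner_algX horner_algC.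
  apply: subalg_gen_add; last exact: subalg_gen_scal.
  apply: subalg_gen_mul => //; apply: subalg_gen_gen.
  by rewrite /double_gen; case: hsh => ->; rewrite !inE eqxx ?orbT.
have R1gen w : R1 E F P sh w -> subalg_gen [:: E; F; P] w.
  move=> [w1 [w2 [h1 h2 ->]]]; apply: subalg_gen_add; apply: subalg_gen_mul;
    by [apply: shape_gens_gen h1 | apply: shape_gens_gen h2 | apply: shape_f_gen | apply: shape_g_gen].
elim: hr => {r} [r hr|c|r r' _ [h [w [wR rE]]] _ [h' [w' [wR' rE']]]|
    r r' hr [h [w [wR rE]]] _ [h' [w' [wR' rE']]]].
- have [C [hh [X1 [X2 [X3 [hE hF hP]]]]]] := commuting_hom EF EP FP.
  move: hr R1_0 R1f R1g; rewrite /f /g /double_gen; case: hsh => ->;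
    rewrite /shape_gens /shape_f /shape_g !inE => /or3P [] /eqP -> R1_0 R1f R1g.
  + by exists 'X, 0; rewrite horner_algX mul0r addr0.
  + exists ((2 * tau)%:P * 'X), (E - F); rewrite rmorphM /= horner_algX horner_algC.
    split=> //; rewrite mulr_algl -scalerA -EFP.
    rewrite mulrBl !mulrBr -EF !expr2.
    by move: (a * a * (b * b)) => ef; nc_ring K A.
  + exists 0, (P * (E + F)); rewrite raddf0 add0r; split=> //.
    by rewrite -hE -hF -hP -!(rmorphXn, rmorphM, rmorphN, rmorphD); congr (hh _); ring.
  + by exists 0, P; rewrite raddf0 add0r expr2.
  + by exists 'X, 0; rewrite horner_algX mul0r addr0.
  + exists 0, (E ^+ 2 - F ^+ 2); rewrite raddf0 add0r; split=> //.
    by rewrite -hE -hF -hP -!(rmorphXn, rmorphM, rmorphN, rmorphD); congr (hh _); ring.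
- by exists c%:P, 0; rewrite horner_algC mul0r addr0.
- exists (h + h'), (w + w'); split; first exact: R1D.
  by rewrite rE rE' rmorphD /= mulrDl addrACA.
- exists (h * h'), (r * w' + horner_alg (double_gen sh) h' * w); split.
    by apply: R1D; apply: R1_mul.
  rewrite rE' rmorphM /= mulrDr {1}rE !mulrDl -!mulrA addrAC addrA; congr (_ + _ + _).
  rewrite (EFP_comm (shape_f_gen sh) (shape_gens_gen (R0h h'))).
  by rewrite !mulrA (EFP_comm (R1gen _ wR) (shape_gens_gen (R0h h'))).
Qed.

End ShapeModel.

(** * The hypotheses of the dimension argument for the actual invariants *)

Section NotRegular.
Variables (R : realType) (k : kashina) (H : hopfAlg R[i]) (x y z : H).
Hypothesis hH : is_kashina k x y z.
Variables (p : rep2) (q : quadric) (alpha : R[i]).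
Hypothesis alpha0 : alpha != 0.
Variables (sx sz : bool) (A : cgAlg R[i]) (u v t : A).
Hypothesis hA : quadric_Ore q alpha u v t.
Variable rho : hopfAction H A.
Hypothesis hact : acts_as k p sx sz x y z u v t rho.

Local Notation K := (R[i]).
Local Notation a := (diagA 'i%C q u v).
Local Notation b := (diagB 'i%C q u v).
Local Notation tau := (diag_sign K q).
Local Notation E := (a ^+ 2).
Local Notation F := (b ^+ 2).
Local Notation P := (a * b).
Local Notation T := (t ^+ 2).
Local Notation sh := (shape_of k p q).
Local Notation f := (shape_f E F P sh).
Local Notation g := (shape_g E F P sh).
Local Notation PP := {poly {poly K}}.

Let im2 : ('i%C : K) ^+ 2 = -1. Proof. by rewrite sqr_i. Qed.
Let two := @complex_two R.
Let tau2 : tau * tau = 1.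
Proof. by rewrite /diag_sign; case: (q); rewrite ?mulrNN mulr1. Qed.

Lemma invariant_div w : act_invariant rho (w * T ^+ 2) -> act_invariant rho w.
Proof.
have [xE xF xP xT] := act_x_EFP hH hA hact.
have [yE yF yP yT] := act_y_EFP hH q hact.
have [zE zF zP zT] := act_z_EFP hH hA hact.
have T2_inj r r' : r * T ^+ 2 = r' * T ^+ 2 -> r = r'.
  move=> e; apply/subr0_eq; do 4!apply: (quadric_Ore_regular hA).
  transitivity (r * T ^+ 2 - r' * T ^+ 2); last by rewrite e subrr.
  by nc_ring constr:(K) A.
have xD : rho x (T ^+ 2) = T ^+ 2 by rewrite (act_xX hH) xT sqrrN.
have yD : rho y (T ^+ 2) = T ^+ 2 by rewrite (act_yX hH) yT.
have zD : rho z (T ^+ 2) = T ^+ 2 by rewrite (act_z_evenX hH) // zT.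
move=> /(act_invariantP hH) [xw yw zw]; apply/(act_invariantP hH); split; apply: T2_inj.
- by rewrite -{1}xD -(act_xM hH).
- by rewrite -{1}yD -(act_yM hH).
(* x^2 fixes T^2, so the twist cancels although w need not be fixed by y at this point. *)
- rewrite -[RHS]zw (act_zM hH) zD !xD; have two' := two.
  move: (rho z w) (rho y (rho z w)) (T ^+ 2) => w1 w2 w3.
  by nc_prep constr:(K) A; repeat split; field.
Qed.

(** As theta kills t and f, the hypothesis on r gives theta(r) theta(g) = 0, and theta(g) is
    regular. So theta kills r, and also its part r0 = h(double_gen) + w f in R0. This forces h(kap)
    = 0, and h = 0 because kap is not constant. Then r - r0 lies in A t and r0 = w f. *)
Lemma theta_sum (theta : {rmorphism A -> 'M[{poly K}]_2}) (kap d : {poly K}) :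
  (forall e, theta (e%:A) = (e%:P)%:M) -> theta t = 0 -> sh = DoubleDiff \/ sh = DoubleProd ->
  theta f = 0 -> theta (double_gen a b sh) = kap%:M -> (1 < size kap)%N ->
  theta g * theta g = d%:M -> d != 0 ->
  forall r w1 w2, act_invariant rho r -> r * g = w1 * T + w2 * f ->
  exists i w, [/\ act_invariant rho i, in_At t i, R1 E F P sh w & r = i + w * f].
Proof.
move=> theta_scal tt hsh tf tw kap1 tg d0 r w1 w2 ir rg.
have tM w w' : theta (w * w') = theta w * theta w' by apply: rmorphM.
have tD w w' : theta (w + w') = theta w + theta w' by apply: raddfD.
have tT : theta T = 0 by rewrite tM tt mulr0.
have tr : theta r = 0.
  have [h _] := scalar_mx_regular (theta r) tg d0; apply: h.
  by rewrite -tM rg tD (tM w1) (tM w2) tT tf !mulr0 addr0.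
have [r0 [r1 [r2 [r3 [h0 h1 h2 h3 rE]]]]] := invariant_decomp hH hA hact ir.
have [h [w [wR r0E]]] :=
  double_decomp (comm_EF hA) (comm_EP hA) (comm_FP hA) (mul_EF hA) hsh h0.
exists (r - r0), w; split=> //.
- apply: act_invariantD => //; rewrite -scaleN1r; apply: act_invariantZ.
  exact: (R0_invariant hH hA hact h0).
- exists (r1 * t ^+ 3 + r2 * f * t + r3 * g * t); rewrite rE.
  by move: f g => f' g'; nc_ring constr:(K) A.
have tr0 : theta r0 = 0.
  move: tr; rewrite rE !tD (tM r1) (tM r2) (tM r3) (tM T T) (tM f T) (tM g T) tT.
  by rewrite !mulr0 !addr0.
have thh (h' : {poly K}) : theta (horner_alg (double_gen a b sh) h') = (h' \Po kap)%:M.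
  elim/poly_ind: h' => [|h' e IH]; first by rewrite comp_poly0 !raddf0.
  rewrite rmorphD rmorphM /= horner_algX horner_algC tD tM IH theta_scal.
  by rewrite tw comp_polyD comp_polyM comp_polyX comp_polyC raddfD /= [in RHS]scalar_mxM.
have h00 : h = 0.
  apply/eqP; rewrite -(comp_poly_eq0 h kap1).
  move: tr0; rewrite r0E tD thh tM tf mulr0 addr0 => /matrixP/(_ ord0 ord0).
  by rewrite !mxE eqxx mulr1n => ->.
by rewrite -[LHS](subrK r0); congr (_ + _); rewrite r0E h00 raddf0 add0r.
Qed.

Section Model.
Variables (sigma : {rmorphism K -> 'M[PP]_2}) (psi : {rmorphism A -> 'M[PP]_2}).
Hypotheses (psi_a : psi a = model_a K q) (psi_b : psi b = model_b K)
  (sigmaE : forall c, sigma c = (c%:P%:P)%:M) (psiZ : forall c w, psi (c *: w) = sigma c * psi w)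
  (psi_t : psi t = 0) (psi_ker : forall w, psi w = 0 -> in_At t w).

Let in_AtP w : in_At t w <-> psi w = 0.
Proof. by split=> [[w' ->]|/psi_ker //]; rewrite rmorphM psi_t mulr0. Qed.

Let psi_E : psi E = ('X%:P ^+ 2)%:M.
Proof.
rewrite rmorphXn /= psi_a.
apply: mx2P; rewrite expr2 ?(mxE, big_ord_recl, big_ord0) /= ?(mxE, big_ord_recl, big_ord0) /=.
- by ring.
- by ring.
- by ring.
have h : tau%:P%:P * tau%:P%:P = 1 :> PP by rewrite -!rmorphM /= tau2 !rmorph1.
by ring: h.
Qed.

Let psi_F : psi F = ('X ^+ 2)%:M.
Proof.
rewrite rmorphXn /= psi_b.
by apply: mx2P; rewrite expr2 ?(mxE, big_ord_recl, big_ord0) /= ?(mxE, big_ord_recl, big_ord0) /=; ring.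
Qed.

Let psi_P : psi P * psi P = (tau%:P%:P * 'X%:P ^+ 2 * 'X ^+ 2)%:M.
Proof.
have -> : psi P * psi P = psi (tau *: (E * F)).
  by rewrite (mul_EF hA) scalerA tau2 scale1r (expr2 P) (rmorphM psi P).
have sM (c d : PP) : c%:M * d%:M = (c * d)%:M :> 'M_2 by rewrite [RHS]scalar_mxM.
by rewrite psiZ sigmaE (rmorphM psi E) psi_E psi_F !sM mulrA.
Qed.

Let tau_neq0 : tau != 0.
Proof. by rewrite /diag_sign; case: (q); rewrite ?oppr_eq0 oner_eq0. Qed.

Let f_sq : exists2 d : PP, d != 0 & psi f * psi f = d%:M.
Proof.
have X0 : 'X%:P != 0 :> PP by rewrite polyC_eq0 polyX_eq0.
have e0 (w : PP) : w.[0] = 'X ^+ 2 -> w != 0.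
  move=> w0; apply/eqP => e; move: w0; rewrite e horner0 => /esym/eqP.
  by rewrite expf_eq0 /= polyX_eq0.
have h := shape_f_square psi_E psi_F psi_P sh.
apply: h; rewrite ?polyC_eq0 ?polyX_eq0 //.
  by rewrite -subr_eq0; apply: e0; rewrite !hornerE /= expr0n subr0.
by apply: e0; rewrite !hornerE /= expr0n addr0.
Qed.

Let f_regr w : in_At t (w * f) -> in_At t w.
Proof.
move=> /in_AtP; rewrite rmorphM => wf0; apply/in_AtP.
by have [d d0 dE] := f_sq; have [h _] := scalar_mx_regular (psi w) dE d0; apply: h.
Qed.

Let f_regl w : in_At t (f * w) -> in_At t w.
Proof.
move=> /in_AtP; rewrite rmorphM => wf0; apply/in_AtP.
by have [d d0 dE] := f_sq; have [_ h] := scalar_mx_regular (psi w) dE d0; apply: h.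
Qed.

Let fixed_by (L : {lrmorphism A -> A}) : L u = u -> L v = v -> L a = a /\ L b = b.
Proof.
move=> Lu Lv; rewrite /diagA /diagB.
have LZ c w : L (c *: w) = c *: L w by rewrite linearZ.
by case: (q); rewrite ?(raddfD, raddfN) /= ?LZ ?Lu ?Lv.
Qed.

Let gens_fixed (L : {lrmorphism A -> A}) : L u = u -> L v = v ->
  forall w, subalg_gen [:: E; F; P] w -> L w = w.
Proof.
move=> Lu Lv w; have [La Lb] := fixed_by Lu Lv.
elim=> {w} [w|c|w w' _ IH _ IH'|w w' _ IH _ IH'].
- by rewrite !inE => /or3P [] /eqP ->; rewrite ?rmorphXn ?rmorphM /= ?La ?Lb.
- by rewrite linearZ /= rmorph1.
- by rewrite rmorphD /= IH IH'.
- by rewrite rmorphM /= IH IH'.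
Qed.

(** The automorphism t -> -t fixes all invariants, hence negates w; but it is the identity modulo t,
    so 2 w vanishes there. *)
Lemma odd_in_At w w' : act_invariant rho w' -> w' = w * t ^+ 3 -> in_At t w.
Proof.
have [|L [Lu Lv Lt]] := @diagonal_morph _ _ _ _ _ _ _ hA 1 1 (-1); first by [].
rewrite !scale1r scaleN1r in Lu Lv Lt.
have psiL r : psi (L r) = psi r.
  elim/(quadric_Ore_ind hA): r => [||r r' IH IH'|c r IH|r r' IH IH'|||].
  - by rewrite !raddf0.
  - by rewrite !rmorph1.
  - by rewrite !rmorphD /= IH IH'.
  - by rewrite linearZ /= !psiZ IH.
  - by rewrite !rmorphM /= IH IH'.
  - by rewrite Lu.
  - by rewrite Lv.
  - by rewrite Lt rmorphN psi_t oppr0.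
have Linv r : act_invariant rho r -> L r = r.
  move: r; apply: (invariant_ind hH hA hact) => [|r r' IH IH'|c r IH|s m j l _].
  - by rewrite raddf0.
  - by rewrite rmorphD /= IH IH'.
  - by rewrite linearZ /= IH.
  - rewrite /orbit_sum rmorphM rmorphXn /= (gens_fixed Lu Lv); last by in_subalg.
    by rewrite rmorphXn /= Lt sqrrN.
move=> /Linv e wE; apply/in_AtP.
have wN : L w = - w.
  move: e; rewrite wE rmorphM rmorphXn /= Lt => e.
  apply/subr0_eq; do 3!apply: (quadric_Ore_regular hA).
  transitivity (w * t ^+ 3 - L w * (- t) ^+ 3); last by rewrite e subrr.
  by move: (L w) => w1; nc_ring constr:(K) A.
have : psi w = - psi w by rewrite -[LHS]psiL wN rmorphN.
move=> /matrixP h; apply/matrixP => i j; have := h i j; rewrite !mxE => e'.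
have two' : (2 : PP) != 0.
  by rewrite -(rmorph_nat (polyC \o polyC : {rmorphism K -> PP})) /= !polyC_eq0.
apply: (mulfI two'); rewrite mulr0 mulr2n mulrDl mul1r {1}e' addNr //.
Qed.

(** The substitution t -> 0 kills w and the terms containing T, and fixes the part in R0, which is
    therefore 0. *)
Lemma invariant_in_At w : act_invariant rho w -> in_At t w -> exists r1 r2 r3,
  [/\ act_invariant rho r1, act_invariant rho r2, act_invariant rho r3
    & w = r1 * T ^+ 2 + r2 * (f * T) + r3 * (g * T)].
Proof.
move=> /(invariant_decomp hH hA hact) [r0 [r1 [r2 [r3 [h0 h1 h2 h3 wE]]]]] [w' w'E].
exists r1, r2, r3; split=> //.
have [|L [Lu Lv Lt]] := @diagonal_morph _ _ _ _ _ _ _ hA 1 1 0; first by [].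
rewrite !scale1r scale0r in Lu Lv Lt.
suff r00 : r0 = 0 by rewrite wE r00 add0r.
rewrite -(gens_fixed Lu Lv (shape_gens_gen h0)).
have LT c d : L (c * d * T) = 0 by rewrite rmorphM rmorphXn /= Lt expr0n mulr0.
have : L w = 0 by rewrite w'E rmorphM /= Lt mulr0.
rewrite wE !rmorphD /= expr2 !(mulrA r1) !(mulrA r2) !(mulrA r3) !LT.
by rewrite !addr0.
Qed.

Lemma augmentation : exists Lam : {rmorphism A -> {poly K}},
  [/\ Lam f = 0, Lam g = 0 & Lam t = 'X].
Proof.
have cC : central_morph (polyC : {rmorphism K -> {poly K}}) by move=> c w; rewrite mulrC.
have rel0 : quadric_rel q (0 : {poly K}) 0 = 0.
  by case: (q); rewrite /= ?mulr0 ?expr0n /= ?subrr ?addr0.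
have [||Lam [Lu Lv Lt LZ]] := quadric_Ore_univ hA (e := 'X) cC rel0;
  rewrite ?mulr0 ?mul0r //.
have [La Lb] : Lam a = 0 /\ Lam b = 0.
  rewrite /diagA /diagB.
  by case: (q); rewrite ?(raddfD, raddfN) /= ?LZ ?Lu ?Lv ?mulr0 ?oppr0 ?addr0.
have LE : Lam E = 0 by rewrite rmorphXn /= La expr0n.
have LF : Lam F = 0 by rewrite rmorphXn /= Lb expr0n.
have LP : Lam P = 0 by rewrite rmorphM /= La mul0r.
have Lsq w : Lam w = 0 -> Lam (w ^+ 2) = 0 by move=> w0; rewrite rmorphXn /= w0 expr0n.
exists Lam; split=> //; rewrite /shape_f /shape_g; case: sh;
  rewrite ?(rmorphM Lam P) ?raddfB ?raddfD ?raddf0 /= ?Lsq ?LE ?LF ?LP ?mul0r ?subrr ?addr0 //.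
Qed.

Section Theta.
Variable c : {poly K}.
(** Specializes the outer variable, the one of b, to the polynomial [c] in the variable of a; [c] is
    chosen so that f vanishes. *)
Definition theta : {rmorphism A -> 'M[{poly K}]_2} := map_mx (horner_eval c) \o psi.

Lemma theta_E : theta E = ('X ^+ 2)%:M.
Proof.
by rewrite /theta /= psi_E map_scalar_mx /= /horner_eval !hornerE.
Qed.

Lemma theta_F : theta F = (c ^+ 2)%:M.
Proof. by rewrite /theta /= psi_F map_scalar_mx /= /horner_eval !hornerE. Qed.

Lemma theta_P : theta P * theta P = (tau%:P * 'X ^+ 2 * c ^+ 2)%:M.
Proof.
transitivity (map_mx (horner_eval c) (psi P * psi P)); first by rewrite [RHS]map_mxM.
by rewrite psi_P map_scalar_mx /= /horner_eval !hornerE.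
Qed.

Lemma theta_scal e : theta (e%:A) = (e%:P)%:M.
Proof.
rewrite /theta /= psiZ rmorph1 mulr1 sigmaE map_scalar_mx /= /horner_eval.
by rewrite hornerC.
Qed.

Lemma theta_t : theta t = 0.
Proof. by rewrite /theta /= psi_t map_mx0. Qed.

End Theta.

Lemma double_sum : g = 0 \/ forall r w1 w2, act_invariant rho r -> r * g = w1 * T + w2 * f ->
  exists i w, [/\ act_invariant rho i, in_At t i, R1 E F P sh w & r = i + w * f].
Proof.
have tM (th : {rmorphism A -> 'M[{poly K}]_2}) w w' : th (w * w') = th w * th w'.
  exact: rmorphM.
have sM (e e' : {poly K}) : e%:M * e'%:M = (e * e')%:M :> 'M_2 by rewrite [RHS]scalar_mxM.
have X0 n : 'X^n != 0 :> {poly K} by rewrite expf_neq0 ?polyX_eq0.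
have tD (th : {rmorphism A -> 'M[{poly K}]_2}) w w' : th (w + w') = th w + th w'.
  exact: raddfD.
have tB (th : {rmorphism A -> 'M[{poly K}]_2}) w w' : th (w - w') = th w - th w'.
  exact: raddfB.
have sD (e e' : {poly K}) : e%:M + e'%:M = (e + e')%:M :> 'M_2 by rewrite [RHS]raddfD.
have t2 (th : {rmorphism A -> 'M[{poly K}]_2}) w e : th w = e%:M -> th (w ^+ 2) = (e * e)%:M.
  by move=> we; rewrite expr2 tM we sM.
have : g = 0 \/ sh = DoubleDiff \/ sh = DoubleProd.
  by rewrite /shape_g; case: sh; auto.
case=> [|[] she]; first by left.
(* With both variables equal to X, f = E - F vanishes, P^2 becomes tau X^4, and g = P (E + F) has a
   nonzero scalar square. *)
- right; apply: (@theta_sum (theta 'X) (tau%:P * 'X ^+ 4) (tau%:P * 'X ^+ 2 * 'X ^+ 2 * ((2%:P * 'X^2) * (2%:P * 'X^2)))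
    (theta_scal _) (theta_t _)).
  + by left.
  + by rewrite she /shape_f tB theta_E theta_F subrr.
  + by rewrite she /double_gen expr2 tM theta_P; congr (_%:M); ring.
  + by rewrite size_Cmul // size_polyXn.
  + rewrite she /shape_g; apply: (mul_P_square (theta_P _)).
    by rewrite tD theta_E theta_F sD; congr (_%:M); rewrite polyCD polyC1; ring.
  + by rewrite !mulf_neq0 ?polyC_eq0 ?polyX_eq0 ?tau_neq0 ?two.
(* With b sent to 0, f = P vanishes, and both E^2 + F^2 and g = E^2 - F^2 become X^4. *)
- have tE := t2 _ _ _ (theta_E 0); have tF := t2 _ _ _ (theta_F 0).
  have [eqE eqF] : ('X^2 * 'X^2 = 'X^4 :> {poly K}) /\ ((0 : {poly K}) ^+ 2 * 0 ^+ 2 = 0).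
    by split; ring.
  rewrite eqE in tE; rewrite eqF in tF.
  have tEF : theta 0 (E ^+ 2 - F ^+ 2) = 'X^4%:M by rewrite tB tE tF raddf0 subr0.
  right; apply: (@theta_sum (theta 0) ('X ^+ 4) ('X ^+ 4 * 'X ^+ 4)
    (theta_scal _) (theta_t _)).
  + by right.
  + rewrite she /shape_f tM (_ : theta 0 b = 0) ?mulr0 // /theta /= psi_b.
    apply/matrixP => i j; rewrite !mxE; case: ifP => _; by rewrite /horner_eval ?horner0 ?hornerX.
  + by rewrite she /double_gen tD tE tF raddf0 addr0.
  + by rewrite size_polyXn.
  + by rewrite she /shape_g tEF sM.
  + by rewrite mulf_neq0.
Qed.

Lemma invariants_infinite_gldim : ~ finite_gldim (inv_cgAlg rho).
Proof.
have inv w : act_invariant rho w -> exists r : invariants rho, val r = w.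
  by move=> hw; exists (Invariants (asboolT hw)).
have invP (r : invariants rho) : act_invariant rho (val r) by apply/asboolP/inv_valP.
have [D iD] : exists r : invariants rho, val r = T ^+ 2.
  apply: inv; apply: (all_gens_invariant hH hA hact).
  by rewrite /all_gens mem_cat !inE eqxx ?orbT.
have [Phi iPhi] : exists r : invariants rho, val r = f * T.
  apply: inv; apply: (all_gens_invariant hH hA hact).
  by rewrite /all_gens mem_cat !inE eqxx ?orbT.
have [Gam iGam] : exists r : invariants rho, val r = g * T.
  apply: inv; apply: (all_gens_invariant hH hA hact).
  by rewrite /all_gens mem_cat !inE eqxx ?orbT.
have [Lam [Lf Lg Lt]] := augmentation.
have lam0 : alpha ^+ 4 != 0 by rewrite expf_neq0.
have [[mu mu0 Tf] [nu nu0 Tg]] := shape_scal lam0 (t2_E hA) (t2_F hA) (t2_P hA) sh.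
have T_inj w w' : w * T = w' * T -> w = w'.
  move=> e; apply/subr0_eq; do 2!apply: (quadric_Ore_regular hA).
  transitivity (w * T - w' * T); last by rewrite e subrr.
  by nc_ring constr:(K) A.
have [||||iota iotaE] := @lrmorphism_ex K (invariants rho) A val; try by [].
have iota_inj : injective iota by move=> r r'; rewrite !iotaE; apply: val_inj.
rewrite -iotaE in iD; rewrite -iotaE in iPhi; rewrite -iotaE in iGam.
have iM (r r' : invariants rho) : iota (r * r') = iota r * iota r' by apply: rmorphM.
have iA (r r' : invariants rho) : iota (r + r') = iota r + iota r' by apply: raddfD.
have main := (@infinite_gldim K A (invariants rho) iota
  t f g D Phi Gam mu nu iota_inj (quadric_Ore_regular hA) (quadric_Ore_swap hA)
  (quadric_Ore_cancel hA) iD iPhi iGam Tf Tg mu0 nu0 _ f_regr f_regl _ _ _ Lam Lf Lg Lt).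
apply: main.
- exact: (shape_fg (comm_EF hA) (comm_EP hA) (comm_FP hA)).
- move=> w r e; have [|r' <-] := inv w; last by exists r'; rewrite iotaE.
  by apply: invariant_div; rewrite -e iotaE; apply: invP.
- by move=> w r; rewrite iotaE; apply: odd_in_At; apply: invP.
- move=> r; rewrite iotaE => /(invariant_in_At (invP r)).
  move=> [w1 [w2 [w3 [/inv [r1 <-] /inv [r2 <-] /inv [r3 <-] rE]]]].
  exists r1, r2, r3; apply: iota_inj; rewrite !iA !iM iD iPhi iGam !iotaE.
  exact: rE.
case: double_sum => [g0|hs]; [by left | right] => r [p1 [q1 e]].
have rg : val r * g = val p1 * T + val q1 * f.
  apply: T_inj; move: e => /(congr1 iota); rewrite iA !iM iD iPhi iGam !iotaE => e'.
  by rewrite -(mulrA (val r)) e' mulrDl (expr2 T) (mulrA (val p1)) (mulrA (val q1)).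
have [i [w [/inv [i' iE] iT [w1 [w2 [h1 h2 wE]]] rE]]] := hs _ _ _ (invP r) rg.
(* The factor mu^-1 compensates for moving T past f: with it, w' Phi = w f D, so that w f is the
   image of w' under division by D. *)
have [w' w'E] : exists w' : invariants rho, val w' = mu^-1 *: (w * T).
  apply/inv/act_invariantZ; rewrite wE mulrDl -!mulrA -iPhi -iGam !iotaE.
  apply: act_invariantD; apply: act_invariantM => //.
    exact: (R0_invariant hH hA hact h1).
  exact: (R0_invariant hH hA hact h2).
have r'E : iota (r - i') = w * f.
  have -> : iota (r - i') = iota r - iota i' by apply: raddfB.
  by rewrite !iotaE rE iE addrC addKr.
exists i', w', (r - i'); split.
- by rewrite iotaE iE.
- by rewrite iotaE w'E; exists (mu^-1 *: (w * t)); nc_ring constr:(K) A.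
- apply: iota_inj; rewrite !iM r'E iD iPhi iotaE w'E.
  have -> : mu^-1 *: (w * T) * (f * T) = mu^-1 *: (w * (T * f) * T).
    by move: f => f'; nc_ring constr:(K) A.
  rewrite Tf -(scalerAr mu) -scalerAl scalerA mulVf // scale1r.
  by move: f => f'; nc_ring constr:(K) A.
- by rewrite addrC subrK.
Qed.

End Model.

Lemma invariants_not_regular : ~ AS_regular (inv_cgAlg rho).
Proof.
have [sigma [psi [psi_a psi_b [sigmaE psiZ] psi_t psi_ker]]] :=
  quadric_Ore_model hA im2 two.
by move=> [gl _ _]; apply: (invariants_infinite_gldim psi_a psi_b sigmaE psiZ psi_t psi_ker gl).
Qed.

End NotRegular.

Theorem theorem4p7 (R : realType) (k : kashina) (H : hopfAlg R[i]) (x y z : H)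
    (hH : is_kashina k x y z)
    (p : rep2) (q : quadric) (alpha : R[i]) (halpha : alpha != 0)
    (sx sz : bool) (A : cgAlg R[i]) (u v t : A)
    (hA : quadric_Ore q alpha u v t) :
  (exists rho : hopfAction H A, acts_as k p sx sz x y z u v t rho) /\
  (forall rho : hopfAction H A, acts_as k p sx sz x y z u v t rho ->
    [/\ inner_faithful rho,
        forall f : A, act_invariant rho f <-> subalg_gen (inv_gens k p q u v t) f,
        ~ AS_regular (inv_cgAlg rho)
      & ~ reflection_Hopf rho]).
Proof.
split=> [|rho hact].
  exact: (kashina_acts hH p sx sz hA).
split.
- exact: (acts_inner_faithful hH hA hact).
- exact: (invariant_ring hH hA hact).
- exact: (invariants_not_regular hH halpha hA hact).
- by move=> [_ _]; apply: (invariants_not_regular hH halpha hA hact).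
Qed.
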